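(* Let $\psi\in L^2(\mathbb{R})$ with $\widehat{\psi}(\xi)=0$ for $\xi<0$. The following are equivalent. (i) There exist constants $a\in\mathbb{R}$, $b\in\mathbb{R}^+$ and a $\mathcal{C}^\infty$ function $f\colon\mathbb{R}\times\mathbb{R}^+\to\mathbb{C}$ with $f(x,y)\neq0$ for all $(x,y)$ such that, for every $s\in L^2(\mathbb{R})$, the function $$h\colon\{z\in\mathbb{C}:\operatorname{Im}(z)>0\}\to\mathbb{C},\qquad x+iy\mapsto f(x,y)\,W_\psi s(x-aby,\,by)$$ is analytic. (ii) There exist constants $c\in\mathbb{C}$, $\alpha>-1$, $\beta\in\mathbb{R}$, and $\gamma\in\mathbb{C}$ with $\operatorname{Re}(\gamma)>0$ such that $$\widehat{\psi}(\xi)=c\,\xi^{\frac{\alpha-1}{2}}e^{-2\pi\gamma\xi}e^{i\beta\log\xi}\qquad\text{for all }\xi>0.$$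
   Context: $\mathbb{R}^+=(0,\infty)$. The Fourier transform is $\widehat{f}(\xi)=\int_{\mathbb{R}}f(t)e^{-2\pi i\xi t}\,dt$ (extended to $L^2(\mathbb{R})$); pointwise conditions on $\widehat\psi$ are understood almost everywhere. For $s,\psi\in L^2(\mathbb{R})$ the continuous wavelet transform is $$W_\psi s(x,y)=\frac{1}{\sqrt{y}}\int_{\mathbb{R}}s(t)\,\overline{\psi\!\left(\frac{t-x}{y}\right)}\,dt,\qquad x\in\mathbb{R},\ y\in\mathbb{R}^+.$$ The constants $a,b$ and the function $f$ in (i) do not depend on $s$. *)

(* Defs.v *)
From HB Require Import structures.
From mathcomp Require Import all_boot all_order all_algebra.
From mathcomp Require Import complex.
From mathcomp Require Import all_classical all_reals all_analysis.

Set Implicit Arguments.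
Unset Strict Implicit.
Unset Printing Implicit Defensive.

Import Order.TTheory GRing.Theory Num.Theory.
Import numFieldNormedType.Exports.
Import ComplexField.Normc.

Local Open Scope classical_set_scope.
Local Open Scope ring_scope.
Local Open Scope complex_scope.

(* [normc] is the modulus of [R[i]] with values in [R]; the generic [`|z|] has
   values in [R[i]]. *)

Section Defs.
Context {R : realType}.
Implicit Types (f g s psi : R -> R[i]) (z : R[i]).

Local Notation mu := (@lebesgue_measure R).

Definition cexp z : R[i] :=
  (expR (complex.Re z) * cos (complex.Im z))
    +i* (expR (complex.Re z) * sin (complex.Im z)).

Definition cintegral f : R[i] :=
  (\int[mu]_t complex.Re (f t)) +i* (\int[mu]_t complex.Im (f t)).

Definition L2norm f : \bar R := 'N[mu]_2%:E[(fun t => (normc (f t))%:E)].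

(* Elements of L^2(R) are handled through Borel measurable representatives. *)
Definition L2 f : Prop :=
  [/\ measurable_fun setT (fun t => complex.Re (f t)),
      measurable_fun setT (fun t => complex.Im (f t))
    & (L2norm f < +oo)%E].

Definition fourierL1 f (xi : R) : R[i] :=
  cintegral (fun t => f t * cexp (0 +i* (- (2 * pi * xi * t)))).

Definition truncation f (n : nat) (t : R) : R[i] :=
  if `|t| <= n%:R then f t else 0.

(* [g] represents the L^2 Fourier transform of [f]: it is the limit in L^2(R)
   of the Fourier integrals of the truncations of [f], which lie in
   L^1(R) `&` L^2(R) and converge to [f] in L^2(R). *)
Definition is_fourier f g : Prop :=
  L2 g /\
  L2norm (fun xi => fourierL1 (truncation f n) xi - g xi) @[n --> \oo] --> 0%E.

(* A representative exists for every [f] in L^2(R) (Plancherel) and is unique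
   up to a null set; only almost-everywhere properties are meaningful. *)
Definition fourier f : R -> R[i] := xget (fun=> 0) [set g | is_fourier f g].

Definition wavelet psi s (x y : R) : R[i] :=
  ((Num.sqrt y)^-1)%:C * cintegral (fun t => s t * conjc (psi ((t - x) / y))).

Fixpoint Ck_on (U : set (R * R)) (k : nat) (u : R * R -> R) : Prop :=
  (forall p, U p -> {for p, continuous u}) /\
  (if k is k'.+1 then
     [/\ forall p, U p -> derivable u p (1, 0) /\ derivable u p (0, 1),
         Ck_on U k' (fun p => 'D_(1, 0) u p)
       & Ck_on U k' (fun p => 'D_(0, 1) u p)]
   else True).

(* Smoothness on an open set [U]: values outside [U] are irrelevant, since all
   the (iterated) partial derivatives at points of [U] are local. *)
Definition smooth_on (U : set (R * R)) (f : R -> R -> R[i]) : Prop :=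
  forall k, Ck_on U k (fun p => complex.Re (f p.1 p.2)) /\
            Ck_on U k (fun p => complex.Im (f p.1 p.2)).

(* [derivable h z 1] over the base field [R[i]] is complex differentiability. *)
Definition analytic_on (U : set R[i]) (h : R[i] -> R[i]) : Prop :=
  forall z, U z -> derivable (h : R[i]^o -> R[i]^o) z 1.

Definition upper_half_plane : set R[i] := [set z | 0 < complex.Im z].

End Defs.

(* Main.v *)
Require Import Defs.
From HB Require Import structures.
From mathcomp Require Import all_boot all_order all_algebra.
From mathcomp Require Import complex.
From mathcomp Require Import all_classical all_reals all_analysis.
From mathcomp Require Import measurable_realfun ring lra.

Set Implicit Arguments.
Unset Strict Implicit.
Unset Printing Implicit Defensive.

Import Order.TTheory GRing.Theory Num.Theory.
Import numFieldNormedType.Exports.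

Local Open Scope classical_set_scope.
Local Open Scope ring_scope.
Local Open Scope complex_scope.

(** By Parseval, the wavelet transform is an integral of [conjc (fourier psi)]
    against [fourier s] and characters, and for [fourier psi] of the form (ii)
    a dilation turns it into an explicit factor times the Laplace transform of
    a fixed function at [x + iy].  Conversely, take for [s] the signal whose
    spectrum is the indicator of [[p/b, q/b]]: up to scalars the transform is
    the integral over [[py, qy]] of [phi u = conjc (fourier psi u) *
    exp (- 2 pi i a u)] times [exp (2 pi i u x / (b y))].  The Cauchy-Riemann
    equation of [h] at the point [i] reads [q phi(q) - p phi(p) =
    int_p^q (A - w u) phi(u) du] with constants [A] and [w = 2 pi / b] that do
    not depend on [p] and [q], so [u phi(u)] agrees almost everywhere with a
    solution of [G' = (A / u - w) G], that is, a multiple of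
    [u^A exp (- w u)]. *)

(** The spectrum of [psi] is known only up to null sets, so the values [phi p] and [phi q] in the
    Cauchy-Riemann equation have a meaning only where the primitive of [phi] is differentiable with
    derivative [phi]. Such points have full measure, and the equation is used at them alone. The
    single point [i] is enough because the freedom lies in [p] and [q]: the derivative in [y] moves
    the ends of [[py, qy]] and produces boundary values, the derivative in [x] multiplies the
    integrand by [u], and [f] enters only through its value and first partials at [(0, 1)]. Parseval
    is needed in two forms: the integrable spectrum is that of [psi] for sufficiency and that of the
    signal for necessity. Both reduce to Fubini for truncations and to a passage to the limit in
    L^2, which the energy bound for the Fourier transform permits; the first form also needs [psi]
    to be recovered from its spectrum. Abel weights in frequency, which become Poisson averages in
    time, give both the energy bound and the inversion formula. *)

Local Notation normc := ComplexField.Normc.normc.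

(** * Complex numbers *)

Section ComplexNumbers.
Context {R : realType}.
Implicit Types (z w : R[i]) (a : R).

Lemma Re_add z w : complex.Re (z + w) = complex.Re z + complex.Re w.
Proof. by case: z; case: w. Qed.
Lemma Im_add z w : complex.Im (z + w) = complex.Im z + complex.Im w.
Proof. by case: z; case: w. Qed.
Lemma Re_opp z : complex.Re (- z) = - complex.Re z.
Proof. by case: z. Qed.
Lemma Im_opp z : complex.Im (- z) = - complex.Im z.
Proof. by case: z. Qed.
Lemma Re_mul z w :
  complex.Re (z * w) = complex.Re z * complex.Re w - complex.Im z * complex.Im w.
Proof. by case: z; case: w. Qed.
Lemma Im_mul z w :
  complex.Im (z * w) = complex.Re z * complex.Im w + complex.Im z * complex.Re w.
Proof. by case: z; case: w. Qed.
Lemma Re_conj z : complex.Re (conjc z) = complex.Re z.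
Proof. by case: z. Qed.
Lemma Im_conj z : complex.Im (conjc z) = - complex.Im z.
Proof. by case: z. Qed.

Definition ReImE := (Re_add, Im_add, Re_opp, Im_opp, Re_mul, Im_mul, Re_conj, Im_conj).

Lemma complex_ext z w :
  complex.Re z = complex.Re w -> complex.Im z = complex.Im w -> z = w.
Proof. by case: z; case: w => /= a b c d -> ->. Qed.

Lemma sqr_normc_ReIm z : normc z ^+ 2 = complex.Re z ^+ 2 + complex.Im z ^+ 2.
Proof. by case: z => a b /=; rewrite sqr_sqrtr // addr_ge0 // sqr_ge0. Qed.

Lemma normc_ge0 z : 0 <= normc z.
Proof. by case: z => a b /=; rewrite sqrtr_ge0. Qed.
Hint Resolve normc_ge0 : core.

Lemma normr_Re_le z : `|complex.Re z| <= normc z.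
Proof.
rewrite -(ler_sqr (x := `|_|)) ?nnegrE// sqr_normc_ReIm real_normK ?num_real//.
by rewrite lerDl sqr_ge0.
Qed.

Lemma normr_Im_le z : `|complex.Im z| <= normc z.
Proof.
rewrite -(ler_sqr (x := `|_|)) ?nnegrE// sqr_normc_ReIm real_normK ?num_real//.
by rewrite lerDr sqr_ge0.
Qed.

Lemma normc_le_ReIm z : normc z <= `|complex.Re z| + `|complex.Im z|.
Proof.
rewrite -ler_sqr ?nnegrE ?addr_ge0// sqr_normc_ReIm sqrrD !real_normK ?num_real//.
by rewrite lerD2r lerDl mulrn_wge0// mulr_ge0.
Qed.

Lemma normc_conj z : normc (conjc z) = normc z.
Proof. by case: z => a b /=; rewrite sqrrN. Qed.

Lemma normc_real a : normc a%:C = `|a|.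
Proof. by rewrite /= expr0n addr0 sqrtr_sqr. Qed.

Lemma mulr_conjc z : z * conjc z = (normc z ^+ 2)%:C.
Proof.
rewrite sqr_normc_ReIm; apply: complex_ext; rewrite !ReImE /=; last by ring.
by rewrite mulrN opprK !expr2.
Qed.

Lemma normcM z w : normc (z * w) = normc z * normc w.
Proof. exact: ComplexField.Normc.normcM. Qed.

Lemma normcD z w : normc (z + w) <= normc z + normc w.
Proof. exact: le_normcD. Qed.

Lemma normcB z w : normc (z - w) <= normc z + normc w.
Proof. by rewrite (le_trans (normcD _ _))// normcN. Qed.

Lemma sqr_normcD z w : normc (z + w) ^+ 2 <= 2 * normc z ^+ 2 + 2 * normc w ^+ 2.
Proof.
have := normcD z w; have := normc_ge0 (z + w).
have := normc_ge0 z; have := normc_ge0 w.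
set x := normc z; set y := normc w; set u := normc (z + w) => y0 x0 u0 uxy.
have : u ^+ 2 <= (x + y) ^+ 2 by rewrite ler_sqr ?nnegrE ?addr_ge0.
have := sqr_ge0 (x - y); lra.
Qed.

Lemma Re_real a : complex.Re (a%:C : R[i]) = a. Proof. by []. Qed.
Lemma Im_real a : complex.Im (a%:C : R[i]) = 0. Proof. by []. Qed.

Lemma cexp0 : cexp 0 = 1 :> R[i].
Proof. by rewrite /cexp /= expR0 cos0 sin0 mulr1 mulr0. Qed.

Lemma cexpD z w : cexp (z + w) = cexp z * cexp w.
Proof.
by apply: complex_ext; rewrite !ReImE /= !ReImE expRD ?cosD ?sinD; ring.
Qed.

Lemma normc_cexp z : normc (cexp z) = expR (complex.Re z).
Proof.
rewrite /= !exprMn -mulrDr cos2Dsin2 mulr1 sqrtr_sqr ger0_norm//.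
Qed.

Lemma cexp_conj z : conjc (cexp z) = cexp (conjc z).
Proof. by case: z => a b; rewrite /cexp /= cosN sinN mulrN. Qed.

Lemma cexp_neq0 z : cexp z != 0.
Proof.
apply/eqP => /(congr1 (@ComplexField.Normc.normc R)); rewrite normc_cexp normc_real normr0.
by apply/eqP; rewrite gt_eqF// expR_gt0.
Qed.

End ComplexNumbers.
#[global] Hint Extern 0 (is_true (@Order.le _ _ _ (ComplexField.Normc.normc _))) =>
  exact: normc_ge0 : core.
Arguments ComplexField.Normc.normc : simpl never.
Arguments conjc : simpl never.
Arguments cexp : simpl never.

(** * Integrals of complex-valued functions *)

Section ComplexMeasurable.
Context {d} {T : measurableType d} {R : realType}.
Implicit Types (f g : T -> R[i]) (u : T -> R).

Definition cmeasurable f :=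
  measurable_fun setT (fun t => complex.Re (f t)) /\
  measurable_fun setT (fun t => complex.Im (f t)).

Lemma cmeasurable_cst (c : R[i]) : cmeasurable (fun=> c).
Proof. by split; exact: measurable_cst. Qed.

Lemma cmeasurableD f g : cmeasurable f -> cmeasurable g ->
  cmeasurable (fun t => f t + g t).
Proof.
move=> [rf If] [rg Ig]; split.
- under eq_fun do rewrite Re_add; exact: measurable_funD.
- under eq_fun do rewrite Im_add; exact: measurable_funD.
Qed.

Lemma cmeasurableN f : cmeasurable f -> cmeasurable (fun t => - f t).
Proof.
move=> [rf If]; split.
- under eq_fun do rewrite Re_opp; exact: measurableT_comp.
- under eq_fun do rewrite Im_opp; exact: measurableT_comp.
Qed.

Lemma cmeasurableB f g : cmeasurable f -> cmeasurable g ->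
  cmeasurable (fun t => f t - g t).
Proof. by move=> mf mg; apply: cmeasurableD => //; exact: cmeasurableN. Qed.

Lemma cmeasurableM f g : cmeasurable f -> cmeasurable g ->
  cmeasurable (fun t => f t * g t).
Proof.
move=> [rf If] [rg Ig]; split.
- under eq_fun do rewrite Re_mul.
  by apply: measurable_funB; exact: measurable_funM.
- under eq_fun do rewrite Im_mul.
  by apply: measurable_funD; exact: measurable_funM.
Qed.

Lemma cmeasurable_conj f : cmeasurable f -> cmeasurable (fun t => conjc (f t)).
Proof.
move=> [rf If]; split.
- by under eq_fun do rewrite Re_conj.
- under eq_fun do rewrite Im_conj; exact: measurableT_comp.
Qed.

Lemma cmeasurable_real u : measurable_fun setT u -> cmeasurable (fun t => (u t)%:C).
Proof. by move=> mu; split => //; exact: measurable_cst. Qed.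

Lemma cmeasurable_cexp f : cmeasurable f -> cmeasurable (fun t => cexp (f t)).
Proof.
move=> [rf If]; split => /=; apply: measurable_funM.
- exact: (measurableT_comp (@measurable_expR R)).
- apply: (measurableT_comp (f := @cos R)) => //.
  by apply: continuous_measurable_fun; exact: continuous_cos.
- exact: (measurableT_comp (@measurable_expR R)).
- apply: (measurableT_comp (f := @sin R)) => //.
  by apply: continuous_measurable_fun; exact: continuous_sin.
Qed.

Lemma measurable_normc f : cmeasurable f -> measurable_fun setT (fun t => normc (f t)).
Proof.
move=> [rf If]; rewrite (_ : (fun _ => _) =
  (fun t => Num.sqrt (complex.Re (f t) ^+ 2 + complex.Im (f t) ^+ 2))); last first.
  by apply/funext => t; rewrite -sqr_normc_ReIm sqrtr_sqr ger0_norm.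
apply: (measurableT_comp (f := @Num.sqrt R)) => //; last first.
  by apply: measurable_funD; exact: measurable_funX.
by apply: continuous_measurable_fun; exact: sqrt_continuous.
Qed.

End ComplexMeasurable.

Section ComplexIntegral.
Context {R : realType}.
Local Notation mu := (@lebesgue_measure R).
Implicit Types (f g : R -> R[i]) (u v : R -> R).

Lemma ae_imp (P Q : R -> Prop) : (forall x, P x -> Q x) ->
  {ae mu, forall x, P x} -> {ae mu, forall x, Q x}.
Proof. by move=> PQ; exact: (@filterS _ _ (ae_filter_ringOfSetsType mu) _ _ PQ). Qed.

Lemma ae_imp2 (P Q S : R -> Prop) : (forall x, P x -> Q x -> S x) ->
  {ae mu, forall x, P x} -> {ae mu, forall x, Q x} -> {ae mu, forall x, S x}.
Proof. by move=> PQ; exact: (@filterS2 _ _ (ae_filter_ringOfSetsType mu) _ _ _ PQ). Qed.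

Lemma ae_all (P : R -> Prop) : (forall x, P x) -> {ae mu, forall x, P x}.
Proof. by move=> allP; apply: aeW. Qed.

Definition rintegrable u := mu.-integrable setT (EFin \o u).
Definition cintegrable f :=
  rintegrable (fun t => complex.Re (f t)) /\ rintegrable (fun t => complex.Im (f t)).

Lemma rintegrable_measurable u : rintegrable u -> measurable_fun setT u.
Proof. by move=> /integrableP[/measurable_EFinP]. Qed.

Lemma cintegrable_measurable f : cintegrable f -> cmeasurable f.
Proof. by move=> [/rintegrable_measurable rf /rintegrable_measurable]. Qed.

Lemma le_rintegrable u v : measurable_fun setT u -> (forall x, `|u x| <= v x) ->
  rintegrable v -> rintegrable u.
Proof.
move=> mu' uv iv; apply: (le_integrable measurableT _ _ iv) => /=.
  exact/measurable_EFinP.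
by move=> x _ /=; rewrite lee_fin (le_trans (uv x))// ler_norm.
Qed.

Lemma rintegrable0 : rintegrable (fun=> 0).
Proof. exact: integrable0. Qed.

Lemma rintegrableD u v : rintegrable u -> rintegrable v ->
  rintegrable (fun t => u t + v t).
Proof. by move=> iu iv; exact: (integrableD measurableT iu iv). Qed.

Lemma rintegrableN u : rintegrable u -> rintegrable (fun t => - u t).
Proof. by move=> iu; exact: (integrableN iu). Qed.

Lemma rintegrableB u v : rintegrable u -> rintegrable v ->
  rintegrable (fun t => u t - v t).
Proof. by move=> iu iv; apply: rintegrableD => //; exact: rintegrableN. Qed.

Lemma rintegrableZ (a : R) u : rintegrable u -> rintegrable (fun t => a * u t).
Proof. by move=> iu; exact: (integrableZl measurableT a iu). Qed.

Lemma rintegrable_normc f : cintegrable f -> rintegrable (fun t => normc (f t)).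
Proof.
move=> /[dup] /cintegrable_measurable mf [rf If].
apply: (@le_rintegrable _ (fun t => `|complex.Re (f t)| + `|complex.Im (f t)|)).
- exact: measurable_normc.
- by move=> x; rewrite (ger0_norm (normc_ge0 _)) normc_le_ReIm.
- by apply: rintegrableD; exact: integrable_norm.
Qed.

Lemma le_cintegrable f u : cmeasurable f -> (forall x, normc (f x) <= u x) ->
  rintegrable u -> cintegrable f.
Proof.
move=> [rf If] fu iu; split; apply: le_rintegrable iu => // x;
  apply: le_trans (fu x); [exact: normr_Re_le|exact: normr_Im_le].
Qed.

Lemma cintegrable_normc f : cmeasurable f -> rintegrable (fun t => normc (f t)) ->
  cintegrable f.
Proof. by move=> mf; apply: le_cintegrable. Qed.

Lemma cintegrableD f g : cintegrable f -> cintegrable g ->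
  cintegrable (fun t => f t + g t).
Proof.
move=> [rf If] [rg Ig]; split.
- under eq_fun do rewrite Re_add; exact: rintegrableD.
- under eq_fun do rewrite Im_add; exact: rintegrableD.
Qed.

Lemma cintegrableN f : cintegrable f -> cintegrable (fun t => - f t).
Proof.
move=> [rf If]; split.
- under eq_fun do rewrite Re_opp; exact: rintegrableN.
- under eq_fun do rewrite Im_opp; exact: rintegrableN.
Qed.

Lemma cintegrableB f g : cintegrable f -> cintegrable g ->
  cintegrable (fun t => f t - g t).
Proof. by move=> fi gi; apply: cintegrableD => //; exact: cintegrableN. Qed.

Lemma cintegrable_conj f : cintegrable f -> cintegrable (fun t => conjc (f t)).
Proof.
move=> [rf If]; split.
- by under eq_fun do rewrite Re_conj.
- under eq_fun do rewrite Im_conj; exact: rintegrableN.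
Qed.

Lemma cintegrableZ (c : R[i]) f : cintegrable f -> cintegrable (fun t => c * f t).
Proof.
move=> [rf If]; split.
- under eq_fun do rewrite Re_mul; apply: rintegrableB; exact: rintegrableZ.
- under eq_fun do rewrite Im_mul; apply: rintegrableD; exact: rintegrableZ.
Qed.

Lemma cintegralD f g : cintegrable f -> cintegrable g ->
  cintegral (fun t => f t + g t) = cintegral f + cintegral g.
Proof.
move=> [rf If] [rg Ig]; apply: complex_ext; rewrite ?ReImE /=.
- by under eq_Rintegral do rewrite Re_add; rewrite RintegralD.
- by under eq_Rintegral do rewrite Im_add; rewrite RintegralD.
Qed.

Lemma cintegralZ (c : R[i]) f : cintegrable f ->
  cintegral (fun t => c * f t) = c * cintegral f.
Proof.
move=> [rf If]; apply: complex_ext; rewrite ?ReImE /=.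
- under eq_Rintegral do rewrite Re_mul.
  by rewrite RintegralB// ?RintegralZl//; exact: rintegrableZ.
- under eq_Rintegral do rewrite Im_mul.
  by rewrite RintegralD// ?RintegralZl//; exact: rintegrableZ.
Qed.

Lemma cintegralB f g : cintegrable f -> cintegrable g ->
  cintegral (fun t => f t - g t) = cintegral f - cintegral g.
Proof.
move=> fi gi; under [in LHS]eq_fun do rewrite -mulN1r.
by rewrite cintegralD ?cintegralZ ?mulN1r//; exact: cintegrableZ.
Qed.

Lemma cintegral_conj f : cintegrable f ->
  cintegral (fun t => conjc (f t)) = conjc (cintegral f).
Proof.
move=> [rf If]; apply: complex_ext; rewrite ?ReImE /=.
- by under eq_Rintegral do rewrite Re_conj.
- under eq_Rintegral do rewrite Im_conj -mulN1r.
  by rewrite RintegralZl// mulN1r.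
Qed.

Lemma cintegral_real u : cintegral (fun t => (u t)%:C) = (\int[mu]_t u t)%:C.
Proof.
by apply: complex_ext => //=; rewrite /Rintegral integral0.
Qed.

Lemma le_rintegral u v : rintegrable u -> rintegrable v -> (forall x, u x <= v x) ->
  \int[mu]_t u t <= \int[mu]_t v t.
Proof. by move=> iu iv uv; apply: le_Rintegral. Qed.

(* Rotate the integral onto the positive real axis and compare real parts. *)
Lemma normc_cintegral f : cintegrable f ->
  normc (cintegral f) <= \int[mu]_t normc (f t).
Proof.
move=> fi; set z := cintegral f.
have [z0|z0] := eqVneq (normc z) 0.
  by rewrite z0; apply: Rintegral_ge0 => x _.
have {}z0 : 0 < normc z by rewrite lt_neqAle eq_sym z0 normc_ge0.
rewrite -(ler_pM2l z0) -expr2.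
have -> : normc z ^+ 2 = \int[mu]_t complex.Re (conjc z * f t).
  transitivity (complex.Re (cintegral (fun t => conjc z * f t))) => //.
  by rewrite cintegralZ// mulrC mulr_conjc.
rewrite -RintegralZl//; last exact: rintegrable_normc.
apply: le_rintegral.
- by have [] := cintegrableZ (conjc z) fi.
- by apply: rintegrableZ; exact: rintegrable_normc.
- move=> x; apply: le_trans (ler_norm _) _.
  by rewrite (le_trans (normr_Re_le _))// normcM normc_conj.
Qed.

Lemma ae_eq_Rintegral u v : measurable_fun setT u -> measurable_fun setT v ->
  {ae mu, forall x, u x = v x} -> \int[mu]_t u t = \int[mu]_t v t.
Proof.
move=> mu' mv uv; congr fine; apply: ae_eq_integral => //;
  try exact/measurable_EFinP.
by apply: ae_imp uv => x /= -> _.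
Qed.

Lemma ae_eq_cintegral f g : cmeasurable f -> cmeasurable g ->
  {ae mu, forall x, f x = g x} -> cintegral f = cintegral g.
Proof.
move=> [rf If] [rg Ig] fg; apply: complex_ext => /=; apply: ae_eq_Rintegral => //;
by apply: ae_imp fg => x /= ->.
Qed.

Lemma ae_eq_rintegrable u v : measurable_fun setT u -> measurable_fun setT v ->
  {ae mu, forall x, u x = v x} -> rintegrable u -> rintegrable v.
Proof.
move=> mu' mv uv /integrableP[_ iu]; apply/integrableP; split.
  exact/measurable_EFinP.
rewrite (_ : (\int[mu]_x _)%E = (\int[mu]_x `|(EFin \o u) x|)%E)//.
apply: ae_eq_integral => //.
- by apply: measurableT_comp => //; exact/measurable_EFinP.
- by apply: measurableT_comp => //; exact/measurable_EFinP.
- by apply: ae_imp uv => x /= -> _.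
Qed.

Lemma dominated_cvg_Rintegral (u_ : nat -> R -> R) u v :
  (forall n, measurable_fun setT (u_ n)) -> measurable_fun setT u ->
  {ae mu, forall x, u_ ^~ x @ \oo --> u x} -> rintegrable v ->
  (forall n x, `|u_ n x| <= v x) ->
  \int[mu]_t u_ n t @[n --> \oo] --> \int[mu]_t u t.
Proof.
move=> mu_ mu' cu iv ub.
have m1 n : measurable_fun setT (EFin \o u_ n) by exact/measurable_EFinP.
have m2 : measurable_fun setT (EFin \o u) by exact/measurable_EFinP.
have c1 : {ae mu, forall x, setT x -> (EFin \o u_ n) x @[n --> \oo] --> (EFin \o u) x}.
  by apply: ae_imp cu => x ux _; apply: cvg_EFin => //; exact: nearW.
have d1 : {ae mu, forall x n, setT x -> (`|(EFin \o u_ n) x| <= (EFin \o v) x)%E}.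
  by apply: ae_all => x n _ /=; rewrite lee_fin.
have [iu _] := @dominated_convergence _ _ _ mu setT measurableT _ _ _ m1 m2 c1 iv d1.
move=> cuv; rewrite /Rintegral; apply: fine_cvg; rewrite fineK; first exact: cuv.
exact: integrable_fin_num iu.
Qed.

Lemma dominated_cvg_cintegral (f_ : nat -> R -> R[i]) f v :
  (forall n, cmeasurable (f_ n)) -> cmeasurable f ->
  {ae mu, forall x, normc (f_ n x - f x) @[n --> \oo] --> (0:R)} -> rintegrable v ->
  (forall n x, normc (f_ n x) <= v x) -> (forall x, normc (f x) <= v x) ->
  normc (cintegral (f_ n) - cintegral f) @[n --> \oo] --> (0:R).
Proof.
move=> mf_ mf cf iv fv_ fv.
have : \int[mu]_t normc (f_ n t - f t) @[n --> \oo] --> (\int[mu]_t (0:R) : R).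
  apply: (@dominated_cvg_Rintegral _ _ (fun x => v x + v x)) => //.
  - by move=> n; apply: measurable_normc; exact: cmeasurableB.
  - exact: rintegrableD.
  - move=> n x; rewrite ger0_norm//.
    by rewrite (le_trans (normcB _ _))// lerD.
have -> : \int[mu]_t (0:R) = 0 :> R by rewrite /Rintegral integral0.
apply: squeeze_cvgr; last exact: cvg_cst.
apply: nearW => n /=; rewrite normc_ge0/= -cintegralB; last 2 first.
- exact: le_cintegrable iv.
- exact: le_cintegrable iv.
by apply: normc_cintegral; apply: cintegrableB; apply: le_cintegrable iv.
Qed.

End ComplexIntegral.

(** * Fubini's theorem under a product bound *)

Section Fubini.
Context {R : realType}.
Local Notation mu := (@lebesgue_measure R).
Variables (F : R -> R -> R[i]) (u v : R -> R).
Hypotheses (mF : cmeasurable (fun p : R * R => F p.1 p.2))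
  (Fuv : forall t x, normc (F t x) <= u t * v x)
  (ui : rintegrable u) (vi : rintegrable v).

(** The bound [u t * v x] makes every section integrable, not only almost every one, and by Tonelli
    the double integral is at most the product of the integrals of [|u|] and [|v|]. *)
Let prod_integrable (G : R -> R -> R) :
  measurable_fun setT (fun p : R * R => G p.1 p.2) ->
  (forall t x, `|G t x| <= u t * v x) ->
  [/\ (forall t, rintegrable (G t)), (forall x, rintegrable (G ^~ x)) &
   (mu \x mu)%E.-integrable setT (fun p : R * R => (G p.1 p.2)%:E)].
Proof.
move=> mG Guv.
have vi' := rintegrable_measurable vi.
have i1 t : rintegrable (G t).
  apply: (@le_rintegrable _ _ (fun x => u t * v x)) => //.
  - exact: (measurable_fun_pair2 t mG).
  - exact: rintegrableZ.
split => //.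
- move=> x; apply: (@le_rintegrable _ _ (fun t => v x * u t)) => //.
  + exact: (measurable_fun_pair1 x mG).
  + by move=> t; rewrite mulrC.
  + exact: rintegrableZ.
apply/(integrable12ltyP _ _ _).2; first exact/measurable_EFinP.
pose U := (\int[mu]_x `|(v x)%:E|)%E.
have Ulty : (U < +oo)%E by have /integrableP[] := vi.
have Ufin : U \is a fin_num by rewrite ge0_fin_numE// integral_ge0.
apply: (@le_lt_trans _ _ (\int[mu]_t (`|(u t)%:E| * U))%E); last first.
  under eq_integral do rewrite muleC.
  rewrite ge0_integralZl//.
  - by rewrite lte_mul_pinfty// ?integral_ge0//; have /integrableP[] := ui.
  - by apply: measurableT_comp => //; apply/measurable_EFinP; exact: rintegrable_measurable.
  - exact: integral_ge0.
apply: ge0_le_integral => //.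
- by move=> x _; apply: integral_ge0.
- apply: (@measurable_fun_fubini_tonelli_F _ _ _ _ _ mu (fun p : R * R => `|(G p.1 p.2)%:E|%E)) => //.
  by apply: measurableT_comp => //; exact/measurable_EFinP.
- apply: emeasurable_funM => //; apply: measurableT_comp => //.
  by apply/measurable_EFinP; exact: rintegrable_measurable.
- move=> t _; rewrite -ge0_integralZl//; last first.
    by apply: measurableT_comp => //; exact/measurable_EFinP.
  apply: ge0_le_integral => //.
  + apply: measurableT_comp => //; apply/measurable_EFinP.
    exact: (measurable_fun_pair2 t mG).
  + apply: emeasurable_funM => //; apply: measurableT_comp => //.
    exact/measurable_EFinP.
  + move=> x _; rewrite -abseM -EFinM lee_fin.
    by rewrite (le_trans (Guv _ _))// ler_norm.
Qed.

Let real_Fubini (G : R -> R -> R) :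
  measurable_fun setT (fun p : R * R => G p.1 p.2) ->
  (forall t x, `|G t x| <= u t * v x) ->
  rintegrable (fun t => \int[mu]_x G t x) /\
  \int[mu]_t \int[mu]_x G t x = \int[mu]_x \int[mu]_t G t x.
Proof.
move=> mG Guv; have [i1 i2 i12] := prod_integrable mG Guv.
have e1 t : (\int[mu]_x (G t x)%:E = (\int[mu]_x G t x)%:E)%E.
  by rewrite fineK//; exact: integrable_fin_num (i1 t).
have e2 x : (\int[mu]_t (G t x)%:E = (\int[mu]_t G t x)%:E)%E.
  by rewrite fineK//; exact: integrable_fin_num (i2 x).
split.
  have := integrable_fubini_F i12; rewrite /fubini_F/=.
  by under eq_fun do rewrite e1.
have := Fubini i12; under eq_integral do rewrite e1.
by under [in RHS]eq_integral do rewrite e2; rewrite {3}/Rintegral => ->.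
Qed.

Let mRe : measurable_fun setT (fun p : R * R => complex.Re (F p.1 p.2)).
Proof. by case: mF. Qed.
Let mIm : measurable_fun setT (fun p : R * R => complex.Im (F p.1 p.2)).
Proof. by case: mF. Qed.
Let bRe t x : `|complex.Re (F t x)| <= u t * v x.
Proof. exact: le_trans (normr_Re_le _) (Fuv t x). Qed.
Let bIm t x : `|complex.Im (F t x)| <= u t * v x.
Proof. exact: le_trans (normr_Im_le _) (Fuv t x). Qed.

Lemma cintegrable_partial : cintegrable (fun t => cintegral (F t)).
Proof. by split; [have [] := real_Fubini mRe bRe|have [] := real_Fubini mIm bIm]. Qed.

Lemma complex_Fubini :
  cintegral (fun t => cintegral (fun x => F t x)) =
  cintegral (fun x => cintegral (fun t => F t x)).
Proof.
by apply: complex_ext => /=; [have [] := real_Fubini mRe bRe|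
  have [] := real_Fubini mIm bIm].
Qed.

End Fubini.

(** * Square-integrable functions *)

Section SquareIntegrable.
Context {R : realType}.
Local Notation mu := (@lebesgue_measure R).
Implicit Types (f g : R -> R[i]) (u v : R -> R).

(** The square of the L^2 norm as a real number, so that bounds and limits are taken in [R]. It is
    meaningful for [L2] functions, since an infinite integral would be read as 0. *)
Definition energy f : R := \int[mu]_t normc (f t) ^+ 2.

Lemma energy_ge0 f : 0 <= energy f.
Proof. by apply: Rintegral_ge0 => t _; exact: sqr_ge0. Qed.

Lemma measurable_normc_sqr d (T : measurableType d) (f : T -> R[i]) : cmeasurable f ->
  measurable_fun setT (fun t => normc (f t) ^+ 2).
Proof. by move=> mf; apply: measurable_funX; exact: measurable_normc. Qed.

Lemma L2norm_poweR f :
  L2norm f = ((\int[mu]_t (normc (f t) ^+ 2)%:E) `^ (2^-1))%E.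
Proof.
rewrite /L2norm unlock; congr (_ `^ _)%E; apply: eq_integral => t _.
by rewrite /= ger0_norm// powR_mulrn.
Qed.

Lemma L2P f : L2 f <-> cmeasurable f /\ rintegrable (fun t => normc (f t) ^+ 2).
Proof.
rewrite /L2 L2norm_poweR; split.
- move=> [rf If fy]; split => //; apply/integrableP; split.
    by apply/measurable_EFinP; apply: measurable_normc_sqr.
  under eq_integral do rewrite /= ger0_norm ?sqr_ge0//.
  rewrite ltey; apply/eqP => h; move: fy; rewrite h poweRyr // invr_neq0//.
- move=> [[rf If] /integrableP[_ fi]]; split => //.
  apply: poweR_lty; apply: le_lt_trans fi.
  by under [leRHS]eq_integral do rewrite /= ger0_norm ?sqr_ge0//.
Qed.

Lemma L2norm_energy f : L2 f -> L2norm f = (Num.sqrt (energy f))%:E.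
Proof.
move=> /L2P[mf fi]; rewrite L2norm_poweR -powR12_sqrt ?energy_ge0//.
rewrite -poweR_EFin; congr (_ `^ _)%E.
by rewrite /energy fineK//; exact: integrable_fin_num fi.
Qed.

Lemma L2_measurable f : L2 f -> cmeasurable f.
Proof. by move=> /L2P[]. Qed.

Lemma L2_energy f : L2 f -> rintegrable (fun t => normc (f t) ^+ 2).
Proof. by move=> /L2P[]. Qed.

Lemma le_L2 f u : cmeasurable f -> (forall t, normc (f t) ^+ 2 <= u t) ->
  rintegrable u -> L2 f.
Proof.
move=> mf fu iu; apply/L2P; split => //; apply: le_rintegrable iu.
  exact: measurable_normc_sqr.
by move=> t; rewrite ger0_norm ?sqr_ge0.
Qed.

Lemma L2D f g : L2 f -> L2 g -> L2 (fun t => f t + g t).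
Proof.
move=> /L2P[mf fi] /L2P[mg gi].
apply: (@le_L2 _ (fun t => 2 * normc (f t) ^+ 2 + 2 * normc (g t) ^+ 2)).
- exact: cmeasurableD.
- by move=> t; exact: sqr_normcD.
- by apply: rintegrableD; exact: rintegrableZ.
Qed.

Lemma L2Z (c : R[i]) f : L2 f -> L2 (fun t => c * f t).
Proof.
move=> /L2P[mf fi].
apply: (@le_L2 _ (fun t => normc c ^+ 2 * normc (f t) ^+ 2)).
- by apply: cmeasurableM => //; exact: cmeasurable_cst.
- by move=> t; rewrite normcM exprMn.
- exact: rintegrableZ.
Qed.

Lemma L2B f g : L2 f -> L2 g -> L2 (fun t => f t - g t).
Proof.
move=> fi gi; apply: L2D => //; under eq_fun do rewrite -mulN1r; exact: L2Z.
Qed.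

Lemma L2_conj f : L2 f -> L2 (fun t => conjc (f t)).
Proof.
move=> /L2P[mf fi]; apply: le_L2 fi; first exact: cmeasurable_conj.
by move=> t; rewrite normc_conj.
Qed.

Lemma le_L2_normc f g : cmeasurable f -> (forall t, normc (f t) <= normc (g t)) ->
  L2 g -> L2 f.
Proof.
move=> mf fg /L2P[_ gi]; apply: le_L2 gi => // t.
by rewrite ler_sqr ?nnegrE.
Qed.

Lemma energy_add f g : L2 f -> L2 g ->
  energy (fun t => f t + g t) <= 2 * energy f + 2 * energy g.
Proof.
move=> fi gi; have := L2_energy fi; have := L2_energy gi => eg ef.
rewrite /energy -!RintegralZl// -RintegralD//; try exact: rintegrableZ.
apply: le_rintegral.
- exact: L2_energy (L2D fi gi).
- by apply: rintegrableD; exact: rintegrableZ.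
- by move=> t; exact: sqr_normcD.
Qed.

Lemma energyN f : energy (fun t => - f t) = energy f.
Proof. by congr Rintegral; apply/funext => t; rewrite normcN. Qed.

Lemma energy_sub f g : L2 f -> L2 g ->
  energy (fun t => f t - g t) <= 2 * energy f + 2 * energy g.
Proof.
move=> fi gi; rewrite -[energy g]energyN; apply: energy_add => //.
by under eq_fun do rewrite -mulN1r; exact: L2Z.
Qed.

(** Expanding [e * (a / e - b) ^+ 2] bounds even twice the product. The free weight [e] makes one
    factor count as little as desired, which does the work of the Cauchy-Schwarz inequality. *)
Lemma mulr_le_sqr (a b e : R) : 0 < e -> a * b <= a ^+ 2 / e + e * b ^+ 2.
Proof.
move=> e0; have := sqr_ge0 (a / e - b); rewrite -(pmulr_rge0 _ e0) => h.
have : e * (a / e - b) ^+ 2 = a ^+ 2 / e + e * b ^+ 2 - 2 * (a * b).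
  by field; rewrite gt_eqF.
have := mulr_ge0 (ltW e0) (sqr_ge0 b).
have : 0 <= a ^+ 2 / e by rewrite divr_ge0 ?sqr_ge0// ltW.
by case: (leP 0 (a * b)) => ab; lra.
Qed.

Lemma rintegrable_mulL2 f g : L2 f -> L2 g ->
  rintegrable (fun t => normc (f t) * normc (g t)).
Proof.
move=> /L2P[mf fi] /L2P[mg gi].
apply: (@le_rintegrable _ _ (fun t => normc (f t) ^+ 2 + normc (g t) ^+ 2)).
- by apply: measurable_funM; exact: measurable_normc.
- move=> t; rewrite ger0_norm ?mulr_ge0//.
  by have := @mulr_le_sqr (normc (f t)) (normc (g t)) 1 ltr01; rewrite divr1 mul1r.
- exact: rintegrableD.
Qed.

Lemma cintegrable_mulL2 f g : L2 f -> L2 g -> cintegrable (fun t => f t * g t).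
Proof.
move=> fi gi; apply: le_cintegrable (rintegrable_mulL2 fi gi).
- by apply: cmeasurableM; exact: L2_measurable.
- by move=> t; rewrite normcM.
Qed.

Lemma normc_pairing f g e : 0 < e -> L2 f -> L2 g ->
  normc (cintegral (fun t => f t * g t)) <= energy f / e + e * energy g.
Proof.
move=> e0 fi gi; rewrite (le_trans (normc_cintegral (cintegrable_mulL2 fi gi)))//.
have ef := L2_energy fi; have eg := L2_energy gi.
rewrite mulrC /energy -!RintegralZl// -RintegralD//; try exact: rintegrableZ.
apply: le_rintegral.
- exact: rintegrable_normc (cintegrable_mulL2 fi gi).
- by apply: rintegrableD; exact: rintegrableZ.
- by move=> t; rewrite normcM (le_trans (mulr_le_sqr _ _ e0))// mulrC.
Qed.

Lemma cvg_pairing (f_ : nat -> R -> R[i]) f g :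
  (forall n, L2 (f_ n)) -> L2 f -> L2 g ->
  energy (fun t => f_ n t - f t) @[n --> \oo] --> (0:R) ->
  normc (cintegral (fun t => f_ n t * g t) - cintegral (fun t => f t * g t))
    @[n --> \oo] --> (0:R).
Proof.
move=> f_i fi gi cf; apply/cvgr0Pnorm_lt => e e0.
(* With this weight the fixed term [d * energy g] stays below [e / 2], while the other term tends to
   0 with [n]. The added 1 covers the case of zero energy. *)
pose d := e / (2 * (energy g + 1)).
have g1 : 0 < energy g + 1 by rewrite ltr_wpDl// energy_ge0.
have d0 : 0 < d by rewrite divr_gt0// mulr_gt0.
have dg : d * energy g < e / 2.
  have -> : e / 2 = d * (energy g + 1) by rewrite /d; field; rewrite gt_eqF.
  by rewrite ltr_pM2l// ltrDl.
have ed : 0 < e / 2 * d by rewrite mulr_gt0// divr_gt0.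
move/cvgr0Pnorm_lt : cf => /(_ _ ed); apply: filterS => n.
rewrite ger0_norm ?energy_ge0// -ltr_pdivrMr// => hn.
rewrite ger0_norm// -cintegralB; try exact: cintegrable_mulL2.
under eq_fun do rewrite -mulrBl.
apply: le_lt_trans (normc_pairing d0 (L2B (f_i n) fi) gi) _.
by rewrite [ltRHS](splitr e) ltrD.
Qed.

Lemma rintegrable_indic_itv (a b : R) (b0 b1 : bool) :
  rintegrable (\1_[set` Interval (BSide b0 a) (BSide b1 b)] : R -> R).
Proof. exact: integrable_indic_itv. Qed.

(** On the support the modulus is at most 1 plus its square, and the support has finite length. *)
Lemma L2_bounded_support f (M : R) : L2 f -> (forall t, M < `|t| -> f t = 0) ->
  cintegrable f.
Proof.
move=> /L2P[mf fi] fM.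
apply: (@le_cintegrable _ _ (fun t => \1_`[- M, M] t + normc (f t) ^+ 2)) => //.
- move=> t; have [tM|tM] := leP `|t| M.
    rewrite indicE mem_set /=; last by rewrite in_itv /= -ler_norml.
    by have := sqr_ge0 (normc (f t) - 2^-1); rewrite sqrrB; lra.
  by rewrite fM// ComplexField.Normc.normc0 expr0n addr0.
- by apply: rintegrableD => //; exact: rintegrable_indic_itv.
Qed.

Lemma truncationE f n t : truncation f n t = (\1_`[- n%:R, n%:R] t)%:C * f t.
Proof.
rewrite /truncation indicE; case: ifPn => [tn|tn].
  by rewrite mem_set ?mul1r//= in_itv/= -ler_norml.
by rewrite memNset ?mul0r//= in_itv/= -ler_norml; apply/negP.
Qed.

Lemma normc_truncation f n t : normc (truncation f n t) <= normc (f t).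
Proof. by rewrite /truncation; case: ifPn => //; rewrite ComplexField.Normc.normc0. Qed.

Lemma cmeasurable_truncation f n : cmeasurable f -> cmeasurable (truncation f n).
Proof.
move=> mf; rewrite (_ : truncation f n = fun t => (\1_`[- n%:R, n%:R] t)%:C * f t).
  by apply: cmeasurableM => //; apply: cmeasurable_real; exact: measurable_indic.
by apply/funext => t; rewrite truncationE.
Qed.

Lemma L2_truncation f n : L2 f -> L2 (truncation f n).
Proof.
move=> fi; apply: le_L2_normc (fi); last exact: normc_truncation.
by apply: cmeasurable_truncation; exact: L2_measurable.
Qed.

Lemma truncation_support f n t : n%:R < `|t| -> truncation f n t = 0.
Proof. by rewrite /truncation ltNge => /negbTE ->. Qed.

Lemma cintegrable_truncation f n : L2 f -> cintegrable (truncation f n).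
Proof.
by move=> fi; apply: (L2_bounded_support (L2_truncation n fi)); exact: truncation_support.
Qed.

Lemma truncation_near f t : \forall n \near \oo, truncation f n t = f t.
Proof.
have := nbhs_infty_ger `|t|; apply: filterS => n tn.
by rewrite /truncation tn.
Qed.

Lemma cvg_energy_truncation f : L2 f ->
  energy (fun t => truncation f n t - f t) @[n --> \oo] --> (0:R).
Proof.
move=> /[dup] fi /L2P[mf ef].
have -> : (0:R) = \int[mu]_t (0:R) by rewrite /Rintegral integral0.
apply: (@dominated_cvg_Rintegral _ _ _ (fun t => normc (f t) ^+ 2)) => //.
- move=> n; apply: measurable_normc_sqr; apply: cmeasurableB => //.
  exact: cmeasurable_truncation.
- apply: ae_all => t; apply: cvg_near_cst; have := truncation_near f t.
  by apply: filterS => n ->; rewrite subrr ComplexField.Normc.normc0 expr0n.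
- move=> n t; rewrite ger0_norm ?sqr_ge0// /truncation.
  by case: ifPn => _; rewrite ?subrr ?sub0r ?normcN// ComplexField.Normc.normc0 expr0n/= sqr_ge0.
Qed.

End SquareIntegrable.

(** * Affine changes of variables *)

Section AffineChangeOfVariable.
Context {R : realType}.
Local Notation mu := (@lebesgue_measure R).
Variables (a b : R).
Hypothesis a0 : a != 0.

Let phi : measurableTypeR R -> measurableTypeR R := fun x => a * x + b.

Let mphi : measurable_fun setT phi.
Proof. by apply: measurable_funD => //; exact: measurable_funM. Qed.

Let image_measure : {measure set (measurableTypeR R) -> \bar R} :=
  measure_function_pushforward__canonical__measure_function_Measure mu mphi.

Let na_ge0 : (0 <= `|a|)%R. Proof. by []. Qed.

(** Two measures are compared on half-open intervals, which determine Lebesgue measure; for negative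
    [a] the preimage has its ends and its open side exchanged. *)
Let affine_measure (A : set R) : measurable A ->
  mu A = mscale (NngNum na_ge0) image_measure A.
Proof.
apply: lebesgue_measure_unique => /= _ [[c d]] _ <-.
rewrite /mscale /= /pushforward.
have [agt0|alt0|a00] := ltgtP 0 a; last by move: (a0); rewrite -a00 eqxx.
- have -> : phi @^-1` `]c, d] = `](c - b) / a, (d - b) / a]%classic.
    apply/seteqP; split => x /=; rewrite /phi !in_itv/= ltr_pdivrMr// ler_pdivlMr//;
    by rewrite ltrBlDr lerBrDr mulrC.
  rewrite !lebesgue_measure_itv/= !lte_fin ltr_pM2r ?invr_gt0// ltrD2r.
  case: ifPn => _; last by rewrite mule0.
  rewrite -!EFinB -EFinM (gtr0_norm agt0); congr EFin; field.
  by rewrite gt_eqF.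
- have -> : phi @^-1` `]c, d] = `[(d - b) / a, (c - b) / a[%classic.
    apply/seteqP; split => x /=; rewrite /phi !in_itv/= ltr_ndivlMr// ler_ndivrMr//;
    by rewrite ltrBlDr lerBrDr mulrC andbC.
  rewrite !lebesgue_measure_itv/= !lte_fin ltr_nM2r ?invr_lt0// ltrD2r.
  case: ifPn => _; last by rewrite mule0.
  rewrite -!EFinB -EFinM (ltr0_norm alt0); congr EFin; field.
  by rewrite lt_eqF.
Qed.

Lemma ge0_integral_affine (u : R -> \bar R) : measurable_fun setT u ->
  (forall x, 0 <= u x)%E ->
  (\int[mu]_x u x = `|a|%:E * \int[mu]_x u (a * x + b)%R)%E.
Proof.
move=> mu' u0.
rewrite (eq_measure_integral (mscale (NngNum na_ge0) image_measure)); last first.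
  by move=> A mA _; exact: affine_measure.
rewrite ge0_integral_mscale//=; congr (_ * _)%E.
by rewrite ge0_integral_pushforward//= preimage_setT.
Qed.

Lemma measurable_affine : measurable_fun setT (fun x : R => a * x + b).
Proof. exact: mphi. Qed.

Lemma measurable_comp_affine (u : R -> R) : measurable_fun setT u ->
  measurable_fun setT (fun x => u (a * x + b)).
Proof. by move=> mu'; apply: (measurableT_comp (f := u)) => //; exact: measurable_affine. Qed.

Lemma cmeasurable_affine (f : R -> R[i]) : cmeasurable f ->
  cmeasurable (fun x => f (a * x + b)).
Proof.
move=> [rf If]; split.
- exact: (measurable_comp_affine rf).
- exact: (measurable_comp_affine If).
Qed.

Lemma rintegrable_affine (u : R -> R) : rintegrable u ->
  rintegrable (fun x => u (a * x + b)).
Proof.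
move=> /[dup] /rintegrable_measurable mu' /integrableP[_ iu].
apply/integrableP; split.
  by apply/measurable_EFinP; exact: measurable_comp_affine.
move: iu; rewrite (@ge0_integral_affine (fun x => `|(u x)%:E|)%E)//; last first.
  by apply: measurableT_comp => //; exact/measurable_EFinP.
move=> h; rewrite ltey; apply/eqP => /= e; move: h; rewrite /= e gt0_muley//.
by rewrite lte_fin normr_gt0.
Qed.

Let ge0_Rintegral_affine (u : R -> R) : rintegrable u -> (forall x, 0 <= u x) ->
  \int[mu]_x u x = `|a| * \int[mu]_x u (a * x + b).
Proof.
move=> iu u0; have iu' := rintegrable_affine iu.
have fin : (\int[mu]_x (u (a * x + b))%:E)%E \is a fin_num.
  exact: integrable_fin_num iu'.
rewrite /Rintegral -[X in _ = X * _]/(fine (`|a|%:E)) -fineM//; congr fine.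
apply: (@ge0_integral_affine (EFin \o u)) => [|x]; last by rewrite /= lee_fin.
by apply/measurable_EFinP; exact: rintegrable_measurable.
Qed.

Lemma Rintegral_affine (u : R -> R) : rintegrable u ->
  \int[mu]_x u x = `|a| * \int[mu]_x u (a * x + b).
Proof.
move=> iu; have iu' := rintegrable_affine iu.
have iau : rintegrable (fun x => `|u x|) by exact: integrable_norm.
have iau' := rintegrable_affine iau.
(* The nonnegative case is applied to [|u| + u] and to [|u|], whose difference is [u]. *)
have split_u (g h : R -> R) : rintegrable g -> rintegrable h ->
    \int[mu]_x g x = \int[mu]_x (h x + g x) - \int[mu]_x h x.
  move=> ig ih; rewrite -RintegralB//; last exact: rintegrableD.
  by apply: eq_Rintegral => x _; rewrite addrC addKr.
rewrite (split_u _ _ iu iau) (split_u _ _ iu' iau') mulrBr.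
rewrite -(ge0_Rintegral_affine iau)// -(@ge0_Rintegral_affine (fun x => `|u x| + u x))//.
- exact: rintegrableD.
- by move=> x; rewrite -lerBlDr sub0r lerNl lerNnormlW.
Qed.

Lemma cintegrable_affine (f : R -> R[i]) : cintegrable f ->
  cintegrable (fun x => f (a * x + b)).
Proof. by move=> [rf If]; split; [move: rf|move: If] => /rintegrable_affine. Qed.

Lemma cintegral_affine (f : R -> R[i]) : cintegrable f ->
  cintegral f = `|a|%:C * cintegral (fun x => f (a * x + b)).
Proof.
move=> [rf If]; apply: complex_ext; rewrite ReImE /= mul0r ?subr0 ?addr0.
- exact: (Rintegral_affine rf).
- exact: (Rintegral_affine If).
Qed.

Lemma L2_affine (f : R -> R[i]) : L2 f -> L2 (fun x => f (a * x + b)).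
Proof.
move=> /L2P[mf fi]; apply/L2P; split; first exact: cmeasurable_affine.
exact: (rintegrable_affine fi).
Qed.

Lemma ae_affine (P : R -> Prop) : {ae mu, forall x, P x} ->
  {ae mu, forall x, P (a * x + b)}.
Proof.
move=> [N [mN N0 PN]]; exists (phi @^-1` N); split.
- by rewrite -[X in measurable X]setTI; exact: mphi.
- move: N0; rewrite affine_measure// /mscale/= => /eqP.
  rewrite mule_eq0 => /orP[|/eqP//].
  by rewrite eqe normr_eq0 (negbTE a0).
- by move=> x /= nPx; apply: PN.
Qed.

End AffineChangeOfVariable.

(** * Abel and Poisson kernels *)

Section RealDerivatives.
Context {R : realType}.
Implicit Types (f g : R -> R) (x a b c : R).

Lemma is_derive_add f g x a b : is_derive x 1 f a -> is_derive x 1 g b ->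
  is_derive x 1 (fun t => f t + g t) (a + b).
Proof. by move=> df dg; exact: is_deriveD. Qed.

Lemma is_derive_opp f x a : is_derive x 1 f a ->
  is_derive x 1 (fun t => - f t) (- a).
Proof. by move=> df; exact: is_deriveN. Qed.

Lemma is_derive_mul f g x a b : is_derive x 1 f a -> is_derive x 1 g b ->
  is_derive x 1 (fun t => f t * g t) (a * g x + f x * b).
Proof.
move=> df dg; apply: is_derive_eq (is_deriveM df dg) _.
by rewrite /GRing.scale /= addrC mulrC; congr (_ + _); rewrite mulrC.
Qed.

Lemma is_derive_scale c f x a : is_derive x 1 f a ->
  is_derive x 1 (fun t => c * f t) (c * a).
Proof. by move=> df; exact: (is_deriveZ c df). Qed.

Lemma is_derive_comp f g x a b : is_derive (g x) 1 f a -> is_derive x 1 g b ->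
  is_derive x 1 (fun t => f (g t)) (a * b).
Proof. by move=> df dg; exact: (is_derive1_comp df dg). Qed.

Lemma is_derive_linear c x : is_derive x 1 (fun t => c * t) c.
Proof.
have := is_derive_scale c (is_derive_id x (1:R)); rewrite mulr1; exact.
Qed.

Lemma is_derive_const c x : is_derive x 1 (fun=> c : R) 0.
Proof. exact: is_derive_cst. Qed.

Lemma is_derive_continuous f x a : is_derive x 1 f a -> {for x, continuous f}.
Proof.
by move=> [df _]; apply: differentiable_continuous; exact/derivable1_diffP.
Qed.

End RealDerivatives.

Section PoissonKernel.
Context {R : realType}.
Local Notation mu := (@lebesgue_measure R).

Definition abel (e x : R) : R := expR (- (e * `|x|)).
(** The Fourier transform of [abel e], that is, the Poisson kernel of the upper half-plane at height
    [e / (2 * pi)]. *)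
Definition poisson (e u : R) : R := 2 * e / (e ^+ 2 + (2 * pi * u) ^+ 2).

Lemma abel_ge0 e x : 0 <= abel e x. Proof. exact: expR_ge0. Qed.

Lemma abel_le1 e x : 0 < e -> abel e x <= 1.
Proof. by move=> e0; rewrite /abel -[leRHS]expR0 ler_expR oppr_le0 mulr_ge0// ltW. Qed.

Lemma continuous_abel e : continuous (abel e).
Proof.
move=> x; apply: continuous_comp; last exact: continuous_expR.
apply: continuousN; apply: continuousM; first exact: cst_continuous.
exact: norm_continuous.
Qed.

Lemma continuous_cosM (w : R) : continuous (fun x => cos (w * x)).
Proof.
by move=> x; apply: (is_derive_continuous (is_derive_comp (is_derive_cos _) (is_derive_linear w x))).
Qed.

Lemma continuous_sinM (w : R) : continuous (fun x => sin (w * x)).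
Proof.
by move=> x; apply: (is_derive_continuous (is_derive_comp (is_derive_sin _) (is_derive_linear w x))).
Qed.

Let cvg0_expR_mul (e C : R) (g : R -> R) : 0 < e -> (forall x, `|g x| <= C) ->
  expR (- (e * x)) * g x @[x --> +oo] --> (0 : R).
Proof.
move=> e0 gC; have C0 : 0 <= C by exact: le_trans (gC 0).
have ex0 : expR (- (e * x)) @[x --> +oo] --> (0 : R).
  apply: (@cvg_comp _ _ _ (fun x => e * x) (fun y => expR (- y)) _ _ _ _ (@cvgr_expR R)).
  exact: gt0_cvgMry.
apply: norm_cvg0; apply: (@squeeze_cvgr _ _ _ _ (fun=> 0) (fun x => expR (- (e * x)) * C)).
- apply: nearW => x; rewrite normr_ge0/= normrM ger0_norm ?expR_ge0//.
  by rewrite ler_wpM2l ?expR_ge0.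
- exact: cvg_cst.
- by rewrite -[X in _ --> X](mul0r C); apply: cvgM => //; exact: cvg_cst.
Qed.

(* The summand 1 makes the integrand nonnegative, which is what the fundamental
   theorem on half-lines asks for. *)
Let integral_abel_1cos (e w : R) : 0 < e ->
  (\int[mu]_x (abel e x * (1 + cos (w * x)))%:E =
   (2 * (e^-1 + e / (e ^+ 2 + w ^+ 2)))%:E)%E.
Proof.
move=> e0; have D0 : 0 < e ^+ 2 + w ^+ 2 by rewrite ltr_pwDl ?exprn_gt0// sqr_ge0.
have cont : continuous (fun x => abel e x * (1 + cos (w * x))).
  move=> x; apply: continuousM; first exact: continuous_abel.
  by apply: continuousD; [exact: cst_continuous|exact: continuous_cosM].
rewrite ge0_symfun_integralT//; last 2 first.
- move=> x; apply: mulr_ge0; first exact: abel_ge0.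
  by have := cos_geN1 (w * x); lra.
- by move=> x /=; rewrite /abel normrN mulrN cosN.
rewrite EFinM; congr (_ * _)%E; rewrite -set_itvcy.
pose g (x : R) := - e^-1 + (w * sin (w * x) - e * cos (w * x)) / (e ^+ 2 + w ^+ 2).
pose F (x : R) := expR (- (e * x)) * g x.
have dF (x : R) : is_derive x 1 F (expR (- (e * x)) * (1 + cos (w * x))).
  have dw := is_derive_linear w x.
  have dsin := is_derive_scale w (is_derive_comp (is_derive_sin (w * x)) dw).
  have dcos := is_derive_opp (is_derive_scale e (is_derive_comp (is_derive_cos (w * x)) dw)).
  have dg := is_derive_add (is_derive_const (- e^-1) x)
    (is_derive_mul (is_derive_add dsin dcos) (is_derive_const (e ^+ 2 + w ^+ 2)^-1 x)).
  have dE := @is_derive_comp _ expR (fun t => - (e * t)) _ _ _ (is_derive_expR (- (e * x)))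
    (is_derive_opp (is_derive_linear e x)).
  apply: is_derive_eq (is_derive_mul dE dg) _; rewrite /g.
  by field; rewrite gt_eqF//= gt_eqF.
have fE (x : R) : 0 <= x -> abel e x * (1 + cos (w * x)) = expR (- (e * x)) * (1 + cos (w * x)).
  by move=> x0; rewrite /abel ger0_norm.
rewrite (@ge0_continuous_FTC2y _ _ F 0 0).
- rewrite /F /g !mulr0 oppr0 expR0 sin0 cos0 mulr0 mulr1 mul1r sub0r -EFinB; congr EFin.
  by field; rewrite gt_eqF//= gt_eqF.
- move=> x _; apply: mulr_ge0; first exact: abel_ge0.
  by have := cos_geN1 (w * x); lra.
- exact: continuous_subspaceT.
- apply: (@cvg0_expR_mul _ (e^-1 + (`|w| + e) / (e ^+ 2 + w ^+ 2))) => // x.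
  rewrite /g (le_trans (ler_normD _ _))// normrN gtr0_norm ?invr_gt0// lerD2l.
  rewrite normrM (gtr0_norm (_ : 0 < _^-1)) ?invr_gt0// ler_pM2r ?invr_gt0//.
  rewrite (le_trans (ler_normB _ _))// !normrM (gtr0_norm e0) lerD//.
  + by apply: ler_piMr; rewrite // ler_norml sin_le1 sin_geN1.
  + by apply: ler_piMr; rewrite ?(ltW e0)// ler_norml cos_le1 cos_geN1.
- by move=> x _; have [] := dF x.
- by apply: cvg_at_right_filter; exact: (is_derive_continuous (dF 0)).
- move=> x; rewrite in_itv/= andbT => x0; rewrite derive1E.
  by have [_ ->] := dF x; rewrite fE// ltW.
Qed.

Lemma rintegrable_abel e : 0 < e -> rintegrable (abel e).
Proof.
move=> e0; apply/integrableP; split.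
  by apply/measurable_EFinP; apply: continuous_measurable_fun; exact: continuous_abel.
have := integral_abel_1cos 0 e0.
under eq_integral do rewrite mul0r cos0.
move=> h; apply: (@le_lt_trans _ _ (\int[mu]_x (abel e x * (1 + 1))%:E)%E); last by rewrite h ltry.
apply: ge0_le_integral => //.
- by apply: measurableT_comp => //; apply/measurable_EFinP;
    apply: continuous_measurable_fun; exact: continuous_abel.
- apply/measurable_EFinP; apply: measurable_funM => //.
  by apply: continuous_measurable_fun; exact: continuous_abel.
- move=> x _ /=; rewrite lee_fin ger0_norm ?abel_ge0// ler_peMr ?abel_ge0//.
  by rewrite lerDl.
Qed.

Lemma cintegrable_abelM e (f : R -> R[i]) (C : R) : 0 < e -> cmeasurable f ->
  (forall x, normc (f x) <= C) -> cintegrable (fun x => (abel e x)%:C * f x).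
Proof.
move=> e0 mf fC; apply: (@le_cintegrable _ _ (fun x => C * abel e x)).
- apply: cmeasurableM => //; apply: cmeasurable_real.
  by apply: continuous_measurable_fun; exact: continuous_abel.
- by move=> x; rewrite normcM normc_real ger0_norm ?abel_ge0// mulrC ler_wpM2r// abel_ge0.
- by apply: rintegrableZ; exact: rintegrable_abel.
Qed.

Let integral_abel_cos (e w : R) : 0 < e ->
  \int[mu]_x (abel e x * cos (w * x)) = 2 * e / (e ^+ 2 + w ^+ 2).
Proof.
move=> e0; have ia := rintegrable_abel e0.
have D0 : 0 < e ^+ 2 + w ^+ 2 by rewrite ltr_pwDl ?exprn_gt0// sqr_ge0.
have ic : rintegrable (fun x => abel e x * cos (w * x)).
  apply: le_rintegrable ia.
    by apply: continuous_measurable_fun => x; apply: continuousM;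
      [exact: continuous_abel|exact: continuous_cosM].
  move=> x; rewrite normrM ger0_norm ?abel_ge0//; apply: ler_piMr; rewrite ?abel_ge0//.
  by rewrite ler_norml cos_le1 cos_geN1.
have ha : \int[mu]_x abel e x = 2 / e.
  have /(congr1 fine)/= := integral_abel_1cos 0 e0.
  under eq_integral do rewrite mul0r cos0.
  rewrite -[LHS]/(\int[mu]_x (abel e x * (1 + 1))) RintegralZr//.
  rewrite expr0n addr0 => h.
  have -> : \int[mu]_x abel e x = \int[mu]_x abel e x * (1 + 1) / 2.
    by rewrite -[1+1]/(2%:R) mulfK.
  by rewrite h; field; rewrite gt_eqF.
have /(congr1 fine)/= := integral_abel_1cos w e0.
under eq_integral do rewrite mulrDr mulr1.
rewrite -[LHS]/(\int[mu]_x (abel e x + abel e x * cos (w * x))) RintegralD// ha.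
move=> /(canRL (addKr _)) ->; field.
by rewrite gt_eqF//= gt_eqF.
Qed.

Let integral_abel_sin (e w : R) : 0 < e ->
  \int[mu]_x (abel e x * sin (w * x)) = 0.
Proof.
move=> e0; have ia := rintegrable_abel e0.
have ic : rintegrable (fun x => abel e x * sin (w * x)).
  apply: le_rintegrable ia.
    by apply: continuous_measurable_fun => x; apply: continuousM;
      [exact: continuous_abel|exact: continuous_sinM].
  move=> x; rewrite normrM ger0_norm ?abel_ge0//; apply: ler_piMr; rewrite ?abel_ge0//.
  by rewrite ler_norml sin_le1 sin_geN1.
have N10 : (-1 : R) != 0 by rewrite oppr_eq0.
have := Rintegral_affine 0 N10 ic.
rewrite normrN1 mul1r.
under [RHS]eq_Rintegral do rewrite addr0 /abel mulN1r normrN mulrN sinN mulrN -mulN1r.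
rewrite RintegralZl// mulN1r => h.
by move: h; lra.
Qed.

Lemma cintegral_abel (e u : R) : 0 < e ->
  cintegral (fun x => (abel e x)%:C * cexp (0 +i* (2 * pi * x * u))) = (poisson e u)%:C.
Proof.
move=> e0; have wE (x : R) : 2 * pi * x * u = (2 * pi * u) * x by ring.
apply: complex_ext.
- rewrite /poisson -integral_abel_cos//; apply: eq_Rintegral => x _.
  by rewrite Re_mul /cexp/= expR0 mul1r mul0r subr0 wE.
- rewrite -[RHS](integral_abel_sin (2 * pi * u) e0); apply: eq_Rintegral => x _.
  by rewrite Im_mul /cexp/= expR0 mul1r mul0r addr0 wE.
Qed.

Lemma poisson_gt0 e u : 0 < e -> 0 < poisson e u.
Proof.
move=> e0; rewrite /poisson divr_gt0 ?mulr_gt0//.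
by rewrite ltr_pwDl ?exprn_gt0// sqr_ge0.
Qed.

Lemma poisson_le e u : 0 < e -> poisson e u <= 2 / e.
Proof.
move=> e0; rewrite /poisson ler_pdivrMr; last first.
  by rewrite ltr_pwDl ?exprn_gt0// sqr_ge0.
rewrite mulrDr; have -> : 2 / e * e ^+ 2 = 2 * e by field; rewrite gt_eqF.
by rewrite lerDl mulr_ge0 ?sqr_ge0// divr_ge0// ltW.
Qed.

Lemma poissonN (e u : R) : poisson e (- u) = poisson e u.
Proof. by rewrite /poisson mulrN sqrrN. Qed.

Lemma is_derive_poisson_primitive (e x : R) : 0 < e ->
  is_derive x 1 (fun t => pi^-1 * atan (2 * pi / e * t)) (poisson e x).
Proof.
move=> e0; have pi0 := pi_gt0 R.
apply: is_derive_eq (is_derive_scale pi^-1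
  (is_derive_comp (is_derive1_atan _) (is_derive_linear (2 * pi / e) x))) _.
rewrite /poisson; move: (@pi R) pi0 => p p0; field.
by rewrite !gt_eqF//= ltr_pwDl ?exprn_gt0// sqr_ge0.
Qed.

Lemma continuous_poisson (e : R) : 0 < e -> continuous (poisson e).
Proof.
move=> e0 x; rewrite /continuous_at /poisson; apply: cvgM; first exact: cvg_cst.
apply: cvgV; first by rewrite gt_eqF// ltr_pwDl ?exprn_gt0// sqr_ge0.
apply: cvgD; first exact: cvg_cst.
apply: (@continuous_comp _ _ _ (fun x => 2 * pi * x) (fun y => y ^+ 2)).
  exact: is_derive_continuous (is_derive_linear _ _).
exact: exprn_continuous.
Qed.

Lemma integral_poisson (e : R) : 0 < e -> (\int[mu]_x (poisson e x)%:E = 1)%E.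
Proof.
move=> e0; have pi0 := pi_gt0 R.
rewrite ge0_symfun_integralT; last 3 first.
- by move=> x; rewrite ltW// poisson_gt0.
- exact: continuous_poisson.
- by move=> x /=; rewrite poissonN.
rewrite -set_itvcy.
rewrite (@ge0_continuous_FTC2y _ _ (fun t => pi^-1 * atan (2 * pi / e * t)) 0 2^-1).
- by rewrite !mulr0 atan0 mulr0 sube0 -EFinM mulfV.
- by move=> x _; rewrite ltW// poisson_gt0.
- by apply: continuous_subspaceT; exact: continuous_poisson.
- have -> : 2^-1 = pi^-1 * (pi / 2) :> R by rewrite mulKf// gt_eqF.
  apply: cvgM; first exact: cvg_cst.
  apply: (@cvg_comp _ _ _ (fun t => 2 * pi / e * t) (@atan R) _ _ _ _ (@cvgy_atan R)).
  by apply: gt0_cvgMry => //; rewrite divr_gt0// mulr_gt0.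
- by move=> x _; have [] := is_derive_poisson_primitive x e0.
- by apply: cvg_at_right_filter; exact: (is_derive_continuous (is_derive_poisson_primitive 0 e0)).
- by move=> x _; rewrite derive1E; have [_ ->] := is_derive_poisson_primitive x e0.
Qed.

Lemma integral_poisson_shift (e u : R) : 0 < e -> (\int[mu]_t (poisson e (u - t))%:E = 1)%E.
Proof.
move=> e0; have N10 : (-1 : R) != 0 by rewrite oppr_eq0.
have := @ge0_integral_affine R (-1) u N10 (fun x => (poisson e x)%:E).
rewrite integral_poisson// normrN1 mul1e => ->.
- by apply: eq_integral => x _; rewrite mulN1r addrC.
- by apply/measurable_EFinP; apply: continuous_measurable_fun; exact: continuous_poisson.
- by move=> x; rewrite lee_fin ltW// poisson_gt0.
Qed.

Lemma Rintegral_poisson_itv (e u a b : R) : 0 < e -> a < b ->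
  \int[mu]_(t in `[a, b]) poisson e (u - t) =
  pi^-1 * atan (2 * pi / e * (u - a)) - pi^-1 * atan (2 * pi / e * (u - b)).
Proof.
move=> e0 ab.
pose F (t : R) := - (pi^-1 * atan (2 * pi / e * (u - t))).
have dF (x : R) : is_derive x 1 F (poisson e (u - x)).
  have du : is_derive x 1 (fun t => u - t) (- 1).
    have := is_derive_add (is_derive_const u x) (is_derive_opp (is_derive_id x (1:R))).
    by rewrite add0r.
  apply: is_derive_eq (is_derive_opp (@is_derive_comp _ _ (fun t => u - t) _ _ _
    (is_derive_poisson_primitive (u - x) e0) du)) _.
  by rewrite mulrN1 opprK.
have cF : continuous F by move=> x; exact: (is_derive_continuous (dF x)).
rewrite /Rintegral (@continuous_FTC2 _ _ F)//.
- by rewrite /F /= opprK addrC.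
- apply: continuous_subspaceT => x.
  apply: (@continuous_comp _ _ _ (fun x => u - x) (poisson e)); last exact: continuous_poisson.
  by apply: continuousB; [exact: cst_continuous|exact: cvg_id].
- split.
  + by move=> x _; have [] := dF x.
  + by apply: cvg_at_right_filter; exact: cF.
  + by apply: cvg_at_left_filter; exact: cF.
- by move=> x _; rewrite derive1E; have [_ ->] := dF x.
Qed.

Lemma Rintegral_poisson_itv_bound (e u a b : R) : 0 < e -> a < b ->
  0 <= \int[mu]_(t in `[a, b]) poisson e (u - t) <= 1.
Proof.
move=> e0 ab; rewrite Rintegral_ge0/=; last by move=> x _; rewrite ltW// poisson_gt0.
rewrite Rintegral_poisson_itv// -mulrBr mulrC ler_pdivrMr ?pi_gt0// mul1r.
have := atan_ltpi2 (2 * pi / e * (u - a)); have := atan_gtNpi2 (2 * pi / e * (u - b)).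
lra.
Qed.

Let cvg_atan_pos (c : R) : 0 < c ->
  pi^-1 * atan (2 * pi / n.+1%:R^-1 * c) @[n --> \oo] --> (2^-1 : R).
Proof.
move=> c0; have pi0 := pi_gt0 R.
have -> : 2^-1 = pi^-1 * (pi / 2) :> R by rewrite mulKf// gt_eqF.
apply: cvgM; first exact: cvg_cst.
apply: (@cvg_comp _ _ _ (fun n => 2 * pi / n.+1%:R^-1 * c) (@atan R) _ _ _ _ (@cvgy_atan R)).
have -> : (fun n => 2 * pi / n.+1%:R^-1 * c) = (fun n => (2 * pi * c) * n.+1%:R).
  by apply/funext => n; rewrite invrK mulrAC.
have K0 : 0 < 2 * pi * c by rewrite !mulr_gt0.
apply/cvgryPge => A; near=> n.
rewrite mulrC -ler_pdivrMr// (@le_trans _ _ n%:R) ?ler_nat//.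
by near: n; exact: nbhs_infty_ger.
Unshelve. all: by end_near. Qed.

(** Each end [c] contributes an arctangent divided by [pi], which tends to one half or minus one
    half according to the sign of [u - c]. At an end point of the interval the limit would be one
    half, hence the two exclusions. *)
Lemma cvg_Rintegral_poisson_itv (u a b : R) : a < b -> u != a -> u != b ->
  \int[mu]_(t in `[a, b]) poisson n.+1%:R^-1 (u - t) @[n --> \oo] -->
  (\1_`[a, b] u : R).
Proof.
move=> ab ua ub.
have cvg_sign (c : R) : u != c ->
    pi^-1 * atan (2 * pi / n.+1%:R^-1 * (u - c)) @[n --> \oo] -->
    (if c < u then 2^-1 else - 2^-1 : R).
  move=> uc; case: ltP => cu; first by apply: cvg_atan_pos; rewrite subr_gt0.
  have {}cu : u < c by rewrite lt_neqAle uc.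
  under eq_fun do rewrite -opprB mulrN atanN mulrN.
  by apply: cvgN; apply: cvg_atan_pos; rewrite subr_gt0.
under eq_fun do rewrite Rintegral_poisson_itv//.
have -> : (\1_`[a, b] u : R) =
    (if a < u then 2^-1 else - 2^-1) - (if b < u then 2^-1 else - 2^-1).
  rewrite indicE; have [au|au] := ltP a u; have [bu|bu] := ltP b u.
  - by rewrite memNset ?subrr//= in_itv/= (leNgt u b) bu andbF.
  - by rewrite mem_set/= ?in_itv/= ?(ltW au)//; lra.
  - by have := lt_trans ab bu; rewrite ltNge au.
  - by rewrite memNset/= ?subrr// in_itv/= (leNgt a u) lt_neqAle ua au.
by apply: cvgB; exact: cvg_sign.
Qed.

End PoissonKernel.

(** * Plancherel's theorem *)

Section FourierL1.
Context {R : realType}.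
Local Notation mu := (@lebesgue_measure R).
Local Notation chr a := (cexp (0 +i* a)).
Implicit Types (f g : R -> R[i]).

Lemma normc_chr (a : R) : normc (chr a) = 1.
Proof. by rewrite normc_cexp expR0. Qed.

Lemma chrD (a b : R) : chr (a + b) = chr a * chr b.
Proof. by rewrite -cexpD; congr cexp; apply: complex_ext; rewrite ReImE/= ?addr0. Qed.

Lemma chr_conj (a : R) : conjc (chr a) = chr (- a).
Proof. by rewrite cexp_conj. Qed.

Lemma cmeasurable_chr d (T : measurableType d) (u : T -> R) : measurable_fun setT u ->
  cmeasurable (fun t => chr (u t)).
Proof. by move=> mu'; apply: cmeasurable_cexp; split => //; exact: measurable_cst. Qed.

Lemma cmeasurable_fst f : cmeasurable f -> cmeasurable (fun p : R * R => f p.1).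
Proof. by move=> [rf If]; split; [exact: (measurableT_comp rf)|exact: (measurableT_comp If)]. Qed.

Lemma cmeasurable_snd f : cmeasurable f -> cmeasurable (fun p : R * R => f p.2).
Proof. by move=> [rf If]; split; [exact: (measurableT_comp rf)|exact: (measurableT_comp If)]. Qed.

Lemma measurable_chr2 (c : R) : measurable_fun setT (fun p : R * R => c * p.1 * p.2).
Proof.
apply: measurable_funM; last exact: measurable_snd.
by apply: measurable_funM => //; exact: measurable_fst.
Qed.

Lemma measurable_abel (e : R) : measurable_fun setT (abel e).
Proof. by apply: continuous_measurable_fun; exact: continuous_abel. Qed.

Lemma cintegrable_chr f (u : R -> R) : cintegrable f -> measurable_fun setT u ->
  cintegrable (fun t => f t * chr (u t)).
Proof.
move=> fi mu'; apply: le_cintegrable (rintegrable_normc fi).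
- by apply: cmeasurableM; [exact: cintegrable_measurable|exact: cmeasurable_chr].
- by move=> t; rewrite normcM normc_chr mulr1.
Qed.

Lemma measurable_scale (c : R) : measurable_fun setT (fun t : R => c * t).
Proof. exact: measurable_funM. Qed.

Lemma cintegrable_fourier f (xi : R) : cintegrable f ->
  cintegrable (fun t => f t * chr (- (2 * pi * xi * t))).
Proof.
by move=> fi; apply: cintegrable_chr => //; apply: measurableT_comp.
Qed.

Lemma normc_fourierL1 f xi : cintegrable f ->
  normc (fourierL1 f xi) <= \int[mu]_t normc (f t).
Proof.
move=> fi; apply: le_trans (normc_cintegral (cintegrable_fourier xi fi)) _.
apply: le_rintegral.
- exact: rintegrable_normc (cintegrable_fourier xi fi).
- exact: rintegrable_normc.
- by move=> t; rewrite normcM normc_chr mulr1.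
Qed.

Lemma fourierL1B f g xi : cintegrable f -> cintegrable g ->
  fourierL1 (fun t => f t - g t) xi = fourierL1 f xi - fourierL1 g xi.
Proof.
move=> fi gi; rewrite /fourierL1 -cintegralB; try exact: cintegrable_fourier.
by congr cintegral; apply/funext => t; rewrite mulrBl.
Qed.

Lemma conj_fourierL1 f xi : cintegrable f ->
  conjc (fourierL1 f xi) = cintegral (fun t => conjc (f t) * chr (2 * pi * xi * t)).
Proof.
move=> fi; rewrite /fourierL1 -cintegral_conj; last exact: cintegrable_fourier.
by congr cintegral; apply/funext => t; rewrite rmorphM/= chr_conj opprK.
Qed.

(* Weighting by the Abel factor makes Fubini applicable without any assumption
   on the decay of the transform. *)
Lemma cmeasurable_fourierL1 f : cintegrable f -> cmeasurable (fourierL1 f).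
Proof.
move=> fi; pose F (x t : R) := (abel 1 x)%:C * (f t * chr (- (2 * pi * x * t))).
have iF : cintegrable (fun x => cintegral (F x)).
  apply: (@cintegrable_partial R F (abel 1) (fun t => normc (f t))).
  - apply: cmeasurableM.
      by apply: cmeasurable_real; apply: measurableT_comp => //; exact: measurable_abel.
    apply: cmeasurableM; first by apply: cmeasurable_snd; exact: cintegrable_measurable.
    by apply: cmeasurable_chr; apply: measurableT_comp => //; exact: measurable_chr2.
  - move=> x t; rewrite !normcM normc_chr mulr1 normc_real ger0_norm//.
    exact: abel_ge0.
  - by apply: rintegrable_abel.
  - exact: rintegrable_normc.
have -> : fourierL1 f = fun x => (expR (1 * `|x|))%:C * cintegral (F x).
  apply/funext => x; rewrite cintegralZ; last exact: cintegrable_fourier.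
  by rewrite mulrA -rmorphM/= /abel -expRD subrr expR0 mul1r.
apply: cmeasurableM; last exact: cintegrable_measurable.
apply: cmeasurable_real; apply: measurableT_comp => //.
by apply: measurable_funM => //; exact: normr_measurable.
Qed.

Lemma measurable_poisson_sub (e : R) : 0 < e ->
  measurable_fun setT (fun p : R * R => poisson e (p.1 - p.2)).
Proof.
move=> e0; apply: (measurableT_comp (f := poisson e)).
  by apply: continuous_measurable_fun; exact: continuous_poisson.
by apply: measurable_funB; [exact: measurable_fst|exact: measurable_snd].
Qed.

(** Both transforms are written as integrals and [x] is integrated first, which leaves the Fourier
    transform of the Abel factor at [u - t]. The Abel factor supplies the integrability in [x] for
    both exchanges. *)
Lemma abel_Plancherel e f g : 0 < e -> cintegrable f -> cintegrable g ->
  cintegral (fun x => (abel e x)%:C * fourierL1 f x * conjc (fourierL1 g x)) =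
  cintegral (fun u => conjc (g u) * cintegral (fun t => (poisson e (u - t))%:C * f t)).
Proof.
move=> e0 fi gi; have gi' := cintegrable_conj gi.
have nf := rintegrable_normc fi; have ng := rintegrable_normc gi'.
have mf := cintegrable_measurable fi; have mg := cintegrable_measurable gi'.
have ia := rintegrable_abel e0.
pose A x := (abel e x)%:C * fourierL1 f x.
have iA : cintegrable A.
  apply: (cintegrable_abelM e0 (cmeasurable_fourierL1 fi)) => x.
  exact: normc_fourierL1.
have mA := cintegrable_measurable iA.
transitivity (cintegral (fun x => cintegral (fun u =>
    A x * (conjc (g u) * chr (2 * pi * x * u))))).
  congr cintegral; apply/funext => x.
  rewrite conj_fourierL1// cintegralZ//.
  apply: cintegrable_chr => //; exact: measurable_scale.
rewrite (complex_Fubini (u := fun x => normc (A x)) (v := fun u => normc (conjc (g u)))).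
- congr cintegral; apply/funext => u.
  transitivity (cintegral (fun x => conjc (g u) * (A x * chr (2 * pi * x * u)))).
    by congr cintegral; apply/funext => x; rewrite mulrCA.
  have mxu : measurable_fun setT (fun x : R => 2 * pi * x * u).
    by apply: measurable_funM => //; exact: measurable_scale.
  rewrite cintegralZ; last exact: cintegrable_chr.
  congr (_ * _).
  pose B x t := ((abel e x)%:C * f t) * chr (2 * pi * x * (u - t)).
  transitivity (cintegral (fun x => cintegral (B x))).
    congr cintegral; apply/funext => x.
    rewrite /A mulrAC /fourierL1 -cintegralZ; last exact: cintegrable_fourier.
    congr cintegral; apply/funext => t.
    by rewrite /B mulrBr chrD; ring.
  rewrite (complex_Fubini (u := abel e) (v := fun t => normc (f t)))//.
  + congr cintegral; apply/funext => t.
    rewrite -(cintegral_abel (u - t) e0) [RHS]mulrC -cintegralZ.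
      by congr cintegral; apply/funext => x; rewrite /B; ring.
    apply: (cintegrable_abelM e0 (C := 1)).
      apply: cmeasurable_chr; apply: measurable_funM => //; exact: measurable_scale.
    by move=> x; rewrite normc_chr.
  + apply: cmeasurableM.
      apply: cmeasurableM; last exact: cmeasurable_snd.
      by apply: cmeasurable_real; apply: measurableT_comp => //; exact: measurable_abel.
    apply: cmeasurable_chr; apply: measurable_funM.
      apply: (measurableT_comp (f := fun x => 2 * pi * x)); last exact: measurable_fst.
      exact: measurable_scale.
    by apply: measurable_funB; [exact: measurable_cst|exact: measurable_snd].
  + by move=> x t; rewrite !normcM normc_chr mulr1 normc_real ger0_norm ?abel_ge0.
- apply: (cmeasurableM (cmeasurable_fst mA)).
  apply: (cmeasurableM (cmeasurable_snd mg)).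
  by apply: cmeasurable_chr; exact: measurable_chr2.
- by move=> x u; rewrite !normcM normc_chr mulr1.
- exact: rintegrable_normc.
- exact: ng.
Qed.

End FourierL1.

(** * Bounds preserved by Fatou's lemma, and the limit of the Abel weights *)

Section Fatou.
Context {R : realType}.
Local Notation mu := (@lebesgue_measure R).

Lemma fatou_le (u_ : nat -> R -> R) (u : R -> R) (C : R) :
  (forall n, measurable_fun setT (u_ n)) -> (forall n x, 0 <= u_ n x) ->
  (forall x, u_ n x @[n --> \oo] --> u x) ->
  (forall n, \int[mu]_x (u_ n x)%:E <= C%:E)%E ->
  (\int[mu]_x (u x)%:E <= C%:E)%E.
Proof.
move=> mu_ u0 cu uC.
have -> : (\int[mu]_x (u x)%:E = \int[mu]_x limn_einf (fun n => (u_ n x)%:E))%E.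
  apply: eq_integral => x _.
  have cux : (u_ n x)%:E @[n --> \oo] --> (u x)%:E by apply: cvg_EFin; [exact: nearW|exact: cu].
  by have [-> _] := cvg_limn_einf_sup cux.
apply: le_trans (fatou mu measurableT _ _) _.
- by move=> n; apply/measurable_EFinP; exact: mu_.
- by move=> n x _; rewrite lee_fin.
- rewrite limn_einf_lim; apply: lime_le; first exact: is_cvg_einfs.
  by apply: nearW => n; apply: le_trans (uC n); apply: ereal_inf_lbound; exists n => /=.
Qed.

Lemma cvg_abel (x : R) : abel n.+1%:R^-1 x @[n --> \oo] --> (1 : R).
Proof.
rewrite [X in _ --> X](_ : 1 = expR (- (0 * `|x|))); last by rewrite mul0r oppr0 expR0.
apply: (continuous_cvg _ (@continuous_expR R _)).
by apply: cvgN; apply: cvgM; [exact: cvg_harmonic|exact: cvg_cst].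
Qed.

End Fatou.

(** * The energy bound for the Fourier transform *)

Section PlancherelInequality.
Context {R : realType}.
Local Notation mu := (@lebesgue_measure R).
Implicit Types (f g : R -> R[i]).

Let integral_weighted_poisson (e : R) f : 0 < e -> L2 f ->
  (\int[mu]_u \int[mu]_t (normc (f u) ^+ 2 / 2 * poisson e (u - t))%:E =
    (energy f / 2)%:E)%E.
Proof.
move=> e0 /L2P[mf fi].
have mp (u : R) : measurable_fun setT (fun t : R => poisson e (u - t)).
  apply: (measurable_fun_pair2 u (measurable_poisson_sub e0)).
transitivity (\int[mu]_u (2^-1%:E * (normc (f u) ^+ 2)%:E))%E.
  apply: eq_integral => u _; under eq_integral do rewrite EFinM.
  rewrite ge0_integralZl//.
  - by rewrite integral_poisson_shift// mule1 -EFinM mulrC.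
  - apply/measurable_EFinP; exact: mp.
  - by move=> t _; rewrite lee_fin ltW// poisson_gt0.
  - by rewrite lee_fin divr_ge0// sqr_ge0.
rewrite ge0_integralZl//.
- by rewrite /energy mulrC EFinM fineK//; exact: integrable_fin_num fi.
- by apply/measurable_EFinP; exact: measurable_normc_sqr.
- by move=> u _; rewrite lee_fin sqr_ge0.
Qed.

(* Arithmetic-geometric mean inequality and the unit mass of the Poisson kernel. *)
Let le_integral_poisson (e : R) f : 0 < e -> L2 f ->
  (\int[mu]_u \int[mu]_t (normc (f u) * normc (f t) * poisson e (u - t))%:E <=
    (energy f)%:E)%E.
Proof.
move=> e0 /[dup] fL2 /L2P[mf fi]; have mn := measurable_normc mf.
have mn1 : measurable_fun setT (fun p : R * R => normc (f p.1)).
  by apply: (measurableT_comp mn); exact: measurable_fst.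
have mn2 : measurable_fun setT (fun p : R * R => normc (f p.2)).
  by apply: (measurableT_comp mn); exact: measurable_snd.
have mp := measurable_poisson_sub e0.
have pge0 (u : R) : 0 <= poisson e u by rewrite ltW// poisson_gt0.
have Fge0 (u t : R) : 0 <= normc (f u) * normc (f t) * poisson e (u - t).
  by apply: mulr_ge0 => //; exact: mulr_ge0.
pose G1 (p : R * R) := (normc (f p.1) ^+ 2 / 2 * poisson e (p.1 - p.2))%:E.
pose G2 (p : R * R) := (normc (f p.2) ^+ 2 / 2 * poisson e (p.1 - p.2))%:E.
have mG1 : measurable_fun setT G1.
  apply/measurable_EFinP; apply: measurable_funM => //.
  by apply: measurable_funM => //; exact: measurable_funX.
have mG2 : measurable_fun setT G2.
  apply/measurable_EFinP; apply: measurable_funM => //.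
  by apply: measurable_funM => //; exact: measurable_funX.
have G1ge0 p : (0 <= G1 p)%E by rewrite lee_fin; apply: mulr_ge0 => //; rewrite divr_ge0// sqr_ge0.
have G2ge0 p : (0 <= G2 p)%E by rewrite lee_fin; apply: mulr_ge0 => //; rewrite divr_ge0// sqr_ge0.
have mF1 := @measurable_fun_fubini_tonelli_F _ _ _ _ _ mu G1 mG1 G1ge0.
have mF2 := @measurable_fun_fubini_tonelli_F _ _ _ _ _ mu G2 mG2 G2ge0.
apply: (@le_trans _ _ (\int[mu]_u \int[mu]_t (G1 (u, t) + G2 (u, t)))%E).
  apply: ge0_le_integral => //.
  - by move=> u _; apply: integral_ge0 => t _; rewrite lee_fin.
  - apply: (@measurable_fun_fubini_tonelli_F _ _ _ _ _ mu
      (fun p : R * R => (normc (f p.1) * normc (f p.2) * poisson e (p.1 - p.2))%:E)).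
    + apply/measurable_EFinP; apply: measurable_funM => //.
      exact: measurable_funM.
    + by move=> p; rewrite lee_fin.
  - apply: (@measurable_fun_fubini_tonelli_F _ _ _ _ _ mu (fun p => G1 p + G2 p)%E).
    + exact: emeasurable_funD.
    + by move=> p; rewrite adde_ge0.
  - move=> u _; apply: ge0_le_integral => //.
    + by move=> t _; rewrite lee_fin.
    + apply/measurable_EFinP; apply: measurable_funM.
        by apply: measurable_funM.
      exact: (measurable_fun_pair2 u mp).
    + by apply: emeasurable_funD; [exact: (measurable_fun_pair2 u mG1)|
        exact: (measurable_fun_pair2 u mG2)].
    + move=> t _; rewrite /G1 /G2 /= -EFinD -mulrDl lee_fin ler_wpM2r//.
      have := sqr_ge0 (normc (f u) - normc (f t)); lra.
under eq_integral => u _.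
  rewrite ge0_integralD//; last 2 first.
  - exact: (measurable_fun_pair2 u mG1).
  - exact: (measurable_fun_pair2 u mG2).
  over.
rewrite ge0_integralD//; last 2 first.
- by move=> u _; apply: integral_ge0.
- by move=> u _; apply: integral_ge0.
rewrite [X in (X + _)%E](integral_weighted_poisson e0 fL2).
rewrite (@fubini_tonelli _ _ _ _ _ mu mu G2 mG2 G2ge0) /G2/=.
rewrite [X in (_ + X)%E](_ : _ = (energy f / 2)%:E).
  by rewrite -EFinD -splitr.
rewrite -(integral_weighted_poisson e0 fL2); apply: eq_integral => u _.
by apply: eq_integral => t _; rewrite -[in poisson _ _]opprB poissonN.
Qed.

(** With an Abel weight the energy of the transform becomes a Poisson double integral of [f] against
    itself, bounded by [energy f] uniformly in the weight; Fatou's lemma then removes the weight.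
    The bounded support makes [f] integrable, so that [fourierL1] is an honest integral. *)
Lemma Plancherel_le f (M : R) : L2 f -> (forall t, M < `|t| -> f t = 0) ->
  L2 (fourierL1 f) /\ energy (fourierL1 f) <= energy f.
Proof.
move=> fL2 fM; have fi := L2_bounded_support fL2 fM.
have mF := cmeasurable_fourierL1 fi.
pose e n : R := n.+1%:R^-1.
have e0 n : 0 < e n by rewrite invr_gt0.
have bound n : (\int[mu]_x (abel (e n) x * normc (fourierL1 f x) ^+ 2)%:E <= (energy f)%:E)%E.
  have iA : rintegrable (fun x => abel (e n) x * normc (fourierL1 f x) ^+ 2).
    have := cintegrable_abelM (f := fun x => (normc (fourierL1 f x) ^+ 2)%:C)
      (C := (\int[mu]_t normc (f t)) ^+ 2) (e0 n).
    case.
    - by apply: cmeasurable_real; exact: measurable_normc_sqr.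
    - move=> x; rewrite normc_real ger0_norm ?sqr_ge0// ler_sqr ?nnegrE//.
        exact: normc_fourierL1.
      by apply: Rintegral_ge0.
    - by move=> + _; under eq_fun do rewrite Re_mul/= mulr0 subr0.
  rewrite -[leLHS]fineK; last exact: integrable_fin_num iA.
  rewrite lee_fin -[leLHS]ger0_norm; last first.
    by apply: Rintegral_ge0 => x _; rewrite mulr_ge0 ?abel_ge0// sqr_ge0.
  rewrite -normc_real -cintegral_real.
  have -> : cintegral (fun x => (abel (e n) x * normc (fourierL1 f x) ^+ 2)%:C) =
      cintegral (fun x => (abel (e n) x)%:C * fourierL1 f x * conjc (fourierL1 f x)).
    by congr cintegral; apply/funext => x; rewrite -mulrA mulr_conjc -rmorphM.
  rewrite abel_Plancherel//.
  pose h u := cintegral (fun t => (poisson (e n) (u - t))%:C * f t).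
  have ih u : cintegrable (fun t => (poisson (e n) (u - t))%:C * f t).
    apply: (@le_cintegrable _ _ (fun t => 2 / e n * normc (f t))).
    - apply: cmeasurableM; last exact: cintegrable_measurable.
      by apply: cmeasurable_real; apply: (measurable_fun_pair2 u (measurable_poisson_sub (e0 n))).
    - move=> t; rewrite normcM normc_real ger0_norm ?(ltW (poisson_gt0 _ (e0 n)))//.
      by rewrite ler_wpM2r// poisson_le.
    - by apply: rintegrableZ; exact: rintegrable_normc.
  have ih2 : cintegrable (fun u => conjc (f u) * h u).
    under eq_fun => u do rewrite -cintegralZ//.
    apply: (@cintegrable_partial R (fun u t => conjc (f u) * ((poisson (e n) (u - t))%:C * f t))
      (fun u => 2 / e n * normc (f u)) (fun t => normc (f t))).
    - apply: (cmeasurableM (cmeasurable_fst (cmeasurable_conj (cintegrable_measurable fi)))).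
      apply: (cmeasurableM _ (cmeasurable_snd (cintegrable_measurable fi))).
      by apply: cmeasurable_real; exact: measurable_poisson_sub.
    - move=> u t; rewrite !normcM normc_conj normc_real.
      rewrite ger0_norm ?(ltW (poisson_gt0 _ (e0 n)))// mulrA ler_wpM2r//.
      by rewrite mulrC ler_wpM2r// poisson_le.
    - by apply: rintegrableZ; exact: rintegrable_normc.
    - exact: rintegrable_normc.
  rewrite -lee_fin; apply: le_trans (le_integral_poisson (e0 n) fL2).
  apply: (@le_trans _ _ (\int[mu]_u normc (conjc (f u) * h u))%:E).
    by rewrite lee_fin; exact: normc_cintegral.
  have inh := rintegrable_normc ih2.
  rewrite fineK; last exact: integrable_fin_num inh.
  have mn := measurable_normc (cintegrable_measurable fi).
  apply: ge0_le_integral => //.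
  - by move=> u _; rewrite lee_fin.
  - by apply/measurable_EFinP; exact: rintegrable_measurable.
  - apply: (@measurable_fun_fubini_tonelli_F _ _ _ _ _ mu
      (fun p : R * R => (normc (f p.1) * normc (f p.2) * poisson (e n) (p.1 - p.2))%:E)).
    + apply/measurable_EFinP; apply: measurable_funM; last exact: measurable_poisson_sub.
      by apply: measurable_funM; apply: (measurableT_comp mn);
        [exact: measurable_fst|exact: measurable_snd].
    + move=> p; rewrite lee_fin; apply: mulr_ge0; first exact: mulr_ge0.
      by rewrite ltW// poisson_gt0.
  - move=> u _; have inu := rintegrableZ (normc (f u)) (rintegrable_normc (ih u)).
    apply: (@le_trans _ _ (normc (f u) *
        \int[mu]_t normc ((poisson (e n) (u - t))%:C * f t))%:E).
      by rewrite lee_fin normcM normc_conj ler_wpM2l// normc_cintegral.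
    rewrite -RintegralZl//; last exact: rintegrable_normc.
    rewrite fineK; last exact: integrable_fin_num inu.
    rewrite le_eqVlt; apply/orP; left; apply/eqP; apply: eq_integral => t _.
    rewrite normcM normc_real ger0_norm ?(ltW (poisson_gt0 _ (e0 n)))//.
    by congr EFin; ring.
have lim : (\int[mu]_x (normc (fourierL1 f x) ^+ 2)%:E <= (energy f)%:E)%E.
  apply: (@fatou_le _ (fun n x => abel (e n) x * normc (fourierL1 f x) ^+ 2)) => //.
  - by move=> n; apply: measurable_funM; [exact: measurable_abel|exact: measurable_normc_sqr].
  - by move=> n x; rewrite mulr_ge0 ?abel_ge0// sqr_ge0.
  - move=> x; rewrite -[X in _ --> X]mul1r; apply: cvgM; last exact: cvg_cst.
    exact: cvg_abel.
have FL2 : L2 (fourierL1 f).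
  apply/L2P; split => //; apply/integrableP; split.
    by apply/measurable_EFinP; exact: measurable_normc_sqr.
  under eq_integral do rewrite /= ger0_norm ?sqr_ge0//.
  exact: le_lt_trans lim (ltry _).
split => //; rewrite -lee_fin /energy fineK//.
by apply: (integrable_fin_num measurableT); exact: L2_energy.
Qed.

End PlancherelInequality.

(** * Completeness of L^2 *)

Section Completeness.
Context {R : realType}.
Local Notation mu := (@lebesgue_measure R).

Lemma geometric_increments_cvg (a : nat -> R) (C q : R) : 0 <= q < 1 ->
  (forall k, `|a k.+1 - a k| <= C * q ^+ k) -> cvgn a.
Proof.
move=> /andP[q0 q1] aC.
have C0 : 0 <= C by rewrite -[C]mulr1 -(expr0 q); exact: le_trans (aC 0%N).
suff cs : cvgn (series (telescope a)).
  have -> : a = (fun n => a 0%N + series (telescope a) n).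
    by apply/funext => n; exact: eq_sum_telescope.
  by apply: is_cvgD => //; exact: is_cvg_cst.
apply: (@normed_cvg R R^o); apply: (@series_le_cvg _ _ (geometric C q)).
- by move=> n; exact: normr_ge0.
- by move=> n; rewrite mulr_ge0// exprn_ge0.
- by move=> n; exact: aC.
- by apply: is_cvg_geometric_series; rewrite ger0_norm.
Qed.

Lemma sum_geometric_le (q : R) n : 0 <= q < 1 -> \sum_(0 <= k < n) q ^+ k <= (1 - q)^-1.
Proof.
move=> /andP[q0 q1]; rewrite big_mkord.
have d0 : 0 < 1 - q by rewrite subr_gt0.
rewrite -[leRHS]mul1r ler_pdivlMr// mulrC -[X in (X * _)]opprB mulNr -subrX1.
by rewrite opprB lerBlDr lerDl exprn_ge0.
Qed.

(* Increments of energy at most [2 * 16^-k] are almost everywhere bounded by a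
   multiple of [2^-k]: the series of [4^k] times their energies is integrable. *)
Lemma ae_fast_increments (D : nat -> R -> R[i]) : (forall k, L2 (D k)) ->
  (forall k, energy (D k) <= 2 * (16^-1) ^+ k) ->
  {ae mu, forall x, exists C, forall k, normc (D k x) <= C * 2^-1 ^+ k}.
Proof.
move=> DL2 Dk.
pose f k x := (4 ^+ k * normc (D k x) ^+ 2)%:E : \bar R.
have f0 k x : (0 <= f k x)%E by rewrite lee_fin mulr_ge0 ?exprn_ge0// sqr_ge0.
have mf k : measurable_fun setT (f k).
  apply/measurable_EFinP; apply: measurable_funM => //.
  by apply: measurable_normc_sqr; exact: L2_measurable.
have fint k : (\int[mu]_x f k x <= (2 * 4^-1 ^+ k)%:E)%E.
  have ik := rintegrableZ (4 ^+ k) (L2_energy (DL2 k)).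
  rewrite -[leLHS]fineK; last exact: integrable_fin_num ik.
  rewrite lee_fin -[leLHS]/(\int[mu]_x (4 ^+ k * normc (D k x) ^+ 2)).
  rewrite RintegralZl//; last exact: L2_energy.
  apply: le_trans (ler_wpM2l _ (Dk k)) _; first by rewrite exprn_ge0.
  rewrite mulrCA ler_pM2l// -exprMn (_ : 4 * 16^-1 = 4^-1)//.
  by field.
have sint : (\int[mu]_x (\sum_(k <oo) f k x) <= 4%:E)%E.
  rewrite integral_nneseries//; apply: lime_le.
    by apply: is_cvg_nneseries => n _ _; apply: integral_ge0.
  apply: nearW => n /=.
  apply: (@le_trans _ _ (\sum_(0 <= k < n) (2 * 4^-1 ^+ k)%:E)%E).
    by apply: lee_sum => k _; exact: fint.
  rewrite sumEFin lee_fin -mulr_sumr.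
  have q1 : 0 <= (4^-1 : R) < 1 by rewrite invr_ge0 ler0n invf_lt1// ltr1n.
  have := sum_geometric_le n q1; have -> : (1 - 4^-1 : R)^-1 = 4 / 3 by field.
  lra.
have S0 x : (0 <= \sum_(k <oo) f k x)%E by apply: nneseries_ge0 => n _ _; exact: f0.
have si : mu.-integrable setT (fun x => (\sum_(k <oo) f k x)%E).
  apply/integrableP; split.
    by apply: ge0_emeasurable_sum => [k x _ _|k _]; [exact: f0|exact: mf].
  under eq_integral do rewrite gee0_abs//.
  exact: le_lt_trans sint (ltry _).
apply: ae_imp (integrable_ae measurableT si) => x /(_ I) Sfin.
exists (Num.sqrt (fine (\sum_(k <oo) f k x)%E)) => k.
have s0 : 0 <= fine (\sum_(k <oo) f k x)%E by rewrite fine_ge0.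
rewrite -ler_sqr ?nnegrE// ?mulr_ge0 ?sqrtr_ge0 ?exprn_ge0//.
rewrite exprMn sqr_sqrtr// -exprM mulnC exprM -[leRHS]mulrC.
have -> : (2^-1 ^+ 2 : R) = 4^-1 by rewrite expr2; field.
rewrite exprVn ler_pdivlMl ?exprn_gt0//.
rewrite -lee_fin fineK//; apply: le_trans (nneseries_lim_ge k.+1 _).
- by rewrite big_nat_recr//= leeDr// sume_ge0.
- by [].
Qed.

(** The Cauchy condition has the form [e n + e m] so that the limit inherits the bound [e n] for
    each [n]. A rapidly converging subsequence has an almost everywhere limit, and Fatou's lemma
    along it gives the bound. *)
Lemma L2_complete (F : nat -> R -> R[i]) (e : nat -> R) :
  (forall n, L2 (F n)) ->
  (forall n m, energy (fun x => F n x - F m x) <= e n + e m) ->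
  e n @[n --> \oo] --> (0:R) ->
  exists2 G, L2 G & forall n, energy (fun x => F n x - G x) <= e n.
Proof.
move=> FL2 Fe e0.
have /choice[phi phiP] : forall k, exists n, e n <= 16^-1 ^+ k.
  move=> k; have k0 : 0 < (16^-1 ^+ k : R) by rewrite exprn_gt0// invr_gt0.
  have [N _ NP] := (cvgr0Pnorm_le _).1 e0 _ k0.
  by exists N; apply: le_trans (ler_norm _) (NP N _) => /=.
pose D k x := F (phi k.+1) x - F (phi k) x.
have DL2 k : L2 (D k) by exact: L2B.
have De k : energy (D k) <= 2 * 16^-1 ^+ k.
  apply: le_trans (Fe _ _) _; rewrite mulr_natl mulr2n lerD//.
  apply: le_trans (phiP _) _; rewrite exprS ler_piMl ?exprn_ge0//.
  by rewrite invf_le1// ler1n.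
have [N [mN N0 NP]] := ae_fast_increments DL2 De.
have cvgF x : ~ N x -> exists C, forall k, normc (D k x) <= C * 2^-1 ^+ k.
  by move=> Nx; apply: contrapT => h; apply: Nx; apply: NP.
have mNb : measurable_fun setT (fun t => t \in N).
  apply: (measurable_fun_bool true); rewrite setTI (_ : _ @^-1` _ = N)//.
  by apply/seteqP; split => x /=; [exact: set_mem|exact: mem_set].
(* Setting the functions to 0 on the exceptional null set makes the subsequence converge everywhere,
   so its limit is measurable. *)
pose F' k x := if x \in N then 0 else F (phi k) x.
have mF' k : cmeasurable (F' k).
  have [rF IF] := L2_measurable (FL2 (phi k)).
  split.
  - rewrite (_ : (fun t => _) = (fun t => if t \in N then 0 else complex.Re (F (phi k) t))).
      by apply: measurable_fun_ifT => //; exact: measurable_cst.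
    by apply/funext => t; rewrite /F'; case: (t \in N).
  - rewrite (_ : (fun t => _) = (fun t => if t \in N then 0 else complex.Im (F (phi k) t))).
      by apply: measurable_fun_ifT => //; exact: measurable_cst.
    by apply/funext => t; rewrite /F'; case: (t \in N).
have F'C x : exists C, forall k, normc (F' k.+1 x - F' k x) <= C * 2^-1 ^+ k.
  rewrite /F'; case: (boolP (x \in N)) => [_|xN].
    by exists 0 => k; rewrite subrr ComplexField.Normc.normc0 mul0r.
  by apply: cvgF => /mem_set; apply/negP.
have half : 0 <= (2^-1 : R) < 1 by rewrite invr_ge0 ler0n invf_lt1// ltr1n.
have cRe x : cvgn (fun k => complex.Re (F' k x)).
  have [C CP] := F'C x; apply: (geometric_increments_cvg half) => k.
  by apply: le_trans (CP k); rewrite -Re_opp -Re_add; exact: normr_Re_le.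
have cIm x : cvgn (fun k => complex.Im (F' k x)).
  have [C CP] := F'C x; apply: (geometric_increments_cvg half) => k.
  by apply: le_trans (CP k); rewrite -Im_opp -Im_add; exact: normr_Im_le.
pose G x := limn (fun k => complex.Re (F' k x)) +i* limn (fun k => complex.Im (F' k x)).
have mG : cmeasurable G.
  split => /=.
  - by apply: (@measurable_fun_cvg _ _ _ _ (fun k x => complex.Re (F' k x))) => [k|x _];
      [case: (mF' k)|exact: cRe].
  - by apply: (@measurable_fun_cvg _ _ _ _ (fun k x => complex.Im (F' k x))) => [k|x _];
      [case: (mF' k)|exact: cIm].
have bound n (d : R) : 0 < d -> (\int[mu]_x (normc (F n x - G x) ^+ 2)%:E <= (e n + d)%:E)%E.
  move=> d0.
  have q1 : `|16^-1 : R| < 1 by rewrite ger0_norm ?invr_ge0// invf_lt1// ltr1n.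
  (* From rank [K] on, the errors [16^-1 ^+ k] of the subsequence are at most [d]; Fatou's lemma is
     applied to the shifted subsequence. *)
  have [K _ KP] := (cvgr0Pnorm_le _).1 (cvg_geometric 1 q1) _ d0.
  apply: (@fatou_le _ (fun k x => normc (F n x - F' (k + K)%N x) ^+ 2)).
  - move=> k; apply: measurable_normc_sqr.
    exact: (cmeasurableB (L2_measurable (FL2 n)) (mF' _)).
  - by move=> k x; exact: sqr_ge0.
  - move=> x; rewrite sqr_normc_ReIm !ReImE.
    under eq_fun do rewrite sqr_normc_ReIm !ReImE.
    have cr := cRe x; have ci := cIm x.
    have lim : (complex.Re (F n x) - complex.Re (F' k x)) ^+ 2 +
        (complex.Im (F n x) - complex.Im (F' k x)) ^+ 2 @[k --> \oo] -->
        (complex.Re (F n x) - complex.Re (G x)) ^+ 2 +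
        (complex.Im (F n x) - complex.Im (G x)) ^+ 2.
      by apply: cvgD; apply: (continuous_cvg _ (@exprn_continuous _ 2 _));
        apply: cvgB => //; exact: cvg_cst.
    by move: lim; rewrite -(cvg_shiftn K).
  - move=> k.
    have -> : (\int[mu]_x (normc (F n x - F' (k + K)%N x) ^+ 2)%:E =
        \int[mu]_x (normc (F n x - F (phi (k + K)%N) x) ^+ 2)%:E)%E.
      apply: ae_eq_integral => //.
      + apply/measurable_EFinP; apply: measurable_normc_sqr.
        exact: (cmeasurableB (L2_measurable (FL2 n)) (mF' _)).
      + apply/measurable_EFinP; apply: measurable_normc_sqr.
        by apply: cmeasurableB; exact: L2_measurable.
      + exists N; split => // x /= h; apply: contrapT => Nx; apply: h => _.
        by rewrite /F' memNset.
    have i := L2_energy (L2B (FL2 n) (FL2 (phi (k + K)%N))).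
    rewrite -[leLHS]fineK; last exact: integrable_fin_num i.
    rewrite lee_fin; apply: le_trans (Fe _ _) _; rewrite lerD2l.
    apply: le_trans (phiP _) _.
    have := KP (k + K)%N; rewrite /= leq_addl => /(_ isT).
    by rewrite mul1r; apply: le_trans; exact: ler_norm.
have FG n : L2 (fun x => F n x - G x).
  have mFG : cmeasurable (fun x => F n x - G x).
    exact: (cmeasurableB (L2_measurable (FL2 n)) mG).
  apply/L2P; split => //; apply/integrableP; split.
    by apply/measurable_EFinP; exact: measurable_normc_sqr.
  under eq_integral do rewrite /= ger0_norm ?sqr_ge0//.
  exact: le_lt_trans (bound n 1 ltr01) (ltry _).
exists G.
  have -> : G = (fun x => F 0%N x - (F 0%N x - G x)).
    by apply/funext => x; rewrite opprB addrC subrK.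
  exact: L2B.
move=> n; apply/ler_addgt0Pr => d d0; rewrite -lee_fin; apply: le_trans (bound n d d0).
rewrite /energy fineK//; exact: integrable_fin_num (L2_energy (FG n)).
Qed.

End Completeness.

(** * The Fourier transform on L^2 as a limit over truncations *)

Section FourierL2.
Context {R : realType}.
Local Notation mu := (@lebesgue_measure R).
Local Notation chr a := (cexp (0 +i* a)).
Implicit Types (f g eta : R -> R[i]).

Lemma cvgc_unique (z_ : nat -> R[i]) (z w : R[i]) :
  normc (z_ n - z) @[n --> \oo] --> (0:R) -> normc (z_ n - w) @[n --> \oo] --> (0:R) ->
  z = w.
Proof.
move=> zz zw; apply/eqP; rewrite -subr_eq0; apply/eqP; apply: ComplexField.Normc.eq0_normc.
have : normc (z - w) @[n --> \oo] --> (0 + 0 : R).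
  apply: (@squeeze_cvgr _ _ _ _ (fun=> 0) (fun n => normc (z_ n - z) + normc (z_ n - w))).
  - apply: nearW => n; rewrite normc_ge0/=.
    have -> : z - w = (z_ n - w) - (z_ n - z) by ring.
    by rewrite [leRHS]addrC normcB.
  - by rewrite addr0; exact: cvg_cst.
  - exact: cvgD.
by rewrite addr0 => /(cvg_unique _ (cvg_cst (normc (z - w)))) ->.
Qed.

Lemma Plancherel_truncation f n : L2 f -> L2 (fourierL1 (truncation f n)).
Proof.
by move=> fL2; have [] := Plancherel_le (L2_truncation n fL2) (@truncation_support _ f n).
Qed.

(** A difference of two truncations again has bounded support, so the energy bound carries the
    Cauchy property from the truncations to their transforms. The factor 2 in [e] comes from
    comparing two truncations through [f]. *)
Lemma energy_fourier_truncation f : L2 f ->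
  exists2 g, L2 g &
    energy (fun x => fourierL1 (truncation f n) x - g x) @[n --> \oo] --> (0:R).
Proof.
move=> fL2; pose e n := 2 * energy (fun t => truncation f n t - f t).
have e0 : e n @[n --> \oo] --> (0:R).
  rewrite -[X in _ --> X](mulr0 2); apply: cvgM; first exact: cvg_cst.
  exact: cvg_energy_truncation.
have FL2 n := Plancherel_truncation n fL2.
have [n m|G GL2 GP] := L2_complete FL2 _ e0.
  have tn := L2_truncation n fL2; have tm := L2_truncation m fL2.
  have tnm := L2B tn tm.
  have supp t : (maxn n m)%:R < `|t| -> truncation f n t - truncation f m t = 0.
    move=> tnm'; rewrite !truncation_support ?subr0//.
    - by apply: le_lt_trans tnm'; rewrite ler_nat leq_maxr.
    - by apply: le_lt_trans tnm'; rewrite ler_nat leq_maxl.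
  have [_] := Plancherel_le tnm supp.
  have -> : fourierL1 (fun t => truncation f n t - truncation f m t) =
      (fun x => fourierL1 (truncation f n) x - fourierL1 (truncation f m) x).
    by apply/funext => x; rewrite fourierL1B//; exact: cintegrable_truncation.
  move=> h; apply: (le_trans h).
  have -> : (fun t => truncation f n t - truncation f m t) =
      (fun t => (truncation f n t - f t) - (truncation f m t - f t)).
    by apply/funext => t; rewrite opprB addrA subrK.
  by apply: energy_sub; exact: L2B.
exists G => //; apply: (@squeeze_cvgr _ _ _ _ (fun=> 0) e) => //; last exact: cvg_cst.
by apply: nearW => n; rewrite energy_ge0 GP.
Qed.

(** [fourier] picks a representative by [xget], so the existence of one transform is what gives the
    choice its defining property. *)
Lemma fourierP f : L2 f -> is_fourier f (fourier f).
Proof.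
move=> fL2; apply: (@xgetPex _ _ [set g | is_fourier f g]).
have [g gL2 cg] := energy_fourier_truncation fL2.
exists g; split => //.
have FL2 n := L2B (Plancherel_truncation n fL2) gL2.
under eq_fun do rewrite (L2norm_energy (FL2 _)).
apply: cvg_EFin; first exact: nearW.
rewrite -[X in _ --> X](sqrtr0 R).
exact: (continuous_cvg _ (@sqrt_continuous R 0)).
Qed.

Lemma L2_fourier f : L2 f -> L2 (fourier f).
Proof. by move=> /fourierP[]. Qed.

Lemma cvg_energy_fourier f : L2 f ->
  energy (fun x => fourierL1 (truncation f n) x - fourier f x) @[n --> \oo] --> (0:R).
Proof.
move=> fL2; have [gL2] := fourierP fL2.
have FL2 n := L2B (Plancherel_truncation n fL2) gL2.
under eq_fun do rewrite (L2norm_energy (FL2 _)).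
move=> /fine_cvg /= h.
suff : Num.sqrt (energy (fun x => fourierL1 (truncation f n) x - fourier f x)) ^+ 2
    @[n --> \oo] --> (0 ^+ 2 : R).
  by rewrite expr0n; under eq_fun do rewrite sqr_sqrtr ?energy_ge0//.
exact: (continuous_cvg _ (@exprn_continuous R 2 0)).
Qed.

Lemma cvg_pairing_conj (f_ : nat -> R -> R[i]) f g :
  (forall n, L2 (f_ n)) -> L2 f -> L2 g ->
  energy (fun t => f_ n t - f t) @[n --> \oo] --> (0:R) ->
  normc (cintegral (fun t => g t * conjc (f_ n t)) -
    cintegral (fun t => g t * conjc (f t))) @[n --> \oo] --> (0:R).
Proof.
move=> f_L2 fL2 gL2 cf.
have sw (h : R -> R[i]) : (fun t => g t * conjc (h t)) = (fun t => conjc (h t) * g t).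
  by apply/funext => t; rewrite mulrC.
rewrite sw; under eq_fun do rewrite sw.
apply: (@cvg_pairing _ (fun n t => conjc (f_ n t)) (fun t => conjc (f t))) => //.
- by move=> n; exact: L2_conj.
- exact: L2_conj.
- rewrite (_ : (fun n => _) = (fun n => energy (fun t => f_ n t - f t)))//.
  apply/funext => n; congr Rintegral; apply/funext => t.
  by rewrite -rmorphB/= normc_conj.
Qed.

Lemma fourier_multiplication f eta : cintegrable f -> cintegrable eta ->
  cintegral (fun t => cintegral (fun x => eta x * chr (2 * pi * x * t)) * conjc (f t)) =
  cintegral (fun x => eta x * conjc (fourierL1 f x)).
Proof.
move=> fi ei; have nf := rintegrable_normc fi; have ne := rintegrable_normc ei.
have mf := cintegrable_measurable fi; have me := cintegrable_measurable ei.
transitivity (cintegral (fun x => cintegral (fun t =>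
    eta x * (conjc (f t) * chr (2 * pi * x * t))))); last first.
  congr cintegral; apply/funext => x; rewrite conj_fourierL1// cintegralZ//.
  by apply: cintegrable_chr; [exact: cintegrable_conj|exact: measurable_scale].
rewrite (complex_Fubini (u := fun x => normc (eta x)) (v := fun t => normc (f t)))//.
- congr cintegral; apply/funext => t; rewrite mulrC -cintegralZ.
    by congr cintegral; apply/funext => x; ring.
  apply: cintegrable_chr => //; apply: measurable_funM => //; exact: measurable_scale.
- apply: (cmeasurableM (cmeasurable_fst me)).
  apply: (cmeasurableM (cmeasurable_snd (cmeasurable_conj mf))).
  by apply: cmeasurable_chr; exact: measurable_chr2.
- by move=> x t; rewrite !normcM normc_chr mulr1 normc_conj.
Qed.

(** For truncations of [g] the identity is Fubini. Both sides then pass to the limit, in time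
    because the truncations converge to [g] and in frequency because their transforms converge to
    [fourier g]. It pairs an explicit spectrum [eta] with an arbitrary [g]. *)
Lemma weak_Parseval g eta : L2 g -> cintegrable eta -> L2 eta ->
  L2 (fun t => cintegral (fun x => eta x * chr (2 * pi * x * t))) ->
  cintegral (fun t => cintegral (fun x => eta x * chr (2 * pi * x * t)) * conjc (g t)) =
  cintegral (fun x => eta x * conjc (fourier g x)).
Proof.
move=> gL2 ei eL2 sL2.
apply: (@cvgc_unique (fun n => cintegral (fun x => eta x * conjc (fourierL1 (truncation g n) x)))).
- under eq_fun do rewrite -(fourier_multiplication (cintegrable_truncation _ gL2) ei).
  apply: cvg_pairing_conj => //; last exact: cvg_energy_truncation.
  by move=> n; exact: L2_truncation.
- apply: cvg_pairing_conj => //.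
  + by move=> n; exact: Plancherel_truncation.
  + exact: L2_fourier.
  + exact: cvg_energy_fourier.
Qed.

End FourierL2.

(** * Local identities and Fourier inversion *)

Section LocalIntegrability.
Context {R : realType}.
Local Notation mu := (@lebesgue_measure R).
Implicit Types (u : R -> R).

Lemma rintegrable_itv u (a b : R) : rintegrable (fun x => \1_`[a, b] x * u x) ->
  measurable_fun setT u -> mu.-integrable `[a, b] (EFin \o u).
Proof.
move=> iu mu'; apply: (@integrable_mkcond _ _ _ mu `[a, b]%classic (EFin \o u) (measurable_itv _)).2.
apply: eq_integrable iu => // x _; rewrite /= patchE indicE.
by case: ifPn => xab; rewrite ?mul1r ?mul0r.
Qed.

Lemma Rintegral_indic_mul u (A : set R) :
  \int[mu]_x (\1_A x * u x) = \int[mu]_(x in A) u x.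
Proof.
rewrite [RHS]Rintegral_mkcond; congr Rintegral; apply/funext => x.
by rewrite patchE indicE; case: ifPn => _; rewrite ?mul1r ?mul0r.
Qed.

Lemma locally_integrable_itv u : measurable_fun setT u ->
  (forall M, rintegrable (fun x => \1_`[- M, M] x * u x)) ->
  locally_integrable setT u.
Proof.
move=> mu' iu; split => //; first exact: openT.
move=> K _ cK; have [M [_ MK]] := compact_bounded cK.
have KM : K `<=` `[- (M + 1), M + 1].
  by move=> x Kx; rewrite /= in_itv/= -ler_norml; apply: (MK (M + 1)) => //; rewrite ltrDl.
have /integrableP[_] := rintegrable_itv (iu (M + 1)) mu'.
apply: le_lt_trans; apply: ge0_subset_integral => //.
- exact: compact_measurable.
- by apply/measurable_EFinP; apply: measurableT_comp => //; exact: measurable_funTS.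
Qed.

(* Every point is the right end of an interval over which the primitive vanishes
   identically, so Lebesgue differentiation gives the value zero. *)
Lemma ae_zero_of_itv u : measurable_fun setT u ->
  (forall M, rintegrable (fun x => \1_`[- M, M] x * u x)) ->
  (forall a b, a < b -> \int[mu]_(x in `[a, b]) u x = 0) ->
  {ae mu, forall x, u x = 0}.
Proof.
move=> mu' iu u0; have lu := locally_integrable_itv mu' iu.
apply: ae_imp (lebesgue_differentiation lu) => x ux.
pose M := `|x| + 1.
have iM : mu.-integrable `[x - 1, x + 1] (EFin \o u).
  apply: integrableS (rintegrable_itv (iu M) mu') => //.
  apply: subset_itv; rewrite bnd_simp /M.
    by have := ler_norm (- x); rewrite normrN; lra.
  by have := ler_norm x; lra.
have xx1 : x < x + 1 by rewrite ltrDl.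
have [|_ <-] := FTC1_lebesgue_pt xx1 iM _ ux.
  by rewrite lte_fin ltrBlDr ltrDl.
rewrite derive1E; suff [_ ->] : is_derive x 1 (fun y => \int[mu]_(t in `[x - 1, y]) u t) 0 by [].
apply: (@near_eq_is_derive _ _ _ (fun=> 0)).
near=> y; apply/esym/u0; near: y.
by apply: lt_nbhsr; rewrite ltrBlDr ltrDl.
Unshelve. all: by end_near. Qed.

End LocalIntegrability.

(** * Parseval against indicators, and Fourier inversion *)

Section Inversion.
Context {R : realType}.
Local Notation mu := (@lebesgue_measure R).
Local Notation chr a := (cexp (0 +i* a)).
Implicit Types (f g : R -> R[i]).

Lemma cvg_norm_sub (u_ : nat -> R) (l : R) :
  u_ n @[n --> \oo] --> l -> `|u_ n - l| @[n --> \oo] --> (0:R).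
Proof.
move=> ul; rewrite -(normr0 R) -[X in `|X|](subrr l).
by apply: cvg_norm; apply: cvgB => //; exact: cvg_cst.
Qed.

Definition box (a b t : R) : R[i] := (\1_`[a, b] t)%:C.

Lemma cmeasurable_box a b : cmeasurable (box a b).
Proof. by apply: cmeasurable_real; exact: measurable_indic. Qed.

Lemma normc_box_le1 a b t : normc (box a b t) <= 1.
Proof. by rewrite normc_real indicE; case: (t \in _); rewrite ?normr1 ?normr0. Qed.

Lemma cintegrable_box a b : cintegrable (box a b).
Proof.
by split; [exact: rintegrable_indic_itv|exact: rintegrable0].
Qed.

Lemma L2_box a b : L2 (box a b).
Proof.
apply: (@le_L2 _ _ (\1_`[a, b] : R -> R)); first exact: cmeasurable_box.
- by move=> t; rewrite normc_real indicE; case: (t \in _); rewrite ?normr1 ?normr0 ?expr1n ?expr0n.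
- exact: rintegrable_indic_itv.
Qed.

Lemma box_support a b t : Num.max `|a| `|b| < `|t| -> box a b t = 0.
Proof.
move=> tab; rewrite /box indicE memNset//= in_itv/= => /andP[ta tb]; move: tab.
by rewrite ltNge => /negP; apply; rewrite le_max; have [t0|t0] := leP 0 t;
  rewrite ?(ger0_norm t0) ?(ltr0_norm t0); [apply/orP; right|apply/orP; left];
  [rewrite (le_trans tb)// ler_norm|rewrite -normrN (le_trans _ (ler_norm _))// lerN2].
Qed.

Lemma L2_fourier_box a b : L2 (fourierL1 (box a b)).
Proof. by have [] := Plancherel_le (L2_box a b) (@box_support a b). Qed.

Lemma ae_neq (a : R) : {ae mu, forall x, x != a}.
Proof.
exists [set a]; split; first exact: measurable_set1.
- exact: lebesgue_measure_set1.
- by move=> x /= /negP; rewrite negbK => /eqP.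
Qed.

(** The transform of an indicator is not integrable, so [weak_Parseval] is out of reach. Instead
    both sides are limits of the Abel-weighted pairings [z n]: in frequency the weight tends to 1,
    in time the Poisson average of the indicator tends to the indicator off its end points. *)
Lemma box_Parseval_support a b g : a < b -> L2 g -> cintegrable g -> L2 (fourierL1 g) ->
  cintegral (fun t => box a b t * conjc (g t)) =
  cintegral (fun x => fourierL1 (box a b) x * conjc (fourierL1 g x)).
Proof.
move=> ab gL2 gi GL2; pose e n : R := n.+1%:R^-1.
have e0 n : 0 < e n by rewrite invr_gt0.
have bi := cintegrable_box a b.
have mg := cintegrable_measurable gi.
pose E n (u : R) : R := \int[mu]_(t in `[a, b]) poisson (e n) (u - t).
have hE n u : cintegral (fun t => (poisson (e n) (u - t))%:C * box a b t) = (E n u)%:C.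
  rewrite /E -Rintegral_indic_mul -cintegral_real; congr cintegral; apply/funext => t.
  by rewrite /box -rmorphM/= mulrC.
have mE n : measurable_fun setT (E n).
  rewrite (_ : E n = fun u => pi^-1 * atan (2 * pi / e n * (u - a)) -
      pi^-1 * atan (2 * pi / e n * (u - b))); last first.
    by apply/funext => u; rewrite /E Rintegral_poisson_itv.
  have m1 c : measurable_fun setT (fun u : R => pi^-1 * atan (2 * pi / e n * (u - c))).
    apply: (measurableT_comp (f := fun u => pi^-1 * atan (2 * pi / e n * u))).
      apply: continuous_measurable_fun => x.
      exact: (is_derive_continuous (is_derive_poisson_primitive x (e0 n))).
    by apply: measurable_funB.
  exact: measurable_funB.
have GL2' := L2_conj GL2.
pose z n := cintegral (fun x =>
  (abel (e n) x)%:C * fourierL1 (box a b) x * conjc (fourierL1 g x)).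
have mG := cmeasurableM (L2_measurable (L2_fourier_box a b)) (L2_measurable GL2').
apply: (@cvgc_unique _ z).
- have zE n : z n = cintegral (fun u => (E n u)%:C * conjc (g u)).
    rewrite /z abel_Plancherel//; congr cintegral; apply/funext => u.
    by rewrite hE mulrC.
  under eq_fun do rewrite zE.
  apply: (@dominated_cvg_cintegral _ _ _ (fun u => normc (g u))).
  + move=> n; apply: cmeasurableM; first exact: cmeasurable_real.
    exact: cmeasurable_conj.
  + by apply: cmeasurableM; [exact: cmeasurable_box|exact: cmeasurable_conj].
  + apply: ae_imp2 (ae_neq a) (ae_neq b) => u ua ub.
    have cu := cvg_Rintegral_poisson_itv ab ua ub.
    have h : `|E n u - \1_`[a, b] u| * normc (g u) @[n --> \oo] --> (0 * normc (g u)).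
      apply: cvgM; last exact: cvg_cst.
      exact: cvg_norm_sub cu.
    rewrite mul0r in h; apply: cvg_trans h; apply: near_eq_cvg; apply: nearW => n.
    by rewrite -mulrBl normcM normc_conj /box -rmorphB/= normc_real.
  + exact: rintegrable_normc.
  + move=> n u; rewrite normcM normc_conj normc_real ler_piMl//.
    have /andP[E0 E1] := Rintegral_poisson_itv_bound u (e0 n) ab.
    by rewrite ger0_norm.
  + by move=> u; rewrite normcM normc_conj ler_piMl// normc_box_le1.
- apply: (@dominated_cvg_cintegral _ _ _
    (fun x => normc (fourierL1 (box a b) x) * normc (conjc (fourierL1 g x)))).
  + move=> n; under eq_fun do rewrite -mulrA.
    by apply: (cmeasurableM (cmeasurable_real (measurable_abel _)) mG).
  + exact: mG.
  + apply: ae_all => x.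
    pose w := fourierL1 (box a b) x * conjc (fourierL1 g x).
    have h : `|abel (e n) x - 1| * normc w @[n --> \oo] --> (0 * normc w).
      apply: cvgM; last exact: cvg_cst.
      exact: cvg_norm_sub (cvg_abel x).
    rewrite mul0r in h; apply: cvg_trans h; apply: near_eq_cvg; apply: nearW => n.
    rewrite [in RHS](_ : _ - _ = (abel (e n) x - 1)%:C * w); last first.
      by rewrite rmorphB/= mulrBl mul1r -mulrA.
    by rewrite normcM normc_real.
  + exact: rintegrable_mulL2 (L2_fourier_box a b) GL2'.
  + move=> n x; rewrite !normcM -mulrA ler_piMl ?mulr_ge0//.
    by rewrite normc_real ger0_norm ?abel_ge0// abel_le1.
  + by move=> x; rewrite normcM.
Qed.

Lemma box_Parseval a b g : a < b -> L2 g ->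
  cintegral (fun t => box a b t * conjc (g t)) =
  cintegral (fun x => fourierL1 (box a b) x * conjc (fourier g x)).
Proof.
move=> ab gL2; have FL2 n := Plancherel_truncation n gL2.
apply: (@cvgc_unique _ (fun n => cintegral (fun x =>
  fourierL1 (box a b) x * conjc (fourierL1 (truncation g n) x)))).
- under eq_fun => n do rewrite -(box_Parseval_support ab (L2_truncation n gL2)
    (cintegrable_truncation n gL2) (FL2 n)).
  apply: cvg_pairing_conj => //; last exact: cvg_energy_truncation.
  + by move=> n; exact: L2_truncation.
  + exact: L2_box.
- apply: cvg_pairing_conj => //; last exact: cvg_energy_fourier.
  + exact: L2_fourier.
  + exact: L2_fourier_box.
Qed.

Lemma normc_inverse_fourier f t : cintegrable f ->
  normc (cintegral (fun x => f x * chr (2 * pi * x * t))) <= \int[mu]_x normc (f x).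
Proof.
move=> fi; have mt : measurable_fun setT (fun x : R => 2 * pi * x * t).
  by apply: measurable_funM => //; exact: measurable_scale.
have i := cintegrable_chr fi mt.
apply: le_trans (normc_cintegral i) _; apply: le_rintegral.
- exact: rintegrable_normc i.
- exact: rintegrable_normc.
- by move=> x; rewrite normcM normc_chr mulr1.
Qed.

Lemma inverse_fourierE f t : cintegrable f ->
  cintegral (fun x => f x * chr (2 * pi * x * t)) =
  conjc (fourierL1 (fun x => conjc (f x)) t).
Proof.
move=> fi; rewrite conj_fourierL1; last exact: cintegrable_conj.
by congr cintegral; apply/funext => x; rewrite conjcK mulrAC.
Qed.

Lemma cmeasurable_inverse_fourier f : cintegrable f ->
  cmeasurable (fun t => cintegral (fun x => f x * chr (2 * pi * x * t))).
Proof.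
move=> fi; under eq_fun do rewrite inverse_fourierE//.
by apply/cmeasurable_conj/cmeasurable_fourierL1/cintegrable_conj.
Qed.

(** [g] and the inverse transform [G] of its spectrum have the same integral over every bounded
    interval, by [box_Parseval] for [g] and by Fubini for [G]; Lebesgue differentiation then
    identifies them. *)
Lemma fourier_inversion g : L2 g -> cintegrable (fourier g) ->
  {ae mu, forall t, g t = cintegral (fun x => fourier g x * chr (2 * pi * x * t))}.
Proof.
move=> gL2 Gi; pose G t := cintegral (fun x => fourier g x * chr (2 * pi * x * t)).
have mG : cmeasurable G by exact: cmeasurable_inverse_fourier.
have mg := L2_measurable gL2.
pose C := \int[mu]_x normc (fourier g x).
have GC t : normc (G t) <= C by exact: normc_inverse_fourier.
have C0 : 0 <= C by exact: le_trans (normc_ge0 _) (GC 0).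
have iloc M : cintegrable (fun t => box (- M) M t * (g t - G t)).
  apply: (@le_cintegrable _ _ (fun t => normc (g t) ^+ 2 + (1 + C) * \1_`[- M, M] t)).
  - by apply: cmeasurableM; [exact: cmeasurable_box|exact: cmeasurableB].
  - move=> t; rewrite normcM normc_real indicE; case: (t \in _) => /=; last first.
      by rewrite normr0 mul0r mulr0 addr0 sqr_ge0.
    rewrite normr1 mul1r mulr1 (le_trans (normcB _ _))//.
    have := GC t; have := sqr_ge0 (normc (g t) - 2^-1); rewrite sqrrB; lra.
  - apply: rintegrableD; first exact: L2_energy.
    by apply: rintegrableZ; exact: rintegrable_indic_itv.
have key a b : a < b -> cintegral (fun t => box a b t * conjc (g t - G t)) = 0.
  move=> ab.
  have bi := cintegrable_box a b.
  have ig : cintegrable (fun t => box a b t * conjc (g t)).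
    by apply: cintegrable_mulL2; [exact: L2_box|exact: L2_conj].
  have iG : cintegrable (fun t => box a b t * conjc (G t)).
    apply: (@le_cintegrable _ _ (fun t => C * normc (box a b t))).
    - by apply: cmeasurableM; [exact: cmeasurable_box|exact: cmeasurable_conj].
    - by move=> t; rewrite normcM normc_conj mulrC ler_wpM2r.
    - by apply: rintegrableZ; exact: rintegrable_normc.
  under eq_fun do rewrite rmorphB/= mulrBr.
  rewrite cintegralB// box_Parseval//.
  suff -> : cintegral (fun t => box a b t * conjc (G t)) =
      cintegral (fun x => fourierL1 (box a b) x * conjc (fourier g x)) by rewrite subrr.
  have -> : cintegral (fun t => box a b t * conjc (G t)) =
      conjc (cintegral (fun t => G t * conjc (box a b t))).
    rewrite -cintegral_conj; last first.
      rewrite (_ : (fun t => _) = (fun t => conjc (box a b t * conjc (G t)))).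
        exact: cintegrable_conj.
      by apply/funext => t; rewrite rmorphM/= conjcK mulrC.
    by congr cintegral; apply/funext => t; rewrite rmorphM/= conjcK mulrC.
  rewrite (fourier_multiplication bi Gi) -cintegral_conj; last first.
    apply: cintegrable_mulL2; first exact: L2_fourier.
    exact: L2_conj (L2_fourier_box a b).
  by congr cintegral; apply/funext => x; rewrite rmorphM/= conjcK mulrC.
have itv0 (u : R -> R) : measurable_fun setT u ->
    (forall M, rintegrable (fun t => \1_`[- M, M] t * u t)) ->
    (forall a b, a < b -> \int[mu]_t (\1_`[a, b] t * u t) = 0) ->
    {ae mu, forall t, u t = 0}.
  move=> mu' iu u0; apply: ae_zero_of_itv => // a b ab.
  by rewrite -Rintegral_indic_mul u0.
have [mr mi] := cmeasurableB mg mG.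
have hr : {ae mu, forall t, complex.Re (g t - G t) = 0}.
  apply: itv0 => //.
  - move=> M; have [+ _] := iloc M.
    by under eq_fun do rewrite Re_mul Im_real mul0r subr0 Re_real.
  - move=> a b ab; have /(congr1 (@complex.Re R)) := key a b ab.
    rewrite /= => h; rewrite -[RHS]h; apply: eq_Rintegral => t _.
    by rewrite Re_mul Im_real mul0r subr0 Re_real Re_conj.
have hi : {ae mu, forall t, - complex.Im (g t - G t) = 0}.
  apply: itv0.
  - exact: measurableT_comp.
  - move=> M; have [_ /rintegrableN] := iloc M.
    by under eq_fun do rewrite Im_mul Im_real mul0r addr0 Re_real -mulrN.
  - move=> a b ab; have /(congr1 (@complex.Im R)) := key a b ab.
    rewrite /= => h; rewrite -[RHS]h; apply: eq_Rintegral => t _.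
    by rewrite Im_mul Im_real mul0r addr0 Re_real Im_conj.
apply: ae_imp2 hr hi => t rt it; apply/eqP; rewrite -subr_eq0; apply/eqP.
by apply: complex_ext => //; apply: oppr_inj; rewrite it oppr0.
Qed.

End Inversion.

(** * Laplace transforms *)

Section ComplexDerivative.
Context {R : realType}.
Implicit Types (z w : R[i]).

Lemma MVT01 (f df : R -> R) : (forall x : R, is_derive x 1 f (df x)) ->
  exists2 c, 0 <= c <= 1 & f 1 - f 0 = df c.
Proof.
move=> dff.
have cf : {within `[0, 1], continuous f}.
  by apply: continuous_subspaceT => x; exact: is_derive_continuous (dff x).
have [c c01 ->] := MVT_segment ler01 (fun x _ => dff x) cf.
by exists c; rewrite ?subr0 ?mulr1//; move: c01; rewrite in_itv.
Qed.

Lemma is_derive_Re_cexp w (t : R) :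
  is_derive t 1 (fun s => complex.Re (cexp (s%:C * w))) (complex.Re (w * cexp (t%:C * w))).
Proof.
rewrite (_ : (fun s : R => _) = (fun s => expR (complex.Re w * s) * cos (complex.Im w * s))); last first.
  by apply/funext => s; rewrite /cexp/= !ReImE/= !mul0r subr0 addr0 ![s * _]mulrC.
have d1 := is_derive_comp (is_derive_expR _) (is_derive_linear (complex.Re w) t).
have d2 := is_derive_comp (is_derive_cos _) (is_derive_linear (complex.Im w) t).
apply: is_derive_eq (is_derive_mul d1 d2) _.
by rewrite Re_mul /cexp/= !ReImE/= !mul0r subr0 addr0 ![t * _]mulrC; ring.
Qed.

Lemma is_derive_Im_cexp w (t : R) :
  is_derive t 1 (fun s => complex.Im (cexp (s%:C * w))) (complex.Im (w * cexp (t%:C * w))).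
Proof.
rewrite (_ : (fun s : R => _) = (fun s => expR (complex.Re w * s) * sin (complex.Im w * s))); last first.
  by apply/funext => s; rewrite /cexp/= !ReImE/= !mul0r subr0 addr0 ![s * _]mulrC.
have d1 := is_derive_comp (is_derive_expR _) (is_derive_linear (complex.Re w) t).
have d2 := is_derive_comp (is_derive_sin _) (is_derive_linear (complex.Im w) t).
apply: is_derive_eq (is_derive_mul d1 d2) _.
by rewrite Im_mul /cexp/= !ReImE/= !mul0r subr0 addr0 ![t * _]mulrC; ring.
Qed.

Lemma normc_cexp_scale w (c : R) : 0 <= c <= 1 ->
  normc (cexp (c%:C * w)) <= expR (normc w).
Proof.
move=> /andP[c0 c1]; rewrite normc_cexp ler_expR Re_mul Re_real Im_real mul0r subr0.
rewrite (le_trans (ler_norm _))// normrM ger0_norm//.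
by rewrite (le_trans (ler_piMl _ c1))// normr_Re_le.
Qed.

(** The mean value theorem is available for real functions only, so it is applied to the real and
    the imaginary part along the segment from 0 to [w]; this costs the factor 2, and the factor 4 in
    the second-order bound. *)
Lemma normc_cexpB1 w : normc (cexp w - 1) <= 2 * (normc w * expR (normc w)).
Proof.
have bound c : 0 <= c <= 1 -> normc (w * cexp (c%:C * w)) <= normc w * expR (normc w).
  by move=> c01; rewrite normcM ler_wpM2l// normc_cexp_scale.
rewrite (le_trans (normc_le_ReIm _))// mulr_natl mulr2n; apply: lerD.
- have [c c01] := MVT01 (is_derive_Re_cexp w).
  rewrite mul1r mul0r cexp0 -Re_opp -Re_add => ->.
  exact: le_trans (normr_Re_le _) (bound c c01).
- have [c c01] := MVT01 (is_derive_Im_cexp w).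
  rewrite mul1r mul0r cexp0 -Im_opp -Im_add => ->.
  exact: le_trans (normr_Im_le _) (bound c c01).
Qed.

Lemma normc_cexpB1B w : normc (cexp w - 1 - w) <= 4 * (normc w ^+ 2 * expR (normc w)).
Proof.
have bound c : 0 <= c <= 1 ->
    normc (w * (cexp (c%:C * w) - 1)) <= 2 * (normc w ^+ 2 * expR (normc w)).
  move=> /andP[c0 c1]; rewrite normcM; have := normc_cexpB1 (c%:C * w).
  rewrite normcM normc_real ger0_norm// => h.
  apply: le_trans (ler_wpM2l _ h) _ => //.
  have hc : c * normc w * expR (c * normc w) <= normc w * expR (normc w).
    apply: ler_pM; rewrite ?expR_ge0 ?mulr_ge0//; first exact: ler_piMl.
    by rewrite ler_expR ler_piMl.
  have -> : 2 * (normc w ^+ 2 * expR (normc w)) =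
      normc w * (2 * (normc w * expR (normc w))) by ring.
  by rewrite ler_wpM2l// ler_pM2l.
have -> : 4 * (normc w ^+ 2 * expR (normc w)) =
    2 * (normc w ^+ 2 * expR (normc w)) + 2 * (normc w ^+ 2 * expR (normc w)) by ring.
rewrite (le_trans (normc_le_ReIm _))//; apply: lerD.
- pose r (s : R) := complex.Re (cexp (s%:C * w)) - complex.Re w * s.
  have dr (t : R) : is_derive t 1 r (complex.Re (w * (cexp (t%:C * w) - 1))).
    apply: is_derive_eq (is_derive_add (is_derive_Re_cexp w t)
      (is_derive_opp (is_derive_linear (complex.Re w) t))) _.
    by rewrite mulrBr mulr1 Re_add Re_opp.
  have [c c01] := MVT01 dr; rewrite /r mul1r mul0r cexp0 mulr1 mulr0 subr0 => h.
  have -> : complex.Re (cexp w - 1 - w) = complex.Re (w * (cexp (c%:C * w) - 1)).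
    by rewrite -h !Re_add !Re_opp addrAC.
  exact: le_trans (normr_Re_le _) (bound c c01).
- pose r (s : R) := complex.Im (cexp (s%:C * w)) - complex.Im w * s.
  have dr (t : R) : is_derive t 1 r (complex.Im (w * (cexp (t%:C * w) - 1))).
    apply: is_derive_eq (is_derive_add (is_derive_Im_cexp w t)
      (is_derive_opp (is_derive_linear (complex.Im w) t))) _.
    by rewrite mulrBr mulr1 Im_add Im_opp.
  have [c c01] := MVT01 dr; rewrite /r mul1r mul0r cexp0 mulr1 mulr0 subr0 => h.
  have -> : complex.Im (cexp w - 1 - w) = complex.Im (w * (cexp (c%:C * w) - 1)).
    by rewrite -h !Im_add !Im_opp addrAC.
  exact: le_trans (normr_Im_le _) (bound c c01).
Qed.

Lemma sqr_le_expR (x : R) : 0 <= x -> x ^+ 2 <= 4 * expR x.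
Proof.
move=> x0; have h : 1 + x / 2 <= expR (x / 2) by exact: expR_ge1Dx.
have -> : expR x = expR (x / 2) ^+ 2 by rewrite expr2 -expRD -splitr.
have x1 : 0 <= 1 + x / 2 by rewrite addr_ge0// divr_ge0.
have : (1 + x / 2) ^+ 2 <= expR (x / 2) ^+ 2 by rewrite ler_sqr ?nnegrE// expR_ge0.
nra.
Qed.

Lemma normC_normc z : `|z| = (normc z)%:C.
Proof. by []. Qed.

Lemma ltr_normC_real z (d : R) : (`|z| < d%:C) = (normc z < d).
Proof. by rewrite normC_normc ltcR. Qed.

Lemma gt0_complex (e : R[i]) : 0 < e -> e = (complex.Re e)%:C /\ 0 < complex.Re e.
Proof. by rewrite ltcE /= => /andP[/eqP h e0]; split => //; apply: complex_ext. Qed.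

Lemma derivable_of_bound (h : R[i] -> R[i]) z l (K d : R) : 0 < d ->
  (forall t, normc t < d -> normc (h (z + t) - h z - t * l) <= K * normc t ^+ 2) ->
  derivable (h : R[i]^o -> R[i]^o) z 1.
Proof.
move=> d0 hK; apply/cvg_ex; exists l; apply/cvgrPdist_le => e /gt0_complex[-> e0].
have K1 : 0 < `|K| + 1 by rewrite ltr_wpDl.
near=> t.
have t0 : t != 0 by near: t; exact: nbhs_dnbhs_neq.
have tn : normc t < Num.min d (complex.Re e / (`|K| + 1)).
  rewrite -ltr_normC_real; near: t; apply: dnbhs0_lt.
  by rewrite ltcR lt_min d0 divr_gt0.
move: tn; rewrite lt_min => /andP[td te].
rewrite normC_normc lecR /=.
have -> : l - t^-1 *: (h (t *: 1 + z) - h z) = - (t^-1 * (h (z + t) - h z - t * l)).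
  have key (u : R[i]) : l - t^-1 * u = - (t^-1 * (u - t * l)).
    by rewrite mulrBr mulKf// opprB.
  by rewrite /GRing.scale/= mulr1 [t + z]addrC; exact: key.
rewrite normcN normcM ComplexField.Normc.normcV.
have tn0 : 0 < normc t.
  by rewrite lt_neqAle normc_ge0 andbT eq_sym; apply: contra t0 => /eqP/ComplexField.Normc.eq0_normc ->.
rewrite ler_pdivrMl//; apply: le_trans (hK t td) _.
rewrite expr2 mulrA mulrC ler_pM2l//.
move: te; rewrite ltr_pdivlMr// => te.
apply: le_trans (ltW te); rewrite mulrC ler_wpM2l//.
by rewrite (le_trans (ler_norm _))// lerDl.
Unshelve. all: by end_near. Qed.

Lemma derivable_dist (h : R[i] -> R[i]) z :
  derivable (h : R[i]^o -> R[i]^o) z 1 ->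
  exists l, forall e : R, 0 < e -> exists2 d : R, 0 < d &
    forall t, t != 0 -> normc t < d -> normc (t^-1 * (h (z + t) - h z) - l) <= e.
Proof.
move=> /cvg_ex[l /cvgrPdist_le hl]; exists l => e e0.
have /hl : 0 < (e%:C : R[i]) by rewrite ltcR.
rewrite /= near_withinE => /nbhs_ballP[d /gt0_complex[-> d0] dP].
exists (complex.Re d) => // t t0 td.
have := dP t; rewrite /ball/= sub0r normrN ltr_normC_real => /(_ td t0).
rewrite normC_normc lecR -normcN opprB /GRing.scale/= mulr1 addrC.
by rewrite [t + z]addrC addrC.
Qed.

End ComplexDerivative.

(** * Holomorphy of Laplace transforms *)

Section FourierLaplace.
Context {R : realType}.
Local Notation mu := (@lebesgue_measure R).
Local Notation chr a := (cexp (0 +i* a)).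
Variable m : R -> R[i].
Hypothesis mm : cmeasurable m.
Hypothesis m_support : forall x, x <= 0 -> m x = 0.
Hypothesis m_decay : forall y, 0 < y -> rintegrable (fun x => normc (m x) * expR (- (2 * pi * y * x))).

Definition laplace (z : R[i]) : R[i] :=
  cintegral (fun x => m x * cexp ((0 +i* (2 * pi * x)) * z)).

Let cmeasurable_kernel (z : R[i]) : cmeasurable (fun x : R => (0 +i* (2 * pi * x)) * z).
Proof.
apply: cmeasurableM; last exact: cmeasurable_cst.
by split; [exact: measurable_cst|exact: measurable_scale].
Qed.

Lemma normc_kernel (x : R) (z : R[i]) :
  normc (cexp ((0 +i* (2 * pi * x)) * z)) = expR (- (2 * pi * complex.Im z * x)).
Proof.
by rewrite normc_cexp Re_mul /= mul0r sub0r; congr (expR (- _)); ring.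
Qed.

Lemma cintegrable_laplace z : 0 < complex.Im z ->
  cintegrable (fun x => m x * cexp ((0 +i* (2 * pi * x)) * z)).
Proof.
move=> z0; apply: le_cintegrable (m_decay z0).
- by apply: cmeasurableM => //; exact: cmeasurable_cexp.
- by move=> x; rewrite normcM normc_kernel.
Qed.

Let normc_freq (x : R) : 0 <= x -> normc (0 +i* (2 * pi * x)) = 2 * pi * x.
Proof.
move=> x0; rewrite /ComplexField.Normc.normc expr0n add0r sqrtr_sqr ger0_norm//.
by rewrite !mulr_ge0// pi_ge0.
Qed.

Let le_expR_div (c x : R) : 0 < c -> x <= expR (c * x) / c.
Proof.
move=> c0; rewrite ler_pdivlMr// mulrC; have := expR_ge1Dx (c * x); lra.
Qed.

Let sqr_le_expR_div (c x : R) : 0 < c -> 0 <= x -> x ^+ 2 <= 4 / c ^+ 2 * expR (c * x).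
Proof.
move=> c0 x0; rewrite mulrAC ler_pdivlMr ?exprn_gt0// -exprMn mulrC.
by apply: sqr_le_expR; rewrite mulr_ge0// ltW.
Qed.

(** The Taylor remainder of the exponential is quadratic in the increment [t]. For [|t| < y / 4]
    both the growth [expR (X * normc t)] and the square of the frequency [X = 2 * pi * x] cost a
    factor [expR (y / 4 * X)]; the decay at height [y] absorbs both and leaves the integrable decay
    at height [y / 2]. *)
Lemma derivable_laplace z : 0 < complex.Im z ->
  derivable (laplace : R[i]^o -> R[i]^o) z 1.
Proof.
move=> z0; pose y := complex.Im z; have y0 : 0 < y by [].
have pi0 := pi_gt0 R.
pose E x := cexp ((0 +i* (2 * pi * x)) * z).
have mE : cmeasurable E by exact: cmeasurable_cexp.
have mf : cmeasurable (fun x : R => 0 +i* (2 * pi * x)).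
  by split; [exact: measurable_cst|exact: measurable_scale].
have y2 : 0 < y / 2 by rewrite divr_gt0.
have y4 : 0 < y / 4 by rewrite divr_gt0.
pose g x := normc (m x) * expR (- (2 * pi * (y / 2) * x)).
have ig : rintegrable g := m_decay y2.
have g0 x : 0 <= g x by rewrite mulr_ge0 ?expR_ge0.
have il : cintegrable (fun x => m x * E x * (0 +i* (2 * pi * x))).
  apply: (@le_cintegrable _ _ (fun x => 2 / y * g x)).
  - by apply: cmeasurableM => //; exact: cmeasurableM.
  - move=> x; have [x0|x0] := leP x 0.
      by rewrite m_support// !mul0r ComplexField.Normc.normc0 mulr_ge0// divr_ge0// ltW.
    rewrite !normcM normc_kernel normc_freq ?(ltW x0)// -/y /g -[leLHS]mulrA [leRHS]mulrCA ler_wpM2l//.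
    have c0 : 0 < y / 2 by [].
    have := le_expR_div (2 * pi * x) c0.
    have -> : expR (y / 2 * (2 * pi * x)) / (y / 2) =
        2 / y * expR (2 * pi * (y / 2) * x).
      by rewrite invf_div mulrC; congr (_ * expR _); ring.
    move=> h; apply: le_trans (ler_wpM2l (expR_ge0 _) h) _.
    rewrite mulrCA ler_pM2l ?divr_gt0// -expRD ler_expR.
    by rewrite le_eqVlt; apply/orP; left; apply/eqP; field.
  - exact: rintegrableZ.
(* The first 4 comes from [normc_cexpB1B], the quotient from [sqr_le_expR_div] at [y / 4]. *)
pose C := 4 * (4 / (y / 4) ^+ 2).
have C0 : 0 <= C by rewrite mulr_ge0// divr_ge0// sqr_ge0.
apply: (@derivable_of_bound _ _ _ (cintegral (fun x => m x * E x * (0 +i* (2 * pi * x))))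
  (C * \int[mu]_x g x) (y / 4)) => // t ty.
have zt0 : 0 < complex.Im (z + t).
  rewrite Im_add -/y; have := normr_Im_le t; have := ler_norm (- complex.Im t).
  rewrite normrN; lra.
have i1 := cintegrable_laplace zt0.
have i2 := cintegrable_laplace z0.
have i3 := cintegrableZ t il.
rewrite /laplace -cintegralB// -cintegralZ// -cintegralB//; last exact: cintegrableB.
have -> : (fun x => m x * cexp ((0 +i* (2 * pi * x)) * (z + t)) -
    m x * cexp ((0 +i* (2 * pi * x)) * z) - t * (m x * E x * (0 +i* (2 * pi * x)))) =
  (fun x => m x * E x * (cexp ((0 +i* (2 * pi * x)) * t) - 1 - (0 +i* (2 * pi * x)) * t)).
  by apply/funext => x; rewrite mulrDr cexpD -/(E x); ring.
have ibound : cintegrable (fun x => m x * E x *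
    (cexp ((0 +i* (2 * pi * x)) * t) - 1 - (0 +i* (2 * pi * x)) * t)) /\
    forall x, normc (m x * E x * (cexp ((0 +i* (2 * pi * x)) * t) - 1 - (0 +i* (2 * pi * x)) * t))
      <= C * normc t ^+ 2 * g x.
  have bound x : normc (m x * E x * (cexp ((0 +i* (2 * pi * x)) * t) - 1 - (0 +i* (2 * pi * x)) * t))
      <= C * normc t ^+ 2 * g x.
    have [x0|x0] := leP x 0.
      rewrite m_support// !mul0r ComplexField.Normc.normc0 mulr_ge0//.
      by rewrite mulr_ge0// sqr_ge0.
    pose X := 2 * pi * x; have X0 : 0 <= X by rewrite !mulr_ge0// ltW.
    rewrite !normcM normc_kernel -/y -/X.
    apply: le_trans (ler_wpM2l _ (normc_cexpB1B _)) _; first by rewrite mulr_ge0 ?expR_ge0.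
    rewrite normcM normc_freq ?(ltW x0)// -/X /g.
    have e1 : expR (X * normc t) <= expR (y / 4 * X).
      by rewrite ler_expR mulrC ler_wpM2r// ltW.
    have e2 := sqr_le_expR_div y4 X0.
    have -> : normc (m x) * expR (- (2 * pi * y * x)) * (4 * ((X * normc t) ^+ 2 * expR (X * normc t)))
      = (4 * (normc (m x) * normc t ^+ 2)) *
        (expR (- (2 * pi * y * x)) * (X ^+ 2 * expR (X * normc t))) by ring.
    have -> : C * normc t ^+ 2 * (normc (m x) * expR (- (2 * pi * (y / 2) * x))) =
      (4 * (normc (m x) * normc t ^+ 2)) *
        (4 / (y / 4) ^+ 2 * expR (- (2 * pi * (y / 2) * x))) by rewrite /C; ring.
    apply: ler_wpM2l; first by rewrite mulr_ge0// mulr_ge0// sqr_ge0.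
    have h : X ^+ 2 * expR (X * normc t) <= 4 / (y / 4) ^+ 2 * expR (y / 4 * X) * expR (y / 4 * X).
      by apply: ler_pM; rewrite ?expR_ge0 ?sqr_ge0.
    apply: le_trans (ler_wpM2l (expR_ge0 _) h) _.
    rewrite -[X in _ * X]mulrA mulrCA ler_wpM2l ?divr_ge0 ?sqr_ge0//.
    rewrite -!expRD ler_expR le_eqVlt; apply/orP; left; apply/eqP.
    by rewrite /X; field.
  split => //; apply: le_cintegrable bound _.
  - apply: cmeasurableM; first exact: cmeasurableM.
    apply: cmeasurableB; last by apply: cmeasurableM => //; exact: cmeasurable_cst.
    by apply: cmeasurableB; [exact: cmeasurable_cexp|exact: cmeasurable_cst].
  - exact: rintegrableZ.
case: ibound => iF bound; apply: le_trans (normc_cintegral iF) _.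
rewrite mulrAC -RintegralZl//; apply: le_rintegral => //.
- exact: rintegrable_normc.
- exact: rintegrableZ.
Qed.

End FourierLaplace.

(** * Sufficiency *)

Section WaveletParseval.
Context {R : realType}.
Local Notation mu := (@lebesgue_measure R).
Local Notation chr a := (cexp (0 +i* a)).
Implicit Types (f g s psi : R -> R[i]).

Lemma L2_ae f g : cmeasurable g -> {ae mu, forall x, f x = g x} -> L2 f -> L2 g.
Proof.
move=> mg fg /L2P[mf fi]; apply/L2P; split => //.
apply: ae_eq_rintegrable fi; try exact: measurable_normc_sqr.
by apply: ae_imp fg => x ->.
Qed.

Lemma wavelet_affineE (t x y : R) : (t - x) / y = y^-1 * t + - (x / y).
Proof. by rewrite mulrBl mulrC. Qed.

Lemma L2_dilation f (x y : R) : 0 < y -> L2 f -> L2 (fun t => f ((t - x) / y)).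
Proof.
move=> y0 fL2; have y1 : y^-1 != 0 by rewrite invr_eq0 gt_eqF.
by under eq_fun do rewrite wavelet_affineE; exact: L2_affine.
Qed.

Lemma L2_scale f (y : R) : 0 < y -> L2 f -> L2 (fun x => f (y * x)).
Proof.
move=> y0 fL2; have y1 : y != 0 by rewrite gt_eqF.
by have := L2_affine 0 y1 fL2; under eq_fun do rewrite addr0.
Qed.

Lemma cintegrable_scale f (y : R) : 0 < y -> cintegrable f -> cintegrable (fun x => f (y * x)).
Proof.
move=> y0 fi; have y1 : y != 0 by rewrite gt_eqF.
by have := cintegrable_affine 0 y1 fi; under eq_fun do rewrite addr0.
Qed.

Lemma cintegral_scale f (y : R) : 0 < y -> cintegrable f ->
  cintegral f = y%:C * cintegral (fun x => f (y * x)).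
Proof.
move=> y0 fi; have y1 : y != 0 by rewrite gt_eqF.
rewrite (cintegral_affine 0 y1 fi) gtr0_norm//; congr (_ * cintegral _).
by apply/funext => x; rewrite addr0.
Qed.

Lemma ae_scale (P : R -> Prop) (y : R) : 0 < y -> {ae mu, forall x, P x} ->
  {ae mu, forall x, P (y * x)}.
Proof.
move=> y0 aeP; have y1 : y != 0 by rewrite gt_eqF.
by apply: ae_imp (ae_affine 0 y1 aeP) => x; rewrite addr0.
Qed.

Lemma cintegrable_chr_lin f (c : R) : cintegrable f ->
  cintegrable (fun x => f x * chr (2 * pi * x * c)).
Proof.
move=> fi; apply: cintegrable_chr => //.
by apply: measurable_funM => //; exact: measurable_scale.
Qed.

Lemma L2_chr f (u : R -> R) : measurable_fun setT u -> L2 f -> L2 (fun x => f x * chr (u x)).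
Proof.
move=> mu' fL2; apply: le_L2_normc (fL2).
- by apply: cmeasurableM; [exact: L2_measurable|exact: cmeasurable_chr].
- by move=> x; rewrite normcM normc_chr mulr1.
Qed.

(** By Fourier inversion the translated and dilated wavelet is almost everywhere the inverse
    transform of the integrable spectrum [eta], so [weak_Parseval] applies with [s] as the arbitrary
    function. *)
Lemma wavelet_Parseval psi s (x y : R) : L2 psi -> L2 s -> 0 < y ->
  cintegrable (fourier psi) ->
  wavelet psi s x y = (Num.sqrt y)%:C *
    cintegral (fun xi => fourier s xi * conjc (fourier psi (y * xi)) * chr (2 * pi * xi * x)).
Proof.
move=> pL2 sL2 y0 Pi; pose P := fourier psi.
have PL2 : L2 P := L2_fourier pL2.
have Py2 := L2_scale y0 PL2.
have Pyi := cintegrable_scale y0 Pi.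
pose eta xi := y%:C * (P (y * xi) * chr (2 * pi * xi * - x)).
have mx : measurable_fun setT (fun xi : R => 2 * pi * xi * - x).
  by apply: measurable_funM => //; exact: measurable_scale.
have eL2 : L2 eta by apply: L2Z; exact: L2_chr.
have ei : cintegrable eta by apply: cintegrableZ; exact: cintegrable_chr.
pose Psi v := cintegral (fun u => P u * chr (2 * pi * u * v)).
have etaE t : cintegral (fun xi => eta xi * chr (2 * pi * xi * t)) = Psi ((t - x) / y).
  rewrite /Psi (cintegral_scale y0 (cintegrable_chr_lin _ Pi)) -cintegralZ; last first.
    exact: (cintegrable_scale y0 (cintegrable_chr_lin ((t - x) / y) Pi)).
  congr cintegral; apply/funext => xi; rewrite /eta -!mulrA -chrD; congr (_ * (_ * chr _)).
  by field; rewrite gt_eqF.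
have mPsi : cmeasurable (fun t : R => Psi ((t - x) / y)).
  have -> : (fun t : R => Psi ((t - x) / y)) =
      (fun t => cintegral (fun xi => eta xi * chr (2 * pi * xi * t))).
    by apply/funext => t; rewrite etaE.
  exact: cmeasurable_inverse_fourier.
have psiE : {ae mu, forall t : R, psi ((t - x) / y) = Psi ((t - x) / y)}.
  have y1 : y^-1 != 0 by rewrite invr_eq0 gt_eqF.
  apply: ae_imp (ae_affine (- (x / y)) y1 (fourier_inversion pL2 Pi)) => t.
  by rewrite -wavelet_affineE.
have pyL2 := L2_dilation x y0 pL2.
have PsiL2 : L2 (fun t : R => Psi ((t - x) / y)) by exact: L2_ae psiE pyL2.
rewrite /wavelet.
have -> : cintegral (fun t : R => s t * conjc (psi ((t - x) / y))) =
    conjc (cintegral (fun t => Psi ((t - x) / y) * conjc (s t))).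
  rewrite -cintegral_conj; last by apply: cintegrable_mulL2 => //; exact: L2_conj.
  apply: ae_eq_cintegral.
  - by apply: cmeasurableM; [exact: L2_measurable|apply: cmeasurable_conj; exact: L2_measurable].
  - apply: cmeasurable_conj; apply: cmeasurableM => //.
    by apply: cmeasurable_conj; exact: L2_measurable.
  - by apply: ae_imp psiE => t ->; rewrite rmorphM/= conjcK mulrC.
have -> : (fun t : R => Psi ((t - x) / y) * conjc (s t)) =
    (fun t => cintegral (fun xi => eta xi * chr (2 * pi * xi * t)) * conjc (s t)).
  by apply/funext => t; rewrite etaE.
rewrite weak_Parseval//; last by under eq_fun do rewrite etaE.
rewrite -cintegral_conj; last by apply: cintegrable_mulL2 => //; exact/L2_conj/L2_fourier.
have -> : (fun xi => conjc (eta xi * conjc (fourier s xi))) =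
    (fun xi => y%:C * (fourier s xi * conjc (P (y * xi)) * chr (2 * pi * xi * x))).
  apply/funext => xi; rewrite /eta !rmorphM/= conjcK conjc_real chr_conj mulrN opprK.
  by ring.
rewrite cintegralZ; last first.
  apply: cintegrable_chr_lin; apply: cintegrable_mulL2; first exact: L2_fourier.
  exact: L2_conj.
rewrite mulrA -rmorphM/=; congr (_%:C * _).
rewrite -[X in _ * X = _]sqr_sqrtr ?(ltW y0)// expr2 mulKf//.
by rewrite gt_eqF// sqrtr_gt0.
Qed.

End WaveletParseval.

(** * Smoothness of the normalizing factor *)

Section Smoothness.
Context {R : realType}.
Implicit Types (U : set (R * R)) (u v : R * R -> R).

(** Partial derivatives match their closed forms only on [U]. Since [U] is open, equality on [U] is
    equality near each of its points and passes to the derivatives. *)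
Lemma Ck_on_eq U k u v : open U -> (forall p, U p -> u p = v p) ->
  Ck_on U k u -> Ck_on U k v.
Proof.
move=> oU; have nU (p : R * R) : U p -> \forall q \near p, U q.
  by move=> Up; apply: open_nbhs_nbhs.
elim: k u v => [|k IH] u v uv [cu Dk]; split => //.
- move=> p Up; have := cu p Up; rewrite /prop_for /continuous_at -(uv p Up) => h.
  apply: cvg_trans h; apply: near_eq_cvg.
  by near=> q; apply: uv; near: q; exact: nU.
- move=> p Up; have := cu p Up; rewrite /prop_for /continuous_at -(uv p Up) => h.
  apply: cvg_trans h; apply: near_eq_cvg.
  by near=> q; apply: uv; near: q; exact: nU.
- have near_uv p : U p -> \near p, u p = v p.
    by move=> Up; near=> q; apply: uv; near: q; exact: nU.
  case: Dk => Dk Dk1 Dk2; split.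
  + move=> p Up; have [d1 d2] := Dk p Up.
    by split; [apply: near_eq_derivable d1|apply: near_eq_derivable d2];
      rewrite ?near_uv//; exact: near_uv.
  + by apply: IH Dk1 => p Up; apply: near_eq_derive; exact: near_uv.
  + by apply: IH Dk2 => p Up; apply: near_eq_derive; exact: near_uv.
Unshelve. all: by end_near. Qed.

Lemma is_derive_snd1 (g : R -> R) (p : R * R) :
  derivable (fun q : R * R => g q.2) p (1, 0) /\ 'D_(1, 0) (fun q : R * R => g q.2) p = 0.
Proof.
have E : (fun h : R => h^-1 *: (((fun q : R * R => g q.2) \o shift p) (h *: ((1, 0) : R * R)) - g p.2)) =
    (fun=> 0).
  by apply/funext => h; rewrite /= scaler0 add0r subrr scaler0.
split; first by rewrite /derivable E; exact: is_cvg_cst.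
by rewrite /derive E; exact: lim_cst.
Qed.

Lemma is_derive_snd2 (g : R -> R) (p : R * R) (a : R) : is_derive p.2 1 g a ->
  derivable (fun q : R * R => g q.2) p (0, 1) /\ 'D_(0, 1) (fun q : R * R => g q.2) p = a.
Proof. by move=> [dg ga]; split. Qed.

(** A combination of the real and imaginary parts of [y] to the power [r + i b]. With free [r], [A]
    and [B] the family is stable under differentiation, so one induction reaches every order. *)
Definition logpolar (b r A B y : R) : R :=
  expR (r * ln y) * (A * cos (b * ln y) + B * sin (b * ln y)).

Lemma is_derive_logpolar (b r A B y : R) : 0 < y ->
  is_derive y 1 (logpolar b r A B) (logpolar b (r - 1) (r * A + b * B) (r * B - b * A) y).
Proof.
move=> y0; have dl := is_derive1_ln y0.
have d c := is_derive_scale c dl.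
have dE := @is_derive_comp _ expR (fun t => r * ln t) _ _ _ (is_derive_expR _) (d r).
have dC := is_derive_scale A
  (@is_derive_comp _ cos (fun t => b * ln t) _ _ _ (is_derive_cos _) (d b)).
have dS := is_derive_scale B
  (@is_derive_comp _ sin (fun t => b * ln t) _ _ _ (is_derive_sin _) (d b)).
apply: is_derive_eq (is_derive_mul dE (is_derive_add dC dS)) _.
rewrite /logpolar mulrBl mul1r expRD expRN lnK//.
by field; rewrite gt_eqF.
Qed.

Lemma open_upper : open [set p : R * R | 0 < p.2].
Proof.
apply: (@open_comp _ _ (fun p : R * R => p.2) [set y : R | 0 < y]).
- by move=> p _; exact: cvg_snd.
- exact: open_gt.
Qed.

Lemma Ck_on_logpolar k (b r A B : R) :
  Ck_on [set p : R * R | 0 < p.2] k (fun p => logpolar b r A B p.2).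
Proof.
elim: k r A B => [|k IH] r A B; split => //.
- move=> p p0; apply: (@continuous_comp _ _ _ (fun q : R * R => q.2) (logpolar b r A B)).
    exact: cvg_snd.
  exact: (is_derive_continuous (is_derive_logpolar b r A B p0)).
- move=> p p0; apply: (@continuous_comp _ _ _ (fun q : R * R => q.2) (logpolar b r A B)).
    exact: cvg_snd.
  exact: (is_derive_continuous (is_derive_logpolar b r A B p0)).
- split.
  + move=> p p0; split; first by have [] := is_derive_snd1 (logpolar b r A B) p.
    by have [] := is_derive_snd2 (is_derive_logpolar b r A B p0).
  + apply: (Ck_on_eq open_upper _ (IH 0 0 0)) => p p0.
    have [_ ->] := is_derive_snd1 (logpolar b r A B) p.
    by rewrite /logpolar !mul0r addr0 mulr0.
  + apply: (Ck_on_eq open_upper _ (IH (r - 1) (r * A + b * B) (r * B - b * A))) => p p0.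
    by have [_ ->] := is_derive_snd2 (is_derive_logpolar b r A B p0).
Qed.

Lemma smooth_on_logpolar (r b : R) :
  smooth_on [set p : R * R | 0 < p.2] (fun _ y => cexp ((r * ln y) +i* (b * ln y))).
Proof.
move=> k; split.
- have := Ck_on_logpolar k b r 1 0; congr Ck_on; apply/funext => p.
  by rewrite /logpolar mul1r mul0r addr0.
- have := Ck_on_logpolar k b r 0 1; congr Ck_on; apply/funext => p.
  by rewrite /logpolar mul1r mul0r add0r.
Qed.

End Smoothness.

(** * From the spectral formula to analyticity *)

Section Sufficiency.
Context {R : realType}.
Local Notation mu := (@lebesgue_measure R).
Local Notation chr a := (cexp (0 +i* a)).
Implicit Types (f g s psi : R -> R[i]).

Lemma ae_le_rintegrable (u v : R -> R) : measurable_fun setT u -> rintegrable v ->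
  {ae mu, forall x, `|u x| <= v x} -> rintegrable u.
Proof.
move=> mu' /[dup] iv /integrableP[_ vy] uv; apply/integrableP; split.
  exact/measurable_EFinP.
apply: le_lt_trans vy; apply: ae_ge0_le_integral => //.
- by apply: measurableT_comp => //; exact/measurable_EFinP.
- by apply: measurableT_comp => //; apply/measurable_EFinP; exact: rintegrable_measurable.
- by apply: ae_imp uv => x ux _ /=; rewrite lee_fin (le_trans ux)// ler_norm.
Qed.

Lemma L2_abel (e : R) : 0 < e -> L2 (fun x => (abel e x)%:C).
Proof.
move=> e0; apply: le_L2 (rintegrable_abel e0).
- by apply: cmeasurable_real; exact: measurable_abel.
- move=> x; rewrite normc_real ger0_norm ?abel_ge0// expr2 ler_piMl ?abel_ge0//.
  exact: abel_le1.
Qed.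

Lemma near_upper_half_plane (z : R[i]) (P : R[i] -> Prop) : 0 < complex.Im z ->
  (forall w, 0 < complex.Im w -> P w) -> \forall w \near (z : R[i]^o), P w.
Proof.
move=> z0 HP; apply/nbhs_ballP; exists (complex.Im z)%:C; first by rewrite /= ltcR.
move=> w; rewrite /ball/= ltr_normC_real => zw; apply: HP.
have := le_lt_trans (normr_Im_le (z - w)) zw; rewrite Im_add Im_opp.
have := ler_norm (complex.Im z - complex.Im w); lra.
Qed.

Variables (psi : R -> R[i]) (c : R[i]) (alpha beta : R) (gamma : R[i]).
Hypothesis psiL2 : L2 psi.
Hypothesis gamma0 : 0 < complex.Re gamma.
Hypothesis psi_hardy : {ae mu, forall xi : R, xi < 0 -> fourier psi xi = 0}.
Hypothesis psi_formula : {ae mu, forall xi : R, 0 < xi ->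
  fourier psi xi = c * (xi `^ ((alpha - 1) / 2))%:C
    * cexp (- (2 * pi * xi)%:C * gamma) * cexp (0 +i* (beta * ln xi))}.

Let P := fourier psi.
Let PL2 : L2 P. Proof. exact: L2_fourier. Qed.
Let r := (alpha - 1) / 2.
Let g1 := complex.Re gamma.
Let g2 := complex.Im gamma.
Let pi0 : 0 < pi :> R. Proof. exact: pi_gt0. Qed.

Let normc_P : {ae mu, forall xi : R, 0 < xi ->
  normc (P xi) = normc c * (xi `^ r * expR (- (2 * pi * g1 * xi)))}.
Proof.
apply: ae_imp psi_formula => xi pxi xi0.
rewrite /P.
rewrite pxi//.
rewrite normcM.
rewrite normc_chr.
rewrite mulr1.
rewrite !normcM.
rewrite normc_real normc_cexp Re_mul Re_opp Im_opp Re_real Im_real oppr0 mul0r subr0.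
rewrite ger0_norm ?powR_ge0// -mulrA; congr (_ * (_ * expR _)).
by rewrite -/g1; ring.
Qed.

(** The formula gives [|P xi| = 2 ^ r * |P (xi / 2)| * exp (- pi * g1 * xi)] for [xi > 0], a product
    of two functions of L^2. *)
Let P_integrable : cintegrable P.
Proof.
apply: cintegrable_normc; first exact: L2_measurable.
have h0 : 0 < (2^-1 : R) by rewrite invr_gt0.
have e0 : 0 < pi * g1 by rewrite mulr_gt0.
have iv := rintegrableZ (2 `^ r) (rintegrable_mulL2 (L2_scale h0 PL2) (L2_abel e0)).
apply: ae_le_rintegrable iv _; first by apply: measurable_normc; exact: L2_measurable.
apply: ae_imp2 (ae_neq 0) (ae_imp2 _ psi_hardy (ae_imp2 _ normc_P (ae_scale h0 normc_P)));
  [|by move=> xi h1 h2; exact: (conj h1 h2)|by move=> xi h1 h2; exact: (conj h1 h2)].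
move=> xi xi0 [hneg [hpos hhalf]]; rewrite ger0_norm//.
have [xneg|xpos] := ltP xi 0.
  by rewrite /P hneg// ComplexField.Normc.normc0 !mulr_ge0// powR_ge0.
have {}xpos : 0 < xi by rewrite lt_neqAle eq_sym xi0.
rewrite hpos// hhalf ?mulr_gt0// normc_real ger0_norm ?abel_ge0// /abel ger0_norm ?(ltW xpos)//.
have -> : expR (- (2 * pi * g1 * xi)) =
    expR (- (2 * pi * g1 * (2^-1 * xi))) * expR (- (pi * g1 * xi)).
  by rewrite -expRD; congr expR; field.
have -> : xi `^ r = 2 `^ r * (2^-1 * xi) `^ r.
  by rewrite -powRM ?mulr_ge0 ?invr_ge0 ?(ltW xpos)// mulrA mulfV// mul1r.
by rewrite le_eqVlt; apply/orP; left; apply/eqP; ring.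
Qed.

Section Signal.
Variable s : R -> R[i].
Hypothesis sL2 : L2 s.

(** The part of the Parseval integrand that does not depend on [x] and [y]: the dilation by [y / g1]
    splits off the power and the logarithmic phase as the factor [dil y]. *)
Let m (xi : R) : R[i] := (\1_`]0, +oo[ xi)%:C *
  (fourier s xi * (conjc c * (xi `^ r)%:C * chr (- (beta * ln xi)))).

Let mm : cmeasurable m.
Proof.
apply: cmeasurableM; first by apply: cmeasurable_real; exact: measurable_indic.
apply: cmeasurableM; first exact/L2_measurable/L2_fourier.
apply: cmeasurableM.
  apply: cmeasurableM; first exact: cmeasurable_cst.
  by apply: cmeasurable_real; exact: measurable_powR.
apply: cmeasurable_chr; apply: measurableT_comp => //.
by apply: measurable_funM => //; exact: measurable_ln.
Qed.

Let m_support xi : xi <= 0 -> m xi = 0.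
Proof.
move=> x0; rewrite /m indicE memNset ?mul0r//= in_itv/= andbT.
by apply/negP; rewrite -leNgt.
Qed.

Let dil (y : R) : R[i] := ((y / g1) `^ r)%:C * chr (- (beta * ln (y / g1))).

Let yg1 (y : R) : 0 < y -> 0 < y / g1. Proof. by move=> y0; rewrite divr_gt0. Qed.

(** The dilation by [g1^-1] normalizes the decay of the spectrum to [exp (- 2 pi y xi)], and the
    shift by [g2 * g1^-1 * y] cancels the phase that [Im gamma] produces; what is left is
    [exp (2 pi i xi (x + i y))]. *)
Let integrandE (x y : R) : 0 < y -> {ae mu, forall xi,
  fourier s xi * conjc (P (y / g1 * xi)) * chr (2 * pi * xi * (x - g2 * g1^-1 * y)) =
  dil y * (m xi * cexp ((0 +i* (2 * pi * xi)) * (x +i* y)))}.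
Proof.
move=> y0; have y1 := yg1 y0.
apply: ae_imp2 (ae_neq 0) (ae_imp2 _ (ae_scale y1 psi_hardy) (ae_scale y1 psi_formula));
  [|by move=> xi h1 h2; exact: (conj h1 h2)].
move=> xi xi0 [hneg hpos].
have [xneg|xpos] := ltP xi 0.
  rewrite m_support ?(ltW xneg)// mul0r mulr0 /P hneg ?conjc0 ?mulr0 ?mul0r//.
  by rewrite pmulr_rlt0.
have {}xpos : 0 < xi by rewrite lt_neqAle eq_sym xi0.
rewrite /P hpos ?(mulr_gt0 y1 xpos)//.
rewrite /m indicE mem_set; last by rewrite /= in_itv/= xpos.
rewrite mul1r !rmorphM/= conjc_real !cexp_conj/dil.
rewrite powRM ?(ltW y1)// ?(ltW xpos)// lnM ?posrE//.
have -> : conjc (0 +i* (beta * (ln (y / g1) + ln xi))) =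
    (0 +i* (- (beta * ln (y / g1)))) + (0 +i* (- (beta * ln xi))).
  by apply: complex_ext; rewrite !ReImE/= ?addr0//; ring.
have -> : (0 +i* (2 * pi * xi)) * (x +i* y) =
    conjc (- (2 * pi * (y / g1 * xi))%:C * gamma) + (0 +i* (2 * pi * xi * (x - g2 * g1^-1 * y))).
  apply: complex_ext; rewrite !ReImE/= -/g1 -/g2.
  - by field; rewrite gt_eqF.
  - by field; rewrite gt_eqF.
rewrite !cexpD -/r !rmorphM/=.
by ring.
Qed.

Let cmeasurable_kernel (y : R) (z : R[i]) :
  cmeasurable (fun xi => dil y * (m xi * cexp ((0 +i* (2 * pi * xi)) * z))).
Proof.
apply: cmeasurableM; first exact: cmeasurable_cst.
apply: cmeasurableM => //; apply: cmeasurable_cexp; apply: cmeasurableM.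
  by split; [exact: measurable_cst|exact: measurable_scale].
exact: cmeasurable_cst.
Qed.

Let cintegrable_pairing (x y : R) : 0 < y -> cintegrable (fun xi =>
  fourier s xi * conjc (P (y / g1 * xi)) * chr (2 * pi * xi * x)).
Proof.
move=> y0; apply: cintegrable_chr_lin; apply: cintegrable_mulL2; first exact: L2_fourier.
by apply: L2_conj; apply: L2_scale PL2; exact: yg1.
Qed.

Let dil_gt0 (y : R) : 0 < y -> 0 < normc (dil y).
Proof.
move=> y0; rewrite normcM normc_chr mulr1 normc_real ger0_norm ?powR_ge0//.
by rewrite powR_gt0// yg1.
Qed.

(** Read off [integrandE] at [x = 0]: up to the positive constant [normc (dil y)], the function is
    almost everywhere the modulus of an integrable product of two L^2 functions. *)
Let m_decay (y : R) : 0 < y -> rintegrable (fun xi => normc (m xi) * expR (- (2 * pi * y * xi))).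
Proof.
move=> y0; have d0 := dil_gt0 y0.
have iF := cintegrable_pairing (0 - g2 * g1^-1 * y) y0.
have -> : (fun xi => normc (m xi) * expR (- (2 * pi * y * xi))) =
    (fun xi => (normc (dil y))^-1 *
      normc (dil y * (m xi * cexp ((0 +i* (2 * pi * xi)) * (0 +i* y))))).
  apply/funext => xi; rewrite [normc (dil y * _)]normcM mulKf ?gt_eqF// [RHS]normcM normc_kernel/=.
  by [].
apply: rintegrableZ; apply: ae_eq_rintegrable (rintegrable_normc iF).
- exact: measurable_normc (cintegrable_measurable iF).
- exact: measurable_normc (cmeasurable_kernel _ _).
- by apply: ae_imp (integrandE 0 y0) => xi ->.
Qed.

Let wavelet_laplace (x y : R) : 0 < y ->
  wavelet psi s (x - g2 * g1^-1 * y) (g1^-1 * y) =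
  (Num.sqrt (y / g1))%:C * (dil y * laplace m (x +i* y)).
Proof.
move=> y0; have y1 := yg1 y0.
rewrite [g1^-1 * y]mulrC wavelet_Parseval//; congr (_ * _).
rewrite /laplace -cintegralZ; last by apply: cintegrable_laplace.
apply: ae_eq_cintegral; last exact: integrandE.
- exact: cintegrable_measurable (cintegrable_pairing _ y0).
- exact: cmeasurable_kernel.
Qed.

(** [y] to the power [- alpha / 2 + i beta]. It compensates the square root of the scale and
    [dil y], whose real exponents add up to [1 / 2 + r = alpha / 2]. *)
Let normalizer (y : R) : R[i] := cexp ((- (alpha / 2) * ln y) +i* (beta * ln y)).

Let normalizerE (y : R) : 0 < y -> normalizer y * ((Num.sqrt (y / g1))%:C * dil y) =
  cexp ((- (alpha / 2) * ln g1) +i* (beta * ln g1)).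
Proof.
move=> y0; have y1 := yg1 y0.
have lnE : ln (y / g1) = ln y - ln g1 by rewrite ln_div ?posrE.
have realE (a : R) : (expR a)%:C = cexp (a +i* 0).
  by apply: complex_ext; rewrite /cexp/= ?cos0 ?sin0 ?mulr1 ?mulr0.
have -> : Num.sqrt (y / g1) = expR (2^-1 * ln (y / g1)).
  by rewrite -powR12_sqrt ?(ltW y1)// /powR gt_eqF.
rewrite /dil /powR gt_eqF// !realE /normalizer -!cexpD lnE; congr cexp.
by apply: complex_ext; rewrite !ReImE/= /r; field.
Qed.

Lemma analytic_normalized_wavelet :
  analytic_on upper_half_plane (fun z =>
    cexp ((- (alpha / 2) * ln (complex.Im z)) +i* (beta * ln (complex.Im z))) *
    wavelet psi s (complex.Re z - g2 * g1^-1 * complex.Im z) (g1^-1 * complex.Im z)).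
Proof.
move=> z z0.
pose K : R[i] := cexp ((- (alpha / 2) * ln g1) +i* (beta * ln g1)).
(* The identity with the Laplace transform holds on the open half-plane only, which is enough near
   [z]. *)
apply: (@near_eq_derivable _ _ _ (fun w : R[i]^o => K *: (laplace m w : R[i]^o))).
  apply: near_upper_half_plane => // w w0.
  rewrite wavelet_laplace//.
  have -> : complex.Re w +i* complex.Im w = w by case: (w).
  by rewrite /K -(normalizerE w0) /GRing.scale/= /normalizer; ring.
by apply: derivableZ; exact: (derivable_laplace mm m_support m_decay).
Qed.

End Signal.

Lemma analytic_wavelet_sufficient :
  exists (a b : R) (f : R -> R -> R[i]),
     [/\ 0 < b,
         smooth_on [set p | 0 < p.2] f,
         (forall x y : R, 0 < y -> f x y <> 0)
       & forall s : R -> R[i], L2 s ->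
           analytic_on upper_half_plane
             (fun z => let x := complex.Re z in let y := complex.Im z in
                       f x y * wavelet psi s (x - a * b * y) (b * y))].
Proof.
(* With [a = Im gamma] and [b = 1 / Re gamma], the product [a * b] is the slope of the shift that
   cancels the phase. *)
exists g2, g1^-1, (fun _ y => cexp ((- (alpha / 2) * ln y) +i* (beta * ln y))); split.
- by rewrite invr_gt0.
- exact: smooth_on_logpolar.
- by move=> _ y _; apply/eqP; exact: cexp_neq0.
- by move=> s sL2; exact: analytic_normalized_wavelet.
Qed.

End Sufficiency.

(** * Curves and primitives *)

Section CurveDerivatives.
Context {R : realType}.
Implicit Types (F G : R -> R[i]) (l k : R[i]) (t : R).

(** Derivative of a complex curve in a real parameter, kept as two real derivatives so that the
    chain rule and the fundamental theorem of real calculus apply to the parts. *)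
Definition cderive F t l :=
  is_derive t 1 (fun s => complex.Re (F s)) (complex.Re l) /\
  is_derive t 1 (fun s => complex.Im (F s)) (complex.Im l).

Lemma cderive_eq F t l k : cderive F t l -> l = k -> cderive F t k.
Proof. by move=> ? <-. Qed.

Lemma cderiveD F G t l k : cderive F t l -> cderive G t k ->
  cderive (fun s => F s + G s) t (l + k).
Proof.
move=> [rF iF] [rG iG]; split.
- under eq_fun do rewrite Re_add; rewrite Re_add; exact: is_derive_add.
- under eq_fun do rewrite Im_add; rewrite Im_add; exact: is_derive_add.
Qed.

Lemma cderiveN F t l : cderive F t l -> cderive (fun s => - F s) t (- l).
Proof.
move=> [rF iF]; split.
- under eq_fun do rewrite Re_opp; rewrite Re_opp; exact: is_derive_opp.
- under eq_fun do rewrite Im_opp; rewrite Im_opp; exact: is_derive_opp.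
Qed.

Lemma cderiveB F G t l k : cderive F t l -> cderive G t k ->
  cderive (fun s => F s - G s) t (l - k).
Proof. by move=> dF dG; apply: cderiveD => //; exact: cderiveN. Qed.

Lemma cderiveM F G t l k : cderive F t l -> cderive G t k ->
  cderive (fun s => F s * G s) t (l * G t + F t * k).
Proof.
move=> [rF iF] [rG iG]; split.
- under eq_fun do rewrite Re_mul.
  apply: is_derive_eq (is_derive_add (is_derive_mul rF rG)
    (is_derive_opp (is_derive_mul iF iG))) _.
  by rewrite Re_add !Re_mul; ring.
- under eq_fun do rewrite Im_mul.
  apply: is_derive_eq (is_derive_add (is_derive_mul rF iG) (is_derive_mul iF rG)) _.
  by rewrite Im_add !Im_mul; ring.
Qed.

Lemma cderive_cst k t : cderive (fun=> k) t 0.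
Proof. by split; exact: is_derive_const. Qed.

Lemma cderive_real (u : R -> R) t (a : R) : is_derive t 1 u a ->
  cderive (fun s => (u s)%:C) t a%:C.
Proof. by move=> du; split => //; exact: is_derive_const. Qed.

Lemma cderive_comp_real F (u : R -> R) t l (a : R) : cderive F (u t) l -> is_derive t 1 u a ->
  cderive (fun s => F (u s)) t (a%:C * l).
Proof.
move=> [rF iF] du; split.
- apply: is_derive_eq (is_derive_comp rF du) _.
  by rewrite Re_mul Re_real Im_real mul0r subr0 mulrC.
- apply: is_derive_eq (is_derive_comp iF du) _.
  by rewrite Im_mul Re_real Im_real mul0r addr0 mulrC.
Qed.

Lemma near_cderive F G t l : (\forall s \near t, F s = G s) -> cderive F t l -> cderive G t l.
Proof.
move=> FG [rF iF]; split.
- by apply: near_eq_is_derive rF; apply: filterS FG => s ->.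
- by apply: near_eq_is_derive iF; apply: filterS FG => s ->.
Qed.

Lemma cderive_unique F t l k : cderive F t l -> cderive F t k -> l = k.
Proof.
move=> [rF iF] [rF' iF']; apply: complex_ext.
- by case: rF => _ <-; case: rF' => _ <-.
- by case: iF => _ <-; case: iF' => _ <-.
Qed.

Lemma is_derive_of_dist (u : R -> R) (t a : R) :
  (forall e : R, 0 < e -> exists2 d : R, 0 < d &
    forall s, s != 0 -> `|s| < d -> `|s^-1 * (u (t + s) - u t) - a| <= e) ->
  is_derive t 1 u a.
Proof.
move=> h; have c : (fun s : R => s^-1 *: ((u \o shift t) (s *: (1:R)) - u t)) @ 0^' --> a.
  apply/cvgrPdist_le => e e0; have [d d0 dP] := h e e0; near=> s.
  rewrite distrC /GRing.scale/= mulr1 [s + t]addrC; apply: dP.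
  - by near: s; exact: nbhs_dnbhs_neq.
  - by near: s; exact: dnbhs0_lt.
apply: DeriveDef; first by apply/cvg_ex; exists a.
exact/cvg_lim.
Unshelve. all: by end_near. Qed.

Lemma cderive_of_dist F t l :
  (forall e : R, 0 < e -> exists2 d : R, 0 < d &
    forall s : R, s != 0 -> `|s| < d -> normc (s^-1%:C * (F (t + s) - F t) - l) <= e) ->
  cderive F t l.
Proof.
move=> h; split; apply: is_derive_of_dist => e e0; have [d d0 dP] := h e e0;
  exists d => // s s0 sd; apply: le_trans (dP s s0 sd).
- by apply: le_trans (normr_Re_le _); rewrite !ReImE/= mul0r subr0.
- by apply: le_trans (normr_Im_le _); rewrite !ReImE/= mul0r addr0.
Qed.

Lemma cderive_of_bound F t l (K : R) :
  (forall s : R, `|s| < 1 -> normc (F (t + s) - F t - s%:C * l) <= K * s ^+ 2) ->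
  cderive F t l.
Proof.
move=> hK; apply: cderive_of_dist => e e0.
have K1 : 0 < `|K| + 1 by rewrite ltr_wpDl.
exists (Num.min 1 (e / (`|K| + 1))); first by rewrite lt_min ltr01 divr_gt0.
move=> s s0; rewrite lt_min => /andP[s1 se].
have -> : s^-1%:C * (F (t + s) - F t) - l = s^-1%:C * (F (t + s) - F t - s%:C * l).
  by rewrite [RHS]mulrBr mulrA -rmorphM/= mulVf// mul1r.
rewrite normcM normc_real normfV ler_pdivrMl ?normr_gt0//.
apply: le_trans (hK s s1) _.
rewrite -real_normK ?num_real// expr2 mulrA mulrC ler_pM2l ?normr_gt0//.
move: se; rewrite ltr_pdivlMr// => se.
apply: le_trans (ltW se); rewrite mulrC ler_wpM2l//.
by rewrite (le_trans (ler_norm _))// lerDl.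
Qed.

(** The Cauchy-Riemann equations: the increment in the complex difference quotient may be taken real
    or purely imaginary. *)
Lemma cderive_of_derivable (h : R[i] -> R[i]) (z : R[i]) :
  derivable (h : R[i]^o -> R[i]^o) z 1 ->
  exists l, cderive (fun t => h (t%:C + z)) 0 l /\
    cderive (fun t => h ((0 +i* t) + z)) 0 ((0 +i* 1) * l).
Proof.
move=> /derivable_dist[l hl]; exists l; split; apply: cderive_of_dist => e e0;
  have [d d0 dP] := hl e e0; exists d => // s s0 sd.
- have sC0 : s%:C != 0 :> R[i] by apply: contra s0 => /eqP[->].
  have := dP s%:C sC0; rewrite normc_real => /(_ sd).
  rewrite !add0r [z + _]addrC; congr (_ <= _); congr normc; congr (_ * _ - _).
  by rewrite fmorphV.
- have nI : normc (0 +i* s) = `|s|.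
    by rewrite /ComplexField.Normc.normc expr0n add0r sqrtr_sqr.
  have sC0 : 0 +i* s != 0 :> R[i] by apply: contra s0 => /eqP[->].
  have := dP (0 +i* s) sC0; rewrite nI => /(_ sd); apply: le_trans.
  have sI : (0 +i* s) = s%:C * (0 +i* 1) :> R[i].
    by apply: complex_ext; rewrite !ReImE/=; ring.
  have I2 : (0 +i* 1) * (0 +i* 1) = -1 :> R[i].
    by apply: complex_ext; rewrite !ReImE/=; ring.
  have I0 : (0 +i* 1) != 0 :> R[i] by apply/eqP => -[] /eqP; rewrite oner_eq0.
  have -> : (0 +i* 0) = 0 :> R[i] by [].
  rewrite !add0r [_ + z]addrC fmorphV.
  set D := h _ - h _; rewrite le_eqVlt; apply/orP; left; apply/eqP.
  have -> : (s%:C)^-1 * D - (0 +i* 1) * l = (0 +i* 1) * ((0 +i* s)^-1 * D - l).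
    rewrite [RHS]mulrBr mulrA; congr (_ * _ - _); rewrite sI invfM mulrCA mulfV// mulr1.
    by [].
  rewrite normcM (_ : normc (0 +i* 1) = 1) ?mul1r//.
  by rewrite /ComplexField.Normc.normc expr0n add0r sqrtr_sqr normr1.
Qed.

End CurveDerivatives.

Section Primitives.
Context {R : realType}.
Local Notation mu := (@lebesgue_measure R).
Implicit Types (u : R -> R) (f : R -> R[i]).

Definition rlocal u := measurable_fun setT u /\
  forall a b, rintegrable (fun x => \1_`[a, b] x * u x).

Let rlocal_itv u (a b : R) : rlocal u -> mu.-integrable `[a, b] (EFin \o u).
Proof. by move=> [mu' iu]; exact: rintegrable_itv. Qed.

Let rprim u (x : R) : R := \int[mu]_(t in `[0, x]) u t.

Let rprim_sub u (c d : R) : rlocal u -> 0 <= c <= d ->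
  \int[mu]_(t in `[c, d]) u t = rprim u d - rprim u c.
Proof.
move=> lu /andP[c0 cd]; rewrite /rprim.
rewrite (@Rintegral_itvB _ _ (BLeft 0) (BRight d) c); last 3 first.
- exact: rlocal_itv.
- by rewrite bnd_simp.
- by rewrite bnd_simp.
rewrite Rintegral_itv_obnd_cbnd//.
by apply: integrableS (rlocal_itv c d lu) => //; exact: subset_itv_oc_cc.
Qed.

Let ae_derive_rprim u : rlocal u -> {ae mu, forall x : R, 0 < x -> is_derive x 1 (rprim u) (u x)}.
Proof.
move=> lu; have lu' : locally_integrable setT u.
  by apply: locally_integrable_itv; [case: lu|move=> M; case: lu].
apply: ae_imp (lebesgue_differentiation lu') => x ux x0.
have xx1 : x < x + 1 by rewrite ltrDl.
have [|d1 d2] := FTC1_lebesgue_pt xx1 (rlocal_itv 0 (x + 1) lu) _ ux; first by rewrite lte_fin.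
by constructor; [exact: d1|rewrite -derive1E; exact: d2].
Qed.

Let derive_rprim u (x : R) : rlocal u -> 0 < x -> {for x, continuous u} ->
  is_derive x 1 (rprim u) (u x).
Proof.
move=> lu x0 ux; have xx1 : x < x + 1 by rewrite ltrDl.
have [|d1 d2] := continuous_FTC1 xx1 (rlocal_itv 0 (x + 1) lu) _ ux; first by rewrite lte_fin.
by constructor; [exact: d1|rewrite -derive1E; exact: d2].
Qed.

Let continuous_rprim u (x : R) : rlocal u -> 0 < x -> {for x, continuous (rprim u)}.
Proof.
move=> lu x0.
have x1 : 0 <= x + 1 by rewrite addr_ge0// ltW.
have := parameterized_integral_continuous x1 (rlocal_itv 0 (x + 1) lu).
move=> /continuous_within_itvP; rewrite ltr_wpDl ?(ltW x0)// => /(_ isT)[+ _ _].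
by apply; rewrite in_itv/= x0/= ltrDl.
Qed.

Definition clocal f := cmeasurable f /\ forall a b, cintegrable (fun x => box a b x * f x).

Definition primitive f (x : R) : R[i] := cintegral (fun t => box 0 x t * f t).

Let clocalRe f : clocal f -> rlocal (fun x => complex.Re (f x)).
Proof.
move=> [[mr mi] i]; split => // a b; have [+ _] := i a b.
by under eq_fun do rewrite Re_mul Re_real Im_real mul0r subr0.
Qed.

Let clocalIm f : clocal f -> rlocal (fun x => complex.Im (f x)).
Proof.
move=> [[mr mi] i]; split => // a b; have [_ +] := i a b.
by under eq_fun do rewrite Im_mul Re_real Im_real mul0r addr0.
Qed.

Let primitiveE f a b : cintegral (fun t => box a b t * f t) =
  \int[mu]_(t in `[a, b]) complex.Re (f t) +i* \int[mu]_(t in `[a, b]) complex.Im (f t).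
Proof.
rewrite /cintegral; congr (_ +i* _); rewrite -[RHS]Rintegral_indic_mul;
  apply: eq_Rintegral => t _.
- by rewrite Re_mul Re_real Im_real mul0r subr0.
- by rewrite Im_mul Re_real Im_real mul0r addr0.
Qed.

Lemma primitive_sub f (c d : R) : clocal f -> 0 <= c <= d ->
  cintegral (fun t => box c d t * f t) = primitive f d - primitive f c.
Proof.
move=> lf cd; rewrite /primitive !primitiveE.
apply: complex_ext; rewrite !ReImE/=.
- exact: rprim_sub (clocalRe lf) cd.
- exact: rprim_sub (clocalIm lf) cd.
Qed.

Lemma ae_cderive_primitive f : clocal f ->
  {ae mu, forall x : R, 0 < x -> cderive (primitive f) x (f x)}.
Proof.
move=> lf; apply: ae_imp2 (ae_derive_rprim (clocalRe lf)) (ae_derive_rprim (clocalIm lf)).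
move=> x dr di x0; split; under eq_fun do rewrite /primitive primitiveE/=.
- exact: dr.
- exact: di.
Qed.

Lemma cderive_primitive f (x : R) : clocal f -> 0 < x ->
  {for x, continuous (fun t => complex.Re (f t))} ->
  {for x, continuous (fun t => complex.Im (f t))} -> cderive (primitive f) x (f x).
Proof.
move=> lf x0 cr ci; split; under eq_fun do rewrite /primitive primitiveE/=.
- exact: (derive_rprim (clocalRe lf) x0 cr).
- exact: (derive_rprim (clocalIm lf) x0 ci).
Qed.

Lemma continuous_primitive f (x : R) : clocal f -> 0 < x ->
  {for x, continuous (fun t => complex.Re (primitive f t))} /\
  {for x, continuous (fun t => complex.Im (primitive f t))}.
Proof.
move=> lf x0; split.
- rewrite (_ : (fun t => _) = rprim (fun t => complex.Re (f t))).
    exact: continuous_rprim (clocalRe lf) x0.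
  by apply/funext => t; rewrite /primitive primitiveE.
- rewrite (_ : (fun t => _) = rprim (fun t => complex.Im (f t))).
    exact: continuous_rprim (clocalIm lf) x0.
  by apply/funext => t; rewrite /primitive primitiveE.
Qed.

End Primitives.

(** * The integral equation *)

Section ContinuousCurves.
Context {R : realType}.
Local Notation mu := (@lebesgue_measure R).
Implicit Types (F G f : R -> R[i]) (t : R).

Definition ccontinuous_at F t :=
  complex.Re (F s) @[s --> t] --> complex.Re (F t) /\
  complex.Im (F s) @[s --> t] --> complex.Im (F t).

Lemma ccontinuousD F G t : ccontinuous_at F t -> ccontinuous_at G t ->
  ccontinuous_at (fun s => F s + G s) t.
Proof.
move=> [rF iF] [rG iG]; split.
- by under eq_fun do rewrite Re_add; rewrite Re_add; exact: cvgD.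
- by under eq_fun do rewrite Im_add; rewrite Im_add; exact: cvgD.
Qed.

Lemma ccontinuousM F G t : ccontinuous_at F t -> ccontinuous_at G t ->
  ccontinuous_at (fun s => F s * G s) t.
Proof.
move=> [rF iF] [rG iG]; split.
- by under eq_fun do rewrite Re_mul; rewrite Re_mul; apply: cvgB; exact: cvgM.
- by under eq_fun do rewrite Im_mul; rewrite Im_mul; apply: cvgD; exact: cvgM.
Qed.

Lemma ccontinuous_cst k t : ccontinuous_at (fun=> k) t.
Proof. by split; exact: cvg_cst. Qed.

Lemma cderive_continuous F t l : cderive F t l -> ccontinuous_at F t.
Proof. by move=> [dr di]; split; [exact: is_derive_continuous dr|exact: is_derive_continuous di]. Qed.

Lemma near_ccontinuous F G t : (\forall s \near t, F s = G s) ->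
  ccontinuous_at F t -> ccontinuous_at G t.
Proof.
move=> FG [rF iF]; have E := nbhs_singleton FG; split.
- rewrite -E; apply: cvg_trans rF.
  by apply: near_eq_cvg; apply: filterS FG => s ->.
- rewrite -E; apply: cvg_trans iF.
  by apply: near_eq_cvg; apply: filterS FG => s ->.
Qed.

Lemma cmeasurable_box_continuous f (c d : R) :
  (forall t, c <= t <= d -> ccontinuous_at f t) -> cmeasurable (fun t => box c d t * f t).
Proof.
move=> cf; have h (u : R -> R) : (forall t, c <= t <= d -> {for t, continuous u}) ->
    measurable_fun setT (fun t => \1_`[c, d] t * u t).
  move=> cu; have mu' : measurable_fun `[c, d] u.
    apply: subspace_continuous_measurable_fun => //.
    apply: continuous_in_subspaceT => t; rewrite inE/= in_itv/=; exact: cu.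
  rewrite (_ : (fun t => _) = u \_ `[c, d]).
    by apply/(measurable_restrictT u _).
  by apply/funext => t; rewrite patchE indicE; case: ifPn => _; rewrite ?mul1r ?mul0r.
split.
- under eq_fun do rewrite Re_mul Re_real Im_real mul0r subr0.
  by apply: h => t /cf[].
- under eq_fun do rewrite Im_mul Re_real Im_real mul0r addr0.
  by apply: h => t /cf[].
Qed.

Lemma cderive_cexp F t l : cderive F t l -> cderive (fun s => cexp (F s)) t (l * cexp (F t)).
Proof.
move=> [rF iF].
have dE := @is_derive_comp _ expR (fun s => complex.Re (F s)) _ _ _ (is_derive_expR _) rF.
have dC := @is_derive_comp _ cos (fun s => complex.Im (F s)) _ _ _ (is_derive_cos _) iF.
have dS := @is_derive_comp _ sin (fun s => complex.Im (F s)) _ _ _ (is_derive_sin _) iF.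
split.
- apply: is_derive_eq (is_derive_mul dE dC) _.
  by rewrite Re_mul /cexp/=; ring.
- apply: is_derive_eq (is_derive_mul dE dS) _.
  by rewrite Im_mul /cexp/=; ring.
Qed.

Lemma cderive0_cst F : (forall t, cderive F t 0) -> forall t, F t = F 0.
Proof.
move=> dF t; apply: complex_ext.
- by apply: (@is_derive_0_is_cst _ (fun s => complex.Re (F s))) => s; have [] := dF s.
- by apply: (@is_derive_0_is_cst _ (fun s => complex.Im (F s))) => s; have [] := dF s.
Qed.

Lemma clocal_bounded f g (K : R -> R) : clocal f -> cmeasurable g ->
  (forall M t, `|t| <= M -> normc (g t) <= K M) -> clocal (fun t => g t * f t).
Proof.
move=> [mf fi] mg gK; split; first exact: cmeasurableM.
move=> a b; pose M := Num.max `|a| `|b|.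
have iv := rintegrableZ (K M) (rintegrable_normc (fi a b)).
apply: le_cintegrable iv; first by apply: cmeasurableM; [exact: cmeasurable_box|exact: cmeasurableM].
move=> t; have [tM|Mt] := leP `|t| M; last by rewrite (box_support Mt) !mul0r ComplexField.Normc.normc0 mulr0.
rewrite mulrCA [normc (_ * _)]normcM.
apply: le_trans (ler_wpM2r _ (gK M t tM)) _ => //.
Qed.

End ContinuousCurves.

Section IntegralEquation.
Context {R : realType}.
Local Notation mu := (@lebesgue_measure R).
Variables (phi : R -> R[i]) (A : R[i]) (w : R).
Hypothesis phi_local : clocal phi.

(** The points at which the value of [phi] is determined by its integrals; almost every positive
    point is one. *)
Let good (x : R) := cderive (primitive phi) x (phi x).

Hypothesis phi_eq : forall p q : R, 0 < p -> p < q -> good p -> good q ->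
  q%:C * phi q - p%:C * phi p =
  cintegral (fun u => box p q u * ((A - (w * u)%:C) * phi u)).

Let psi u := (A - (w * u)%:C) * phi u.

Let psi_local : clocal psi.
Proof.
apply: (@clocal_bounded _ _ _ (fun M => normc A + `|w| * M)) => //.
  apply: cmeasurableB; first exact: cmeasurable_cst.
  by apply: cmeasurable_real; exact: measurable_scale.
move=> M t tM; apply: le_trans (normcB _ _) _.
by rewrite lerD2l normc_real normrM ler_wpM2l.
Qed.

Let Theta := primitive psi.

(** [x * phi x - Theta x] takes the same value at any two good points, so one good point fixes [k].
    Without a good positive point any [k] would do, because almost every positive point is good. *)
Let first_integral : exists k, {ae mu, forall x : R, 0 < x -> x%:C * phi x = k + Theta x}.
Proof.
have step p q : 0 < p -> p < q -> good p -> good q ->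
    q%:C * phi q - Theta q = p%:C * phi p - Theta p.
  move=> p0 pq gp gq; have := phi_eq p0 pq gp gq.
  rewrite primitive_sub//; last by rewrite !ltW.
  rewrite -/psi -/Theta => h.
  by rewrite -[q%:C * phi q](subrK (p%:C * phi p)) h; ring.
have [[x0 [x00 gx0]]|none] := pselect (exists x0, 0 < x0 /\ good x0); last first.
  exists 0; apply: ae_imp (ae_cderive_primitive phi_local) => x gx x0.
  by exfalso; apply: none; exists x; split => //; exact: gx.
exists (x0%:C * phi x0 - Theta x0).
apply: ae_imp (ae_cderive_primitive phi_local) => x gx x1.
have [xx|xx|<-] := ltgtP x x0; last by rewrite subrK.
- by rewrite (step x x0)// ?subrK//; exact: gx.
- by rewrite -(step x0 x)// ?subrK//; exact: gx.
Qed.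

(** A regularity bootstrap: [x * phi x] is almost everywhere the continuous [G = k + Theta], so the
    integrand of [Theta] is almost everywhere the continuous [H], so [G] is differentiable at every
    positive point with derivative [H]. *)
Lemma integral_equation_solution : exists C, {ae mu, forall x : R, 0 < x ->
  phi x = C * (x^-1)%:C * cexp ((ln x)%:C * A - (w * x)%:C)}.
Proof.
have [k phiG] := first_integral; pose G x := k + Theta x.
have cG x : 0 < x -> ccontinuous_at G x.
  move=> x0; apply: ccontinuousD; first exact: ccontinuous_cst.
  by have := continuous_primitive psi_local x0.
pose H t := (A - (w * t)%:C) * ((t^-1)%:C * G t).
have cV t : 0 < t -> ccontinuous_at (fun s : R => (s^-1)%:C) t.
  by move=> t0; split; [apply: inv_continuous; rewrite gt_eqF|exact: cvg_cst].
have cL t : cderive (fun s : R => A - (w * s)%:C) t (- w%:C).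
  rewrite -[- w%:C]sub0r; apply: cderiveB; first exact: cderive_cst.
  by apply: cderive_real; exact: is_derive_linear.
have cH t : 0 < t -> ccontinuous_at H t.
  move=> t0; apply: ccontinuousM; first exact: cderive_continuous (cL t).
  by apply: ccontinuousM; [exact: cV|exact: cG].
have psiH : {ae mu, forall t : R, 0 < t -> psi t = H t}.
  apply: ae_imp phiG => t pt t0; rewrite /psi /H /G -pt//; congr (_ * _).
  by rewrite mulrA -rmorphM/= mulVf ?gt_eqF// mul1r.
have dG x : 0 < x -> cderive G x (H x).
  (* [H] is known to be continuous on the positive axis only, so it is cut to a window around [x]
     that avoids 0. Continuity gives measurability there, integrability is inherited from [psi], and
     inside the window the primitives of both differ by a constant. *)
  move=> x0; pose c := x / 2; pose d := x + 1.
  have c0 : 0 < c by rewrite divr_gt0.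
  have cx : c < x by rewrite /c ltr_pdivrMr// ltr_pMr// ltr1n.
  have xd : x < d by rewrite ltrDl.
  pose f t := box c d t * H t.
  have mf : cmeasurable f.
    by apply: cmeasurable_box_continuous => t /andP[ct _]; apply: cH; exact: lt_le_trans ct.
  have box0 (t : R) : box c d t != 0 -> c <= t <= d.
    rewrite /box indicE; case: (boolP (t \in _)); rewrite ?eqxx// => + _.
    by rewrite inE/= in_itv.
  have fpsi a b : {ae mu, forall t : R, box a b t * f t = box a b t * (box c d t * psi t)}.
    apply: ae_imp psiH => t pt; rewrite /f.
    have [->|/box0/andP[ct _]] := eqVneq (box c d t) 0; first by rewrite !mul0r.
    by rewrite pt//; exact: lt_le_trans ct.
  have bpsi : clocal (fun t => box c d t * psi t).
    apply: (@clocal_bounded _ _ _ (fun=> 1)) => //; first exact: cmeasurable_box.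
    by move=> M t _; exact: normc_box_le1.
  have lf : clocal f.
    split => // a b; have [m1 i1] := bpsi.
    have mab : cmeasurable (fun t => box a b t * f t).
      by apply: cmeasurableM => //; exact: cmeasurable_box.
    apply: cintegrable_normc => //; apply: ae_eq_rintegrable (rintegrable_normc (i1 a b)).
    - by apply: measurable_normc; apply: cmeasurableM => //; exact: cmeasurable_box.
    - exact: measurable_normc.
    - by apply: ae_imp (fpsi a b) => t ->.
  have df : cderive (primitive f) x (f x).
    have [fr fi] : ccontinuous_at f x.
      apply: near_ccontinuous (cH x x0); near=> t.
      rewrite /f /box indicE mem_set ?mul1r//= in_itv/=.
      by apply/andP; split; near: t; [exact: lt_le_nbhsr|exact: lt_le_nbhsl].
    exact: cderive_primitive.
  have fx : f x = H x.
    by rewrite /f /box indicE mem_set ?mul1r//= in_itv/= !ltW.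
  rewrite -fx.
  apply: near_cderive (cderive_eq (cderiveD (cderive_cst (G c - primitive f c) x) df) (add0r _)).
  near=> y.
  have cy : c <= y by near: y; exact: lt_le_nbhsr.
  have yd : y <= d by near: y; exact: lt_le_nbhsl.
  have e1 := primitive_sub psi_local (_ : 0 <= c <= y).
  have e2 := primitive_sub lf (_ : 0 <= c <= y).
  have cy' : 0 <= c <= y by rewrite ltW.
  have : cintegral (fun t => box c y t * psi t) = cintegral (fun t => box c y t * f t).
    apply: ae_eq_cintegral.
    - by apply: cmeasurableM; [exact: cmeasurable_box|case: psi_local].
    - by apply: cmeasurableM => //; exact: cmeasurable_box.
    apply: ae_imp (fpsi c y) => t ->.
    rewrite /box !indicE; case: (boolP (t \in [set` `[c, y]])) => [|_]; last by rewrite !mul0r.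
    rewrite inE/= in_itv/= => /andP[ct ty].
    by rewrite mem_set ?mul1r//= in_itv/= ct (le_trans ty).
  rewrite e1// e2// /G -/Theta => e.
  by rewrite -[X in _ = k + X](subrK (Theta c)) e; ring.
(* Integrating factor: the inverse of the expected solution [x^A exp (- w x)]. *)
pose E x := cexp ((w * x)%:C - (ln x)%:C * A).
have dE x : 0 < x -> cderive E x ((w%:C - (x^-1)%:C * A) * E x).
  move=> x0; apply: cderive_cexp; apply: cderiveB.
    by apply: cderive_real; exact: is_derive_linear.
  apply: cderive_eq (cderiveM (cderive_real (is_derive1_ln x0)) (cderive_cst A x)) _.
  by rewrite mulr0 addr0.
have dGE x : 0 < x -> cderive (fun s => G s * E s) x 0.
  move=> x0; apply: cderive_eq (cderiveM (dG x x0) (dE x x0)) _.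
  rewrite /H; have -> : w%:C = (w * x)%:C * (x^-1)%:C :> R[i].
    by rewrite -rmorphM/= mulfK ?gt_eqF.
  ring.
have GE x : 0 < x -> G x * E x = G 1 * E 1.
  (* The substitution [x = expR s] transports the positive axis to the whole line, where a vanishing
     derivative forces a constant. *)
  move=> x0; have := @cderive0_cst _ (fun s => G (expR s) * E (expR s)) _ (ln x).
  rewrite expR0 lnK// => -> // t.
  apply: cderive_eq (cderive_comp_real (dGE _ (expR_gt0 t)) (is_derive_expR t)) _.
  by rewrite mulr0.
exists (G 1 * E 1); apply: ae_imp phiG => x px x0.
have EN : E x * cexp ((ln x)%:C * A - (w * x)%:C) = 1.
  by rewrite /E -cexpD addrA subrK subrr cexp0.
have xV : x%:C * (x^-1)%:C = 1 :> R[i] by rewrite -rmorphM/= mulfV ?gt_eqF.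
have -> : G 1 * E 1 * (x^-1)%:C * cexp ((ln x)%:C * A - (w * x)%:C) =
    G x * (x^-1)%:C * (E x * cexp ((ln x)%:C * A - (w * x)%:C)) by rewrite -(GE x x0); ring.
by rewrite EN mulr1 /G -px// mulrAC xV mul1r.
Unshelve. all: by end_near. Qed.

End IntegralEquation.

(** * Necessity *)

Section TestSignals.
Context {R : realType}.
Local Notation mu := (@lebesgue_measure R).
Local Notation chr a := (cexp (0 +i* a)).

Definition band_signal (p q t : R) : R[i] :=
  cintegral (fun x => box p q x * chr (2 * pi * x * t)).

Lemma L2_band_signal (p q : R) : L2 (band_signal p q).
Proof.
rewrite (_ : band_signal p q = fun t => conjc (fourierL1 (box p q) t)).
  exact/L2_conj/L2_fourier_box.
apply/funext => t; rewrite /band_signal inverse_fourierE; last exact: cintegrable_box.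
congr (conjc (fourierL1 _ t)); apply/funext => x.
by apply: complex_ext; rewrite !ReImE//= oppr0.
Qed.

Lemma box_scale (p q y u : R) : 0 < y -> box p q (y^-1 * u) = box (p * y) (q * y) u.
Proof.
move=> y0; rewrite /box !indicE; congr ((nat_of_bool _)%:R%:C).
by apply/idP/idP; rewrite !inE/= !in_itv/= ler_pdivlMl// ler_pdivrMl// ![y * _]mulrC.
Qed.

(** The substitution [t = y * v + x] moves translation and dilation onto the signal, whose spectrum
    is explicit and integrable; [weak_Parseval] then applies with [psi] as the arbitrary
    function. *)
Lemma wavelet_band_signal psi (p q x y : R) : L2 psi -> 0 < y ->
  wavelet psi (band_signal p q) x y = ((Num.sqrt y)^-1)%:C *
    cintegral (fun u => box (p * y) (q * y) u *
      (conjc (fourier psi u) * chr (2 * pi * u * (x / y)))).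
Proof.
move=> pL2 y0; have y1 : y != 0 by rewrite gt_eqF.
have sL2 := L2_band_signal p q.
rewrite /wavelet; congr (_ * _).
rewrite (cintegral_affine x y1); last first.
  by apply: cintegrable_mulL2 => //; apply: L2_conj; exact: L2_dilation.
under eq_fun do rewrite addrK [_ / y]mulrC mulKf//.
rewrite gtr0_norm//.
pose eta u : R[i] := (y^-1)%:C * (box (p * y) (q * y) u * chr (2 * pi * u * (x / y))).
have mc : measurable_fun setT (fun u : R => 2 * pi * u * (x / y)).
  by apply: measurable_funM => //; exact: measurable_scale.
have etaL2 : L2 eta by apply: L2Z; apply: L2_chr => //; exact: L2_box.
have etai : cintegrable eta.
  by apply: cintegrableZ; apply: cintegrable_chr => //; exact: cintegrable_box.
have sE v : band_signal p q (y * v + x) = cintegral (fun u => eta u * chr (2 * pi * u * v)).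
  rewrite /band_signal.
  have yV : 0 < y^-1 by rewrite invr_gt0.
  rewrite (cintegral_scale yV); last by apply: cintegrable_chr_lin; exact: cintegrable_box.
  rewrite -cintegralZ; last first.
    have := cintegrable_scale yV (cintegrable_chr_lin (y * v + x) (cintegrable_box p q)).
    exact.
  congr cintegral; apply/funext => u; rewrite /eta box_scale// -!mulrA; congr (_ * (_ * _)).
  rewrite -chrD; congr (chr _).
  by move: (@pi R) => c; field.
under eq_fun do rewrite sE.
rewrite weak_Parseval//; last first.
  by under eq_fun do rewrite -sE; exact: L2_affine.
rewrite -cintegralZ; last first.
  by apply: cintegrable_mulL2 => //; apply: L2_conj; exact: L2_fourier.
congr cintegral; apply/funext => u; rewrite /eta.
rewrite !mulrA -rmorphM/= mulfV// mul1r -!mulrA; congr (_ * _); exact: mulrC.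
Qed.

Variables (psi : R -> R[i]) (a b : R).
Hypotheses (psiL2 : L2 psi) (b0 : 0 < b).

(** The shift [- a * b * y] divided by the scale [b * y] is the constant [- a], so it contributes a
    phase that depends on neither [x] nor [y] and can be merged with the spectrum. *)
Definition twisted (u : R) : R[i] := conjc (fourier psi u) * chr (- (2 * pi * a * u)).

Lemma L2_twisted : L2 twisted.
Proof.
apply: L2_chr; last exact/L2_conj/L2_fourier.
by apply: measurableT_comp => //; exact: measurable_scale.
Qed.

Lemma clocal_twisted : clocal twisted.
Proof.
split; first exact/L2_measurable/L2_twisted.
by move=> c d; apply: cintegrable_mulL2; [exact: L2_box|exact: L2_twisted].
Qed.

Lemma wavelet_twisted (p q x y : R) : 0 < y ->
  wavelet psi (band_signal (p / b) (q / b)) (x - a * b * y) (b * y) =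
  ((Num.sqrt (b * y))^-1)%:C * cintegral (fun u => box (p * y) (q * y) u *
     (twisted u * chr (2 * pi * u * (x / (b * y))))).
Proof.
move=> y0; have by0 : 0 < b * y by rewrite mulr_gt0.
have [b1 y1] : b != 0 /\ y != 0 by rewrite !gt_eqF.
rewrite wavelet_band_signal//; congr (_ * cintegral _); apply/funext => u.
have bE r : r / b * (b * y) = r * y by rewrite mulrA divfK.
rewrite !bE /twisted -[conjc _ * _ * _]mulrA; congr (_ * (_ * _)).
rewrite -chrD; congr (chr _); move: (@pi R) => c; field; exact/andP.
Qed.

End TestSignals.

(** * Partial derivatives of the transforms of band signals *)

Section DifferentiatedTransforms.
Context {R : realType}.
Local Notation mu := (@lebesgue_measure R).
Local Notation chr a := (cexp (0 +i* a)).

Lemma normc_imag (r : R) : normc (0 +i* r) = `|r|.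
Proof. by rewrite /ComplexField.Normc.normc expr0n add0r sqrtr_sqr. Qed.

Lemma cmeasurable_imag (u : R -> R) : measurable_fun setT u ->
  cmeasurable (fun t => 0 +i* u t).
Proof. by move=> mu'; split => //; exact: measurable_cst. Qed.

(** Differentiation under the integral sign: the frequencies [w * u] are bounded by [B] on the box,
    so the second-order remainder of the exponential is at most a constant times [s ^+ 2] uniformly
    in [u]. *)
Lemma cderive_modulated (g : R -> R[i]) (p q w : R) : clocal g ->
  cderive (fun t => cintegral (fun u => box p q u * (g u * chr (t * (w * u))))) 0
    (cintegral (fun u => box p q u * (g u * (0 +i* (w * u))))).
Proof.
move=> lg; pose M : R := Num.max `|p| `|q|; pose B : R := `|w| * M.
have M0 : 0 <= M by rewrite le_max normr_ge0.
have boundwu (u : R) : `|u| <= M -> `|w * u| <= B by move=> uM; rewrite normrM ler_wpM2l.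
have mw : measurable_fun setT (fun u : R => w * u) := measurable_scale w.
have ig : cintegrable (fun u => box p q u * g u) by case: lg.
have ic t : cintegrable (fun u => box p q u * (g u * chr (t * (w * u)))).
  under eq_fun do rewrite mulrA; apply: cintegrable_chr => //.
  exact: measurable_funM.
have iJ : cintegrable (fun u => box p q u * (g u * (0 +i* (w * u)))).
  have bw (K t : R) : `|t| <= K -> normc (0 +i* (w * t)) <= `|w| * K.
    by move=> tK; rewrite normc_imag normrM ler_wpM2l.
  have [_ /(_ p q)] := clocal_bounded lg (cmeasurable_imag mw) bw.
  by under eq_fun do rewrite [(0 +i* _) * _]mulrC.
pose N := \int[mu]_u normc (box p q u * g u).
apply: (@cderive_of_bound _ _ _ _ (4 * (B ^+ 2 * expR B) * N)) => s s1.
rewrite add0r -cintegralB// -cintegralZ// -cintegralB//; last 2 first.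
- exact: cintegrableB.
- exact: cintegrableZ.
have E u : box p q u * (g u * chr (s * (w * u))) - box p q u * (g u * chr (0 * (w * u))) -
    s%:C * (box p q u * (g u * (0 +i* (w * u)))) =
    box p q u * g u * (chr (s * (w * u)) - 1 - (0 +i* (s * (w * u)))).
  have -> : chr (0 * (w * u)) = 1 by rewrite mul0r cexp0.
  have -> : 0 +i* (s * (w * u)) = s%:C * (0 +i* (w * u)) by apply: complex_ext; rewrite !ReImE/=; ring.
  ring.
under eq_fun do rewrite E.
have iE : cintegrable (fun u => box p q u * g u * (chr (s * (w * u)) - 1 - (0 +i* (s * (w * u))))).
  under eq_fun do rewrite -E; apply: cintegrableB; [exact: cintegrableB|exact: cintegrableZ].
apply: le_trans (normc_cintegral iE) _.
have -> : 4 * (B ^+ 2 * expR B) * N * s ^+ 2 =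
    \int[mu]_u (4 * (B ^+ 2 * expR B) * s ^+ 2 * normc (box p q u * g u)).
  by rewrite RintegralZl//; [rewrite /N; ring|exact: rintegrable_normc].
apply: le_rintegral.
- exact: rintegrable_normc.
- by apply: rintegrableZ; exact: rintegrable_normc.
move=> u; rewrite normcM.
have [uM|Mu] := leP `|u| M; last first.
  by rewrite (box_support Mu) !mul0r ComplexField.Normc.normc0 mul0r mulr0.
rewrite mulrC ler_wpM2r//.
apply: le_trans (normc_cexpB1B _) _; rewrite normc_imag -mulrA ler_pM2l//.
have h : `|s * (w * u)| <= B.
  by rewrite normrM (le_trans _ (boundwu u uM))// ler_piMl// ltW.
rewrite [leRHS]mulrAC; apply: ler_pM.
- exact: sqr_ge0.
- exact: expR_ge0.
- rewrite -[s ^+ 2]real_normK ?num_real// -exprMn [B * _]mulrC normrM.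
  by rewrite ler_sqr ?nnegrE ?mulr_ge0// ler_wpM2l// boundwu.
- by rewrite ler_expR.
Qed.

Lemma derivable_fst (u : R * R -> R) (x y : R) : derivable u (x, y) (1, 0) ->
  exists a, is_derive x 1 (fun t => u (t, y)) a.
Proof.
move=> du; exists ('D_1 (fun t => u (t, y)) x); apply/derivableP.
move: du; rewrite /derivable; set F := (F in F @ _); set G := (G in _ -> cvg (G @ _)).
suff -> : F = G by [].
by apply/funext => h; rewrite /F /G /=; congr (_ *: (u (_, _) - _)); rewrite /= scaler0 add0r.
Qed.

Lemma derivable_snd (u : R * R -> R) (x y : R) : derivable u (x, y) (0, 1) ->
  exists a, is_derive y 1 (fun t => u (x, t)) a.
Proof.
move=> du; exists ('D_1 (fun t => u (x, t)) y); apply/derivableP.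
move: du; rewrite /derivable; set F := (F in F @ _); set G := (G in _ -> cvg (G @ _)).
suff -> : F = G by [].
by apply/funext => h; rewrite /F /G /=; congr (_ *: (u (_, _) - _)); rewrite /= scaler0 add0r.
Qed.

Lemma smooth_on_partials (f : R -> R -> R[i]) (x y : R) :
  smooth_on [set p | 0 < p.2] f -> 0 < y ->
  (exists l, cderive (fun t => f t y) x l) /\ (exists l, cderive (f x) y l).
Proof.
move=> /(_ 1%N)[[_ [r _ _]] [_ [i _ _]]] y0.
have [[r1 r2] [i1 i2]] := (r (x, y) y0, i (x, y) y0).
split.
- have [[a da] [c dc]] := (derivable_fst r1, derivable_fst i1).
  by exists (a +i* c).
- have [[a da] [c dc]] := (derivable_snd r2, derivable_snd i2).
  by exists (a +i* c).
Qed.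

(** Only the ends of the interval move with [y], so the integral is a difference of two primitives
    composed with linear maps. *)
Lemma cderive_dilated_primitive (g : R -> R[i]) (p q : R) : 0 < p -> p < q -> clocal g ->
  cderive (primitive g) p (g p) -> cderive (primitive g) q (g q) ->
  cderive (fun y => cintegral (fun u => box (p * y) (q * y) u * g u)) 1
    (q%:C * g q - p%:C * g p).
Proof.
move=> p0 pq lg dp dq.
have d r : cderive (primitive g) r (g r) -> cderive (fun y => primitive g (r * y)) 1 (r%:C * g r).
  move=> dr; apply: cderive_comp_real; last exact: is_derive_linear.
  by rewrite mulr1.
apply: near_cderive (cderiveB (d q dq) (d p dp)); near=> y.
have y0 : 0 < y by near: y; exact: lt_nbhsr.
rewrite primitive_sub//; apply/andP; split; first by apply: mulr_ge0; exact: ltW.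
by rewrite ler_pM2r// ltW.
Unshelve. all: by end_near. Qed.

Lemma is_derive_sqrtV (b : R) : 0 < b ->
  is_derive (1 : R) 1 (fun y => (Num.sqrt (b * y))^-1) (- ((Num.sqrt b)^-1 / 2)).
Proof.
move=> b0.
have E (y : R) : 0 < y -> (Num.sqrt b)^-1 * expR (- 2^-1 * ln y) = (Num.sqrt (b * y))^-1.
  move=> y0; rewrite sqrtrM ?ltW// invfM; congr (_ * _).
  by rewrite -powR12_sqrt ?ltW// /powR gt_eqF// -expRN mulNr.
have dl := is_derive1_ln (@ltr01 R).
have dE := is_derive_scale (Num.sqrt b)^-1 (@is_derive_comp _ expR (fun t => - 2^-1 * ln t) _ _ _
  (is_derive_expR _) (is_derive_scale (- 2^-1) dl)).
have {}dE := is_derive_eq dE (_ : _ = - ((Num.sqrt b)^-1 / 2)).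
apply: (@near_eq_is_derive _ _ _ (fun t => (Num.sqrt b)^-1 * expR (- 2^-1 * ln t))).
- by near=> y; rewrite E//; near: y; exact: lt_nbhsr.
- by apply: dE; rewrite ln1 mulr0 expR0 invr1; ring.
Unshelve. all: by end_near. Qed.

End DifferentiatedTransforms.

(** * Singularities excluded by square integrability *)

Section SingularFunctions.
Context {R : realType}.
Local Notation mu := (@lebesgue_measure R).

(** On []0, e]] the bound is at least the constant [K * e ^- 2], with integral [K / e]; the choice
    of [e] makes this [K + E + 1], more than the whole energy [E]. *)
Lemma L2_not_singular (g : R -> R[i]) (K : R) : 0 < K -> L2 g ->
  ~ {ae mu, forall x : R, 0 < x -> x < 1 -> K * x ^- 2 <= normc (g x) ^+ 2}.
Proof.
move=> K0 /L2P[mg ig] gK; pose E := energy g.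
pose e : R := K / (K + E + 1).
have E0 : 0 <= E by exact: energy_ge0.
have d0 : 0 < K + E + 1 by lra.
have e0 : 0 < e by rewrite divr_gt0.
have e1 : e < 1 by rewrite ltr_pdivrMr// mul1r; lra.
pose u (x : R) := K * e ^- 2 * \1_`]0, e] x.
have mu' : measurable_fun setT u by apply: measurable_funM => //; exact: measurable_indic.
have u0 x : 0 <= u x.
  by rewrite mulr_ge0// ?mulr_ge0 ?invr_ge0 ?sqr_ge0// ltW.
(* The minimum is below the energy density everywhere and equals [u] almost everywhere, which turns
   the almost everywhere bound into a pointwise one. *)
pose v x := Num.min (u x) (normc (g x) ^+ 2).
have mg2 := measurable_normc_sqr mg.
have mv : measurable_fun setT v by exact: measurable_minr.
have iv : rintegrable v.
  apply: le_rintegrable ig => // x.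
  by rewrite ger0_norm ?ge_min ?lexx ?orbT// le_min u0 sqr_ge0.
have uv : {ae mu, forall x, u x = v x}.
  apply: ae_imp gK => x gx; apply/esym/min_idPl; rewrite /u indicE.
  case: (boolP (x \in [set` `]0, e]])) => [|_]; last by rewrite mulr0 sqr_ge0.
  rewrite inE/= in_itv/= mulr1 => /andP[x0 xe].
  apply: le_trans (gx x0 (le_lt_trans xe e1)); rewrite ler_wpM2l ?(ltW K0)//.
  by rewrite lef_pV2 ?posrE ?exprn_gt0// ler_sqr ?nnegrE ?(ltW x0) ?(ltW e0).
have : \int[mu]_x u x <= E.
  by rewrite (ae_eq_Rintegral mu' mv uv); apply: le_rintegral => // x; rewrite ge_min lexx orbT.
rewrite RintegralZl//; last exact: rintegrable_indic_itv.
rewrite (_ : \int[mu]_x \1_`]0, e] x = e); last first.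
  rewrite /Rintegral integral_indic// setIT.
  by have /= := @lebesgue_measure_itv R `]0, e]; rewrite lte_fin e0 sube0 => ->.
have -> : K * e ^- 2 * e = K + E + 1.
  by rewrite /e; field; rewrite !gt_eqF.
lra.
Qed.

End SingularFunctions.

(** * From analyticity to the spectral formula *)

Section Necessity.
Context {R : realType}.
Local Notation mu := (@lebesgue_measure R).
Local Notation chr a := (cexp (0 +i* a)).
Variables (psi : R -> R[i]) (a b : R) (f : R -> R -> R[i]).
Hypotheses (psiL2 : L2 psi) (b0 : 0 < b).
Hypothesis f_smooth : smooth_on [set p | 0 < p.2] f.
Hypothesis f_neq0 : forall x y : R, 0 < y -> f x y <> 0.
Hypothesis f_analytic : forall s, L2 s -> analytic_on upper_half_plane
  (fun z => let x := complex.Re z in let y := complex.Im z in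
            f x y * wavelet psi s (x - a * b * y) (b * y)).

Let phi := twisted psi a.
Let phi_local : clocal phi. Proof. exact: clocal_twisted. Qed.
Let w : R := 2 * pi / b.

Lemma cauchy_riemann_equation : exists A, forall p q : R, 0 < p -> p < q ->
  cderive (primitive phi) p (phi p) -> cderive (primitive phi) q (phi q) ->
  q%:C * phi q - p%:C * phi p =
  cintegral (fun u => box p q u * ((A - (w * u)%:C) * phi u)).
Proof.
have [[fx dfx] _] := smooth_on_partials 0 f_smooth (@ltr01 R).
have [_ [fy dfy]] := smooth_on_partials 0 f_smooth (@ltr01 R).
have f0 : f 0 1 != 0 by apply/eqP; apply: f_neq0.
pose i : R[i] := 0 +i* 1.
(* [A] comes from solving [h_y = i * h_x] at the point [i] for the boundary term: [2^-1] stems from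
   the derivative of [1 / sqrt (b y)], the quotient from the partials of [f]. *)
exists (2^-1%:C + (i * fx - fy) / f 0 1) => p q p0 pq dp dq.
have q0 : 0 < q := lt_trans p0 pq.
pose F x y := wavelet psi (band_signal (p / b) (q / b)) (x - a * b * y) (b * y).
pose k : R[i] := ((Num.sqrt b)^-1)%:C.
pose I := cintegral (fun u => box p q u * phi u).
pose J := cintegral (fun u => box p q u * (phi u * (0 +i* (w * u)))).
pose D := q%:C * phi q - p%:C * phi p.
have k0 : k != 0.
  by rewrite fmorph_eq0 invr_eq0 gt_eqF// sqrtr_gt0.
have Fx t : F t 1 = k * cintegral (fun u => box p q u * (phi u * chr (t * (w * u)))).
  rewrite /F wavelet_twisted// !mulr1; congr (_ * cintegral _); apply/funext => u.
  by congr (_ * (_ * chr _)); rewrite /w; ring.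
have Fy y : 0 < y -> F 0 y = ((Num.sqrt (b * y))^-1)%:C *
    cintegral (fun u => box (p * y) (q * y) u * phi u).
  move=> y0; rewrite /F wavelet_twisted//; congr (_ * cintegral _); apply/funext => u.
  by rewrite mul0r mulr0 cexp0 mulr1.
have FI : F 0 1 = k * I by rewrite Fy// !mulr1.
have dFx : cderive (fun t => F t 1) 0 (k * J).
  under eq_fun do rewrite Fx.
  apply: cderive_eq (cderiveM (cderive_cst k 0) (cderive_modulated p q w phi_local)) _.
  by rewrite mul0r add0r.
have dFy : cderive (F 0) 1 (k * D - k * 2^-1%:C * I).
  have d := cderiveM (cderive_real (is_derive_sqrtV b0))
    (cderive_dilated_primitive p0 pq phi_local dp dq).
  apply: near_cderive (cderive_eq d _).
    by near=> y; rewrite Fy//; near: y; exact: lt_nbhsr.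
  rewrite !mulr1 -/D -/I -/k rmorphN/= rmorphM/= -/k; ring.
have z0 : upper_half_plane i by rewrite /upper_half_plane/= ltr01.
have [l [dx dy]] := cderive_of_derivable (f_analytic (L2_band_signal (p / b) (q / b)) z0).
have ex : fx * F 0 1 + f 0 1 * (k * J) = l.
  apply: cderive_unique (cderiveM dfx dFx) _.
  by move: dx; under eq_fun do rewrite !ReImE/= addr0 add0r.
have ey : fy * F 0 1 + f 0 1 * (k * D - k * 2^-1%:C * I) = i * l.
  apply: cderive_unique (cderiveM dfy dFy) _.
  (* [dy] is a derivative at 0 along [t] mapped to [i + i t]; the shift [t = y - 1] turns it into a
     derivative in the ordinate at 1. *)
  have h : is_derive (1:R) 1 (fun y : R => y - 1) 1.
    by apply: is_derive_eq (is_derive_add (is_derive_id _ _) (is_derive_const _ _)) (addr0 _).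
  have := @cderive_comp_real _ _ (fun y : R => y - 1) 1 _ _ _ h.
  rewrite subrr => /(_ _ _ dy); rewrite mul1r.
  by under eq_fun do rewrite !ReImE/= addr0 subrK.
pose K := cintegral (fun u => box p q u * ((w * u)%:C * phi u)).
have iphi : cintegrable (fun u => box p q u * phi u) by case: phi_local.
have iwphi : cintegrable (fun u => box p q u * ((w * u)%:C * phi u)).
  have mw : cmeasurable (fun u : R => (w * u)%:C) by apply: cmeasurable_real; exact: measurable_scale.
  have bw (M t : R) : `|t| <= M -> normc (w * t)%:C <= `|w| * M.
    by move=> tM; rewrite normc_real normrM ler_wpM2l.
  by have [_ /(_ p q)] := clocal_bounded phi_local mw bw.
have ii : i * i = -1 by apply: complex_ext; rewrite !ReImE/=; ring.
have JK : J = i * K.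
  rewrite -cintegralZ//; congr cintegral; apply/funext => u.
  have -> : 0 +i* (w * u) = i * (w * u)%:C by apply: complex_ext; rewrite !ReImE/=; ring.
  ring.
pose r := (i * fx - fy) / f 0 1; pose h : R[i] := 2^-1%:C.
have fr : f 0 1 * r = i * fx - fy by rewrite mulrC divfK.
have -> : cintegral (fun u => box p q u * ((h + r - (w * u)%:C) * phi u)) = (h + r) * I - K.
  rewrite -cintegralZ// -cintegralB//; last exact: cintegrableZ.
  by congr cintegral; apply/funext => u; ring.
apply: (mulfI k0); apply: (mulfI f0); rewrite -/D.
have -> : f 0 1 * (k * D) = i * l - fy * F 0 1 + f 0 1 * (k * h * I) by rewrite -ey; ring.
have -> : i * l - fy * F 0 1 + f 0 1 * (k * h * I) =
    (i * fx - fy) * (k * I) + (i * i) * (f 0 1 * (k * K)) + f 0 1 * (k * h * I).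
  by rewrite -ex FI JK; ring.
by rewrite ii -fr; ring.
Unshelve. all: by end_near. Qed.


Lemma analytic_wavelet_necessary : exists (c : R[i]) (alpha beta : R) (gamma : R[i]),
  [/\ - 1 < alpha, 0 < complex.Re gamma
    & {ae mu, forall xi : R, 0 < xi -> fourier psi xi =
         c * (xi `^ ((alpha - 1) / 2))%:C * cexp (- (2 * pi * xi)%:C * gamma)
           * cexp (0 +i* (beta * ln xi))}].
Proof.
have [A phi_eq] := cauchy_riemann_equation.
have [C phiE] := integral_equation_solution phi_local phi_eq.
have fourierE x : fourier psi x = conjc (phi x) * chr (- (2 * pi * a * x)).
  rewrite /phi /twisted rmorphM/= conjcK chr_conj -[RHS]mulrA -chrD opprK subrr.
  by rewrite cexp0 mulr1.
have gamma0 : 0 < complex.Re (b^-1 +i* a) by rewrite /= invr_gt0.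
(* If [C] vanishes the spectrum is zero and says nothing about [A], so an arbitrary admissible
   [alpha] is chosen. *)
have [C0|C0] := eqVneq C 0.
  exists 0, 0, 0, (b^-1 +i* a); split => //.
  apply: ae_imp phiE => x px x0; rewrite fourierE px// C0.
  by rewrite !mul0r rmorph0 mul0r.
(* Conjugating [C x^(A - 1) exp (- w x)] and undoing the twist gives [(alpha - 1) / 2 = Re A - 1],
   [beta = - Im A] and, since [w = 2 pi / b], [gamma = 1 / b + i a]. *)
exists (conjc C), (2 * complex.Re A - 1), (- complex.Im A), (b^-1 +i* a); split => //.
- suff : 0 < complex.Re A by lra.
  (* If [Re A <= 0], the modulus of [phi x] on [0 < x < 1] is at least [|C| exp (- |w|) / x], which
     contradicts square integrability at 0. *)
  rewrite ltNge; apply/negP => A0.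
  have nC : 0 < normc C.
    rewrite lt_def normc_ge0 andbT; apply: contra C0 => /eqP/ComplexField.Normc.eq0_normc ->//.
  apply: (@L2_not_singular _ phi ((normc C * expR (- `|w|)) ^+ 2)).
  + by rewrite exprn_gt0// mulr_gt0// expR_gt0.
  + exact: L2_twisted.
  apply: ae_imp phiE => x px x0 x1; rewrite px//.
  rewrite -exprVn -exprMn ler_sqr ?nnegrE//; last first.
    by rewrite !mulr_ge0 ?invr_ge0 ?expR_ge0// ltW.
  rewrite [leRHS]normcM [normc (C * _)]normcM normc_real normc_cexp mulrAC.
  have xV0 : 0 <= x^-1 by rewrite invr_ge0 ltW.
  rewrite [`|x^-1|]ger0_norm//; apply: ler_wpM2l; first exact: mulr_ge0.
  rewrite ler_expR !ReImE/= mul0r subr0.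
  have l0 : ln x <= 0 by rewrite ln_le0// ltW.
  have h1 : 0 <= ln x * complex.Re A by rewrite mulr_le0.
  have h2 : w * x <= `|w|.
    by rewrite (le_trans (ler_norm _))// normrM ler_piMr// ger0_norm ltW.
  lra.
- apply: ae_imp phiE => x px x0; rewrite fourierE px//.
  have realE (r : R) : (expR r)%:C = cexp (r +i* 0).
    by apply: complex_ext; rewrite /cexp/= ?cos0 ?sin0 ?mulr1 ?mulr0.
  have -> : (x^-1)%:C = cexp (- ln x +i* 0) by rewrite -realE expRN lnK.
  rewrite /powR gt_eqF// realE !rmorphM/= !cexp_conj -!mulrA -!cexpD.
  congr (_ * cexp _); apply: complex_ext; rewrite !ReImE/= /w; move: (@pi R) (ln x) => c l.
    by field; rewrite gt_eqF.
  by field; rewrite gt_eqF.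
Qed.

End Necessity.

Theorem theorem2 (R : realType) (psi : R -> R[i])
    (psiL2 : L2 psi)
    (psi_hardy : {ae (@lebesgue_measure R),
                    forall xi : R, xi < 0 -> fourier psi xi = 0}) :
  (exists (a b : R) (f : R -> R -> R[i]),
     [/\ 0 < b,
         smooth_on [set p | 0 < p.2] f,
         (forall x y : R, 0 < y -> f x y <> 0)
       & forall s : R -> R[i], L2 s ->
           analytic_on upper_half_plane
             (fun z => let x := complex.Re z in let y := complex.Im z in
                       f x y * wavelet psi s (x - a * b * y) (b * y))])
  <->
  (exists (c : R[i]) (alpha beta : R) (gamma : R[i]),
     [/\ - 1 < alpha,
         0 < complex.Re gamma
       & {ae (@lebesgue_measure R), forall xi : R, 0 < xi ->
            fourier psi xi =
              c * (xi `^ ((alpha - 1) / 2))%:C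
                * cexp (- (2 * pi * xi)%:C * gamma)
                * cexp (0 +i* (beta * ln xi))}]).
Proof.
split=> [[a] [b] [f] [b0 fs fn fa]|[c] [alpha] [beta] [gamma] [_ gamma0 psiE]].
- exact: analytic_wavelet_necessary psiL2 b0 fs fn fa.
- exact: analytic_wavelet_sufficient psiL2 gamma0 psi_hardy psiE.
Qed.
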